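(* Let $M$ be a smooth $n$-dimensional manifold and let $g(\cdot)$ satisfy the Ricci flow equation $\frac{\partial g}{\partial t} = -2\operatorname{Ric}$ on $M$. Let $\Sigma$ be an $(n-1)$-dimensional manifold and let $\{e(t)\}$ be a smooth one-parameter family of immersions of $\Sigma$ in $M$, with image $\Sigma_t$ (viewed as a parametrized hypersurface), evolving by the mean curvature flow $$\frac{dx}{dt} = He_0 .$$ Then $$\frac{\partial g_{ij}}{\partial t} = -2R_{ij} - 2HA_{ij},$$ $$\frac{\partial A_{ij}}{\partial t} = (\widehat\triangle A)_{ij} - A^k_{\ i}R^l_{\ klj} - A^k_{\ j}R^l_{\ kli} + 2A^{kl}R_{kilj} - 2HA_{ik}A^k_{\ j} + A^{kl}A_{kl}A_{ij} + \nabla_0R_{0i0j}$$ and $$\frac{\partial H}{\partial t} = \widehat\triangle H + 2A^{ij}R_{ij} + A^{ij}A_{ij}H + \nabla_0R_{00}.$$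
   Context: All quantities at time $t$ are with respect to $g(t)$. $e_0$ is a (local) unit normal to $\Sigma_t$ varying smoothly in $t$, $A(X,Y)=g(e_0,\nabla_XY)$ is the second fundamental form of $\Sigma_t$ and $H=g^{ij}A_{ij}$ the mean curvature (the vector $He_0$ is independent of the choice of $e_0$). The time derivatives are taken at fixed points of $\Sigma$, with $g_{ij}$ (the induced metric) and $A_{ij}$ pulled back to $\Sigma$ by $e(t)$. $\widehat\nabla$ is the Levi-Civita connection of the induced metric and $\widehat\triangle=g^{ij}\widehat\nabla_i\widehat\nabla_j$. Summation convention: Latin indices run only over the $n-1$ directions tangent to $\Sigma_t$ (so $R^l_{\ klj}$ is a sum over tangential $l$ only) and the index $0$ denotes the direction $e_0$. $R_{\alpha\beta\gamma\delta}$ and $R_{\alpha\beta}$ are the Riemann and Ricci tensors of $M$, with sign convention such that $R_{\beta\delta}=R^\alpha_{\ \beta\alpha\delta}$ (so $R_{\alpha\beta\alpha\beta}>0$ on round spheres for orthonormal directions). $\nabla_0R_{0i0j}=(\nabla_{e_0}\mathrm{Rm})(e_0,\partial_i,e_0,\partial_j)$ and $\nabla_0R_{00}=(\nabla_{e_0}\operatorname{Ric})(e_0,e_0)$, with $\nabla$ the Levi-Civita connection of $M$. *)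

(* Defs.v *)
From HB Require Import structures.
From mathcomp Require Import all_boot all_order all_algebra.
From mathcomp Require Import all_classical all_reals all_analysis.

Set Implicit Arguments.
Unset Strict Implicit.
Unset Printing Implicit Defensive.

Import Order.TTheory GRing.Theory Num.Theory.
Import numFieldNormedType.Exports.

Local Open Scope classical_set_scope.
Local Open Scope ring_scope.

(* Intended for D open and V finite-dimensional, where it is the usual C^k: the
   derivatives along fixed vectors determine the continuous total derivative. *)
Fixpoint Ck_on (R : realType) (V W : normedModType R) (k : nat)
    (D : set V) (f : V -> W) : Prop :=
  if k is k'.+1 then
    (forall x, D x -> differentiable f x) /\
    (forall v : V, Ck_on k' D ('D_v f))
  else forall x, D x -> {for x, continuous f}.

Definition smooth_on (R : realType) (V W : normedModType R)
    (D : set V) (f : V -> W) : Prop :=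
  forall k, Ck_on k D f.

Definition pd (R : realType) (n : nat) (W : normedModType R) (i : 'I_n)
    (f : 'rV[R]_n -> W) : 'rV[R]_n -> W :=
  'D_(delta_mx 0 i : 'rV[R]_n) f.

(* [param] is the inverse of [coord]; both are total functions, of which only
   the values on [dom], respectively on [coord @` dom], are meaningful. *)
Record chart (R : realType) (n : nat) (T : topologicalType) := Chart {
  dom : set T;
  coord : T -> 'rV[R]_n;
  param : 'rV[R]_n -> T;
  dom_open : open dom;
  img_open : open (coord @` dom);
  coordK : forall p, dom p -> param (coord p) = p;
  coord_cont : forall p, dom p -> {for p, continuous coord};
  param_cont : forall x, (coord @` dom) x -> {for x, continuous param}
}.

Definition img (R : realType) (n : nat) (T : topologicalType)
    (c : chart R n T) : set 'rV[R]_n := coord c @` dom c.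

Definition transition (R : realType) (n : nat) (T : topologicalType)
    (c d : chart R n T) : 'rV[R]_n -> 'rV[R]_n := coord d \o param c.

Record manifold (R : realType) (n : nat) := Manifold {
  carrier :> topologicalType;
  mfd_hausdorff : hausdorff_space carrier;
  mfd_second_countable : @second_countable carrier;
  atlas : set (chart R n carrier);
  atlas_cover : forall p : carrier, exists2 c, atlas c & dom c p;
  atlas_compat : forall c d, atlas c -> atlas d ->
    smooth_on (coord c @` (dom c `&` dom d)) (transition c d)
}.

Arguments atlas {R n} m : rename.

(* A metric on an open subset of R^n is given by its component matrix
   [G x i j] = g_ij(x). *)

Section LocalGeometry.
Variables (R : realType) (n : nat).
Implicit Types (G : 'rV[R]_n -> 'M[R]_n) (u v w z : 'rV[R]_n).

Definition ip G (y : 'rV[R]_n) u v : R := (u *m G y *m v^T) 0 0.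

(* Gamma^k_ij, with nabla_{d_i} d_j = Gamma^k_ij d_k *)
Definition christoffel G (k i j : 'I_n) (x : 'rV[R]_n) : R :=
  2^-1 * \sum_l invmx (G x) k l *
    (pd i (fun y => G y j l) x + pd j (fun y => G y i l) x
     - pd l (fun y => G y i j) x).

(* R^a_bcd, the d_a-component of Rm(d_c, d_d) d_b, where
   Rm(X, Y) = [nabla_X, nabla_Y] - nabla_[X, Y] *)
Definition riem_up G (a b c d : 'I_n) (x : 'rV[R]_n) : R :=
  pd c (christoffel G a d b) x - pd d (christoffel G a c b) x
  + \sum_e (christoffel G a c e x * christoffel G e d b x
            - christoffel G a d e x * christoffel G e c b x).

Definition riem G (a b c d : 'I_n) (x : 'rV[R]_n) : R :=
  \sum_e G x a e * riem_up G e b c d x.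

Definition ricci G (b d : 'I_n) (x : 'rV[R]_n) : R :=
  \sum_a riem_up G a b a d x.

(* Components (nabla_k T)_{i...} of the covariant derivative of a covariant
   tensor field of rank 1, 2, 3, 4; the direction k comes first. *)
Definition nabla1 G (T : 'I_n -> 'rV[R]_n -> R) (k i : 'I_n)
    (x : 'rV[R]_n) : R :=
  pd k (T i) x - \sum_l christoffel G l k i x * T l x.

Definition nabla2 G (T : 'I_n -> 'I_n -> 'rV[R]_n -> R) (k i j : 'I_n)
    (x : 'rV[R]_n) : R :=
  pd k (T i j) x
  - \sum_l (christoffel G l k i x * T l j x + christoffel G l k j x * T i l x).

Definition nabla3 G (T : 'I_n -> 'I_n -> 'I_n -> 'rV[R]_n -> R)
    (k a b c : 'I_n) (x : 'rV[R]_n) : R :=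
  pd k (T a b c) x
  - \sum_l (christoffel G l k a x * T l b c x
            + christoffel G l k b x * T a l c x
            + christoffel G l k c x * T a b l x).

Definition nabla4 G (T : 'I_n -> 'I_n -> 'I_n -> 'I_n -> 'rV[R]_n -> R)
    (k a b c d : 'I_n) (x : 'rV[R]_n) : R :=
  pd k (T a b c d) x
  - \sum_l (christoffel G l k a x * T l b c d x
            + christoffel G l k b x * T a l c d x
            + christoffel G l k c x * T a b l d x
            + christoffel G l k d x * T a b c l x).

Definition laplacian G (f : 'rV[R]_n -> R) (x : 'rV[R]_n) : R :=
  \sum_i \sum_j invmx (G x) i j * nabla1 G (fun k => pd k f) i j x.

Definition laplacian2 G (T : 'I_n -> 'I_n -> 'rV[R]_n -> R) (i j : 'I_n)
    (x : 'rV[R]_n) : R :=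
  \sum_k \sum_l invmx (G x) k l * nabla3 G (nabla2 G T) k l i j x.

Definition Ric G (y : 'rV[R]_n) u v : R :=
  \sum_a \sum_b ricci G a b y * u 0 a * v 0 b.

Definition Rm G (y : 'rV[R]_n) u v w z : R :=
  \sum_a \sum_b \sum_c \sum_d
    riem G a b c d y * u 0 a * v 0 b * w 0 c * z 0 d.

Definition nablaRic G (y : 'rV[R]_n) (s u v : 'rV[R]_n) : R :=
  \sum_k \sum_a \sum_b nabla2 G (ricci G) k a b y * s 0 k * u 0 a * v 0 b.

Definition nablaRm G (y : 'rV[R]_n) (s u v w z : 'rV[R]_n) : R :=
  \sum_k \sum_a \sum_b \sum_c \sum_d
    nabla4 G (riem G) k a b c d y
    * s 0 k * u 0 a * v 0 b * w 0 c * z 0 d.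

End LocalGeometry.

(* [F] is a parametrized submanifold of an open subset of R^n with metric [G];
   [n] is m.+1 in the applications to hypersurfaces. *)
Section Hypersurface.
Variables (R : realType) (m n : nat).
Variables (G : 'rV[R]_n -> 'M[R]_n) (F : 'rV[R]_m -> 'rV[R]_n).

Definition pullback_metric (x : 'rV[R]_m) : 'M[R]_m :=
  \matrix_(i, j) ip G (F x) (pd i F x) (pd j F x).

Definition unit_normal (x : 'rV[R]_m) (nu : 'rV[R]_n) : Prop :=
  ip G (F x) nu nu = 1 /\ forall i, ip G (F x) nu (pd i F x) = 0.

(* nabla_{d_i} (d_j F), a vector of the ambient space along F *)
Definition acceleration (i j : 'I_m) (x : 'rV[R]_m) : 'rV[R]_n :=
  pd i (pd j F) x
  + \row_a \sum_b \sum_c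
      christoffel G a b c (F x) * pd i F x 0 b * pd j F x 0 c.

(* A_ij = g(e_0, nabla_i d_j F), for the field N = e_0 of unit normals *)
Definition second_form (N : 'rV[R]_m -> 'rV[R]_n) (i j : 'I_m)
    (x : 'rV[R]_m) : R :=
  ip G (F x) (N x) (acceleration i j x).

Definition mean_curvature (N : 'rV[R]_m -> 'rV[R]_n) (x : 'rV[R]_m) : R :=
  \sum_i \sum_j invmx (pullback_metric x) i j * second_form N i j x.

End Hypersurface.

(* Raising of indices by the matrix [hi] = (g^ij): T^i_j and T^ij *)
Definition raise1 (R : realType) (m : nat) (hi : 'M[R]_m)
    (T : 'I_m -> 'I_m -> R) (i j : 'I_m) : R :=
  \sum_p hi i p * T p j.

Definition raise2 (R : realType) (m : nat) (hi : 'M[R]_m)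
    (T : 'I_m -> 'I_m -> R) (i j : 'I_m) : R :=
  \sum_p \sum_q hi i p * hi j q * T p q.

(* A time-dependent covariant 2-tensor field, given by its components in every
   chart; only the charts of the atlas and the points of [img c] matter. *)
Definition metric_family (R : realType) (n : nat) (M : manifold R n) :=
  R -> chart R n M -> 'rV[R]_n -> 'M[R]_n.

Definition riemannian_metrics (R : realType) (n : nat) (M : manifold R n)
    (J : set R) (g : metric_family M) : Prop :=
  [/\ forall t c x, J t -> atlas M c -> img c x ->
        (g t c x)^T = g t c x /\
        forall v : 'rV[R]_n, v != 0 -> 0 < ip (g t c) x v v,
      forall t c d p, J t -> atlas M c -> atlas M d -> dom c p -> dom d p ->
        g t c (coord c p)
        = pullback_metric (g t d) (transition c d) (coord c p) &
      forall c, atlas M c ->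
        smooth_on [set z : R * 'rV[R]_n | J z.1 /\ img c z.2]
          (fun z => g z.1 c z.2)].

Definition ricci_flow (R : realType) (n : nat) (M : manifold R n)
    (J : set R) (g : metric_family M) : Prop :=
  forall t c x, J t -> atlas M c -> img c x ->
    forall i j, is_derive t (1 : R) (fun s : R => g s c x i j)
      (- 2 * ricci (g t c) i j x).

Section Immersions.
Variables (R : realType) (m n : nat) (S : manifold R m) (M : manifold R n).
Variables (J : set R) (e : R -> S -> M).

Definition local_rep (phi : chart R m S) (psi : chart R n M)
    (t : R) (x : 'rV[R]_m) : 'rV[R]_n := coord psi (e t (param phi x)).

Definition rep_domain (phi : chart R m S) (psi : chart R n M) :
    set (R * 'rV[R]_m) :=
  [set z | [/\ J z.1, img phi z.2 & dom psi (e z.1 (param phi z.2))]].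

Definition smooth_immersions : Prop :=
  (forall t p, J t ->
    {for (t, p), continuous (fun z : R * S => e z.1 z.2)}) /\
  (forall phi psi, atlas S phi -> atlas M psi ->
    smooth_on (rep_domain phi psi) (fun z => local_rep phi psi z.1 z.2) /\
    forall t x, rep_domain phi psi (t, x) ->
      row_free (\matrix_(i < m) pd i (local_rep phi psi t) x)).

(* dx/dt = H e_0.  The equation at a point only depends on the unit normal at
   that point, hence the constant field of unit normals. *)
Definition mean_curvature_flow (g : metric_family M) : Prop :=
  forall phi psi t x (nu : 'rV[R]_n), atlas S phi -> atlas M psi ->
    rep_domain phi psi (t, x) ->
    unit_normal (g t psi) (local_rep phi psi t) x nu ->
    is_derive t (1 : R) (fun s : R => local_rep phi psi s x)
      (mean_curvature (g t psi) (local_rep phi psi t) (fun=> nu) x *: nu).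

End Immersions.

(* Main.v *)
(* The components of all tensors live in two commutative rings: the smooth
   functions of time and a point of the chart of [M], and the smooth functions of
   time and a point of the parameter domain.  The coordinate vector fields act on
   both by commuting derivations, and composition with the immersions is a ring
   morphism between them that satisfies the chain rule; so the geometry is
   algebra in these rings.

   Differentiating A_ij = g(e_0, nabla_i d_j F) in time, with
   d_t e_0 = -grad H + 2 Ric(e_0)^tan + Ric(e_0, e_0) e_0 and with the variation
   -(nabla_i R_ja + nabla_j R_ia - nabla_a R_ij) of the Christoffel symbols under
   the Ricci flow, gives

     d_t A_ij = nabla_i nabla_j H - H A_ik A^k_j + H R_0i0j - R_00 A_ij
                - nabla_i R_0j - nabla_j R_0i + nabla_0 R_ij.

   Simons' identity (Codazzi twice, the Ricci identity with the Gauss equation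
   in between, and the contracted second Bianchi identity) replaces the Hessian
   of H by the Laplacian of A, and all derivatives of the curvature cancel except
   nabla_0 R_0i0j.  The equation for H is the trace. *)
Require Import Defs.
From HB Require Import structures.
From mathcomp Require Import all_boot all_order all_algebra.
From mathcomp Require Import all_classical all_reals all_analysis.
From mathcomp Require Import ring.

Set Implicit Arguments.
Unset Strict Implicit.
Unset Printing Implicit Defensive.

Import Order.TTheory GRing.Theory Num.Theory.
Import numFieldNormedType.Exports.

Local Open Scope classical_set_scope.
Local Open Scope ring_scope.

(** * Tensor calculus in a differential ring *)

(* The components of tensor fields are elements of a commutative ring [A], on
   which the coordinate vector fields act by the derivations [d i].  [half] is
   1/2, [gi] the inverse of the metric [g], and [c p i j] an arbitrary
   connection Gamma^p_ij; [chr] is the Levi-Civita connection. *)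
Section Calculus.
Variables (A : comPzRingType) (n : nat) (d : 'I_n -> {additive A -> A}).
Variables (half : A) (g gi : 'I_n -> 'I_n -> A).

(** The unit normal exists only along the hypersurface, so ambient tensors are pulled back by the
    ring morphism, and vectors along the immersion are columns over the second ring, differentiated
    by the pulled-back connection. Each derivation there follows a velocity [X] and a clock of speed
    [eps]: tangential directions have [eps = 0], the time derivative has [eps = 1], and the terms
    carrying [eps] are those due to the motion of the metric. The hypersurface theory is abstract: a
    module with a bilinear form, covariant derivatives and curvature, in which the codimension
    enters only through the expansion of a vector in the frame T_1, ..., T_m, N. The bridge is the
    completeness relation g^{ab} = h^{kl} T_k^a T_l^b + N^a N^b, which turns every ambient trace
    into a tangential trace plus a normal term. Rings of functions have zero divisors and vanish
    over an empty set, so division by 2 is replaced by an element [half] with half + half = 1. The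
    analytic input is that smooth functions form a ring stable under derivation and composition,
    that mixed derivatives commute, and that the inverses of both metrics are smooth. *)

Definition chr (k i j : 'I_n) : A :=
  half * \sum_l gi k l * (d i (g j l) + d j (g i l) - d l (g i j)).

Variable c : 'I_n -> 'I_n -> 'I_n -> A.

Definition curv_up (p l k i : 'I_n) : A :=
  d k (c p i l) - d i (c p k l)
  + \sum_e (c p k e * c e i l - c p i e * c e k l).

Definition nab2 (T : 'I_n -> 'I_n -> A) (k i j : 'I_n) : A :=
  d k (T i j) - \sum_l (c l k i * T l j + c l k j * T i l).

Definition nab3 (T : 'I_n -> 'I_n -> 'I_n -> A) (k a b e : 'I_n) : A :=
  d k (T a b e)
  - \sum_l (c l k a * T l b e + c l k b * T a l e + c l k e * T a b l).

Definition nab4 (T : 'I_n -> 'I_n -> 'I_n -> 'I_n -> A)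
    (k a b e f : 'I_n) : A :=
  d k (T a b e f)
  - \sum_l (c l k a * T l b e f + c l k b * T a l e f
            + c l k e * T a b l f + c l k f * T a b e l).

Definition trace (B : 'I_n -> 'I_n -> A) : A :=
  \sum_k \sum_l gi k l * B k l.

Lemma eq_trace B B' : (forall k l, B k l = B' k l) -> trace B = trace B'.
Proof.
by move=> e; apply: eq_bigr => k _; apply: eq_bigr => l _; rewrite e.
Qed.

Lemma traceD B B' : trace (fun k l => B k l + B' k l) = trace B + trace B'.
Proof.
rewrite /trace -big_split; apply: eq_bigr => k _; rewrite -big_split /=.
by apply: eq_bigr => l _; rewrite mulrDr.
Qed.

Lemma traceZ a B : trace (fun k l => a * B k l) = a * trace B.
Proof.
rewrite /trace mulr_sumr; apply: eq_bigr => k _; rewrite mulr_sumr.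
by apply: eq_bigr => l _; rewrite mulrCA.
Qed.

Lemma traceN B : trace (fun k l => - B k l) = - trace B.
Proof. by rewrite -mulN1r -traceZ; apply: eq_trace => k l; rewrite mulN1r. Qed.

Lemma traceB B B' : trace (fun k l => B k l - B' k l) = trace B - trace B'.
Proof. by rewrite traceD traceN. Qed.

Lemma trace_sum I (r : seq I) P (B : I -> 'I_n -> 'I_n -> A) :
  trace (fun k l => \sum_(i <- r | P i) B i k l)
  = \sum_(i <- r | P i) trace (B i).
Proof.
rewrite /trace [RHS]exchange_big; apply: eq_bigr => k _.
rewrite [RHS]exchange_big; by apply: eq_bigr => l _; rewrite mulr_sumr.
Qed.

Hypothesis gi_sym : forall k l, gi k l = gi l k.

Lemma trace_sym B : trace (fun k l => B l k) = trace B.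
Proof.
rewrite /trace exchange_big; apply: eq_bigr => k _.
by apply: eq_bigr => l _; rewrite gi_sym.
Qed.

Hypothesis d_mul : forall i a b, d i (a * b) = d i a * b + a * d i b.
Hypothesis g_inv : forall k l, \sum_q gi k q * g q l = (k == l)%:R.
Hypothesis g_sym : forall k l, g k l = g l k.
Hypothesis g_compat : forall i k l,
  d i (g k l) = \sum_p (c p i k * g p l + c p i l * g k p).

Lemma deriv_nat i (b : nat) : d i b%:R = 0.
Proof.
have d1 : d i 1 = 0.
  by have := d_mul i 1 1; rewrite !mulr1 mul1r => /eqP; rewrite -subr_eq0 opprD
    addrA subrr sub0r oppr_eq0 => /eqP.
by rewrite raddfMn d1 mul0rn.
Qed.

Lemma sum_delta (F : 'I_n -> A) k : \sum_l (k == l)%:R * F l = F k.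
Proof.
rewrite (bigD1 k) //= eqxx mul1r big1 ?addr0 // => l /negPf nk.
by rewrite eq_sym nk mul0r.
Qed.

Lemma sum_deltar (F : 'I_n -> A) k : \sum_l F l * (l == k)%:R = F k.
Proof.
by rewrite -[RHS]sum_delta; apply: eq_bigr => l _; rewrite mulrC eq_sym.
Qed.

Lemma g_invr k l : \sum_q g k q * gi q l = (k == l)%:R.
Proof.
rewrite eq_sym -g_inv; apply: eq_bigr => q _.
by rewrite mulrC gi_sym g_sym.
Qed.

(** Differentiate g^{-1} g = 1 and multiply by g^{-1} on the right. The argument involves a product
    rule and no connection, so it also applies to the time derivative, viewed as a constant family
    of derivations. *)
Lemma deriv_inv i k l :
  d i (gi k l) = - \sum_p \sum_q gi k p * d i (g p q) * gi q l.
Proof.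
have e q : \sum_p (d i (gi k p) * g p q + gi k p * d i (g p q)) = 0.
  rewrite -[RHS](deriv_nat i (k == q)) -g_inv raddf_sum.
  by apply: eq_bigr => p _; rewrite d_mul.
apply/eqP; rewrite -addr_eq0; apply/eqP.
rewrite -[X in X + _](sum_deltar (fun p => d i (gi k p)) l).
transitivity (\sum_q \sum_p (d i (gi k p) * g p q + gi k p * d i (g p q))
              * gi q l); last first.
  by apply: big1 => q _; rewrite -mulr_suml e mul0r.
under [RHS]eq_bigr => q _ do under eq_bigr => p _ do rewrite mulrDl.
under [RHS]eq_bigr => q _ do rewrite big_split.
rewrite big_split /=; congr (_ + _); last by rewrite exchange_big.
rewrite exchange_big; apply: eq_bigr => p _.
rewrite -g_invr mulr_sumr; apply: eq_bigr => q _; ring.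
Qed.

Lemma deriv_inv_chr i k l :
  d i (gi k l) = - \sum_p (c k i p * gi p l + c l i p * gi k p).
Proof.
rewrite deriv_inv; congr (- _).
transitivity (\sum_p \sum_q \sum_r
   (gi k p * c r i p * g r q * gi q l + gi k p * (c r i q * g p r) * gi q l)).
  apply: eq_bigr => p _; apply: eq_bigr => q _.
  rewrite g_compat mulr_sumr mulr_suml; apply: eq_bigr => r _; ring.
under eq_bigr => p _ do under eq_bigr => q _ do rewrite big_split.
under eq_bigr => p _ do rewrite big_split.
rewrite !big_split /= addrC; congr (_ + _).
- rewrite exchange_big; apply: eq_bigr => q _.
  rewrite exchange_big /= -[RHS](sum_delta (fun r => c r i q * gi q l)).
  apply: eq_bigr => r _; rewrite -g_inv mulr_suml; apply: eq_bigr => p _; ring.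
- apply: eq_bigr => p _; rewrite exchange_big /=.
  rewrite -[RHS](sum_deltar (fun r => c r i p * gi k p)).
  apply: eq_bigr => r _; rewrite -g_invr mulr_sumr.
  apply: eq_bigr => q _; ring.
Qed.

(* The inverse metric is parallel. *)
Lemma deriv_trace i B : d i (trace B) = trace (nab2 B i).
Proof.
transitivity (\sum_k \sum_l \sum_p
  (- (c k i p * gi p l * B k l) - c l i p * gi k p * B k l)
  + trace (fun k l => d i (B k l))).
  rewrite /trace raddf_sum -big_split; apply: eq_bigr => k _ /=.
  rewrite raddf_sum -big_split; apply: eq_bigr => l _ /=.
  rewrite d_mul deriv_inv_chr mulNr mulr_suml; congr (_ + _).
  rewrite -sumrN; apply: eq_bigr => p _; ring.
rewrite traceB addrC; congr (_ + _).
rewrite trace_sum -sumrN.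
rewrite /trace.
transitivity (\sum_k \sum_l \sum_p - (c k i p * gi p l * B k l)
   + \sum_k \sum_l \sum_p - (c l i p * gi k p * B k l)).
  rewrite -big_split; apply: eq_bigr => k _; rewrite -big_split.
  by apply: eq_bigr => l _; rewrite -big_split.
transitivity (\sum_p \sum_k \sum_l (- (gi k l * (c p i k * B p l))) +
  \sum_p \sum_k \sum_l (- (gi k l * (c p i l * B k p)))).
  congr (_ + _); first last.
    rewrite [RHS]exchange_big; apply: eq_bigr => k _.
    apply: eq_bigr => l _; apply: eq_bigr => p _.
    by congr (- _); ring.
  apply: eq_bigr => k _; rewrite exchange_big.
  apply: eq_bigr => p _; apply: eq_bigr => l _; ring.
rewrite -big_split; apply: eq_bigr => p _; rewrite -big_split -sumrN.
apply: eq_bigr => k _; rewrite -big_split -sumrN.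
apply: eq_bigr => l _ /=; ring.
Qed.

Lemma ricci_identity B k i l j :
  (forall p i j, c p i j = c p j i) ->
  (forall i j x, d i (d j x) = d j (d i x)) ->
  nab3 (nab2 B) k i l j - nab3 (nab2 B) i k l j
  = - \sum_p (curv_up p l k i * B p j + curv_up p j k i * B l p).
Proof.
move=> c_sym d_comm.
(* Antisymmetrizing [U] in [k] and [i] gives [curv_up]. [S] collects the remaining terms of the
   second covariant derivative, which are symmetric in [k] and [i] because the derivations commute
   and the connection is torsion-free. *)
pose U q k i l := d k (c q i l) - \sum_e c q i e * c e k l.
pose S k i := d k (d i (B l j)) - \sum_p c p k i * nab2 B p l j
  - \sum_q (c q i l * d k (B q j) + c q k l * d i (B q j)
            + c q i j * d k (B l q) + c q k j * d i (B l q))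
  + \sum_p \sum_q (c p k l * c q i j * B p q + c p i l * c q k j * B p q).
have E k' i' : nab3 (nab2 B) k' i' l j
    = S k' i' - \sum_q (U q k' i' l * B q j + U q k' i' j * B l q).
  rewrite /nab3 /S {1}/nab2 raddfB raddf_sum.
  transitivity (d k' (d i' (B l j)) - \sum_p c p k' i' * nab2 B p l j
    - \sum_q (d k' (c q i' l) * B q j + c q i' l * d k' (B q j)
              + d k' (c q i' j) * B l q + c q i' j * d k' (B l q))
    - \sum_p (c p k' l * d i' (B p j) + c p k' j * d i' (B l p))
    + \sum_p \sum_q (c p k' l * c q i' p * B q j + c p k' l * c q i' j * B p q
                     + c p k' j * c q i' l * B q p
                     + c p k' j * c q i' p * B l q)).
    rewrite -!addrA; congr (_ + _); rewrite addrCA; congr (_ + _).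
      by congr (- _); apply: eq_bigr => q _; rewrite raddfD /= !d_mul !addrA.
    rewrite -!sumrN -!big_split; apply: eq_bigr => p _ /=.
    rewrite /nab2 !mulrBr !mulr_sumr.
    rewrite [X in _ = _ + (_ + X)](_ : _ =
       \sum_q c p k' l * (c q i' p * B q j + c q i' j * B p q) +
       \sum_q c p k' j * (c q i' l * B q p + c q i' p * B l q)); first by ring.
    by rewrite -big_split; apply: eq_bigr => q _ /=; ring.
  have -> : \sum_p \sum_q (c p k' l * c q i' p * B q j
       + c p k' l * c q i' j * B p q + c p k' j * c q i' l * B q p
       + c p k' j * c q i' p * B l q) =
     \sum_p \sum_q (c p k' l * c q i' j * B p q + c p i' l * c q k' j * B p q)
     + \sum_q (\sum_e c q i' e * c e k' l * B q j
               + \sum_e c q i' e * c e k' j * B l q).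
    under eq_bigr => p _ do rewrite !big_split /=.
    under [in RHS]eq_bigr => p _ do rewrite !big_split /=.
    rewrite !big_split /=.
    rewrite [X in X + _ + _ + _ = _]exchange_big /=.
    rewrite [X in _ + _ + X + _ = _]exchange_big /=.
    rewrite [X in _ + _ + _ + X = _]exchange_big /=.
    have e1 j' (w : 'I_n -> A) : \sum_q \sum_p c p k' j' * c q i' p * w q =
       \sum_q \sum_e c q i' e * c e k' j' * w q.
      by apply: eq_bigr => q _; apply: eq_bigr => p _; ring.
    rewrite (e1 l (fun q => B q j)) (e1 j (fun q => B l q)).
    rewrite [X in _ + _ + X + _ = _](_ : _ =
       \sum_p \sum_q c p i' l * c q k' j * B p q); first by ring.
    by apply: eq_bigr => q _; apply: eq_bigr => p _; ring.
  rewrite [X in _ + (_ + X)](_ : _ =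
    \sum_q (d k' (c q i' l) * B q j + c q i' l * d k' (B q j)
            + d k' (c q i' j) * B l q + c q i' j * d k' (B l q))
    + \sum_p (c p k' l * d i' (B p j) + c p k' j * d i' (B l p))
    - \sum_q (c q i' l * d k' (B q j) + c q k' l * d i' (B q j)
            + c q i' j * d k' (B l q) + c q k' j * d i' (B l q))
    - \sum_q (U q k' i' l * B q j + U q k' i' j * B l q)); first by ring.
  rewrite -big_split -!sumrB; apply: eq_bigr => q _ /=.
  rewrite /U !mulrBl -!mulr_suml; ring.
rewrite !E.
have -> : S k i = S i k.
  rewrite /S d_comm; congr (_ - _ - _ + _).
  - by apply: eq_bigr => p _; rewrite c_sym.
  - by apply: eq_bigr => p _; ring.
  - by apply: eq_bigr => p _; apply: eq_bigr => q _; rewrite addrC.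
transitivity (\sum_q (U q i k l * B q j + U q i k j * B l q)
  - \sum_q (U q k i l * B q j + U q k i j * B l q)); first by ring.
rewrite -sumrB -sumrN; apply: eq_bigr => p _; rewrite /curv_up /U.
rewrite !sumrB; ring.
Qed.

End Calculus.

(** * Linear forms on a module *)

Section LinearForms.
Variables (A : comPzRingType) (V : lmodType A).

Lemma scalar_sum (f : V -> A) I (r : seq I) P (a : I -> A) (v : I -> V) :
  scalar f ->
  f (\sum_(i <- r | P i) a i *: v i) = \sum_(i <- r | P i) a i * f (v i).
Proof.
move=> lf; have f0 : f 0 = 0.
  by have := lf (-1) 0 0; rewrite scaler0 addr0 mulN1r addNr.
elim/big_rec2: _ => // i x y _ <-; exact: lf.
Qed.

Lemma scalar_scale (f : V -> A) a v : scalar f -> f (a *: v) = a * f v.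
Proof.
move=> lf; have := @scalar_sum f _ [:: tt] predT (fun=> a) (fun=> v) lf.
by rewrite !big_seq1.
Qed.

Lemma scalar_add (f : V -> A) u v : scalar f -> f (u + v) = f u + f v.
Proof. by move=> lf; have := lf 1 u v; rewrite scale1r mul1r. Qed.

Lemma scalar_opp (f : V -> A) u : scalar f -> f (- u) = - f u.
Proof. by move=> lf; rewrite -scaleN1r scalar_scale // mulN1r. Qed.

Lemma scalar_sub (f : V -> A) u v : scalar f -> f (u - v) = f u - f v.
Proof. by move=> lf; rewrite scalar_add // scalar_opp. Qed.

End LinearForms.

(** * Hypersurfaces: Codazzi, Gauss, Simons and the evolution equations *)

(* [V] is the module of vector fields along the moving hypersurface, [D i] and
   [Dt] the ambient covariant derivatives along the coordinate directions of
   the parameter domain.  [Rm] and [nRm] are the curvature tensor and its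
   covariant derivative, with the direction of derivation first in [nRm]. *)
Section Core.
Variables (A : comPzRingType) (V : lmodType A) (m : nat).
Variables (half : A) (half2 : half + half = 1).
Variables (d : 'I_m -> {additive A -> A}) (dt : {additive A -> A}).
Variables (D : 'I_m -> {additive V -> V}) (Dt : {additive V -> V}).
Variables (ip : V -> V -> A) (Rm : V -> V -> V -> V -> A).
Variables (nRm : V -> V -> V -> V -> V -> A).
Variables (T : 'I_m -> V) (N X : V) (H : A) (hi : 'I_m -> 'I_m -> A).

Let h i j := ip (T i) (T j).
Let c := chr d half h hi.
Let a i j := ip N (D i (T j)).
Let tr := trace hi.
(** The Ricci tensor as a trace in the adapted frame; [Ric_frame] and [nRic_frame] identify these
    traces with the coordinate tensors. *)
Let Ric u v := tr (fun k l => Rm (T k) u (T l) v) + Rm N u N v.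
Let nRic s u v := tr (fun k l => nRm s (T k) u (T l) v) + nRm s N u N v.
Let amix p k := \sum_q hi p q * a q k.
Let aup i j := \sum_p \sum_q hi i p * hi j q * a p q.

Hypothesis d_mul : forall i x y, d i (x * y) = d i x * y + x * d i y.
Hypothesis dt_mul : forall x y, dt (x * y) = dt x * y + x * dt y.
Hypothesis d_comm : forall i j x, d i (d j x) = d j (d i x).
Hypothesis D_mul : forall i x v, D i (x *: v) = d i x *: v + x *: D i v.
Hypothesis ip_lin : forall u, scalar (ip u).
Hypothesis ip_sym : forall u v, ip u v = ip v u.
Hypothesis d_ip : forall i u v, d i (ip u v) = ip (D i u) v + ip u (D i v).
Hypothesis dt_ip : forall u v,
  dt (ip u v) = ip (Dt u) v + ip u (Dt v) - 2 * Ric u v.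
Hypothesis torsion : forall i j, D i (T j) = D j (T i).
Hypothesis torsion_t : forall i, Dt (T i) = D i X.
Hypothesis flow : X = H *: N.
Hypothesis H_def : H = tr a.
Hypothesis NN : ip N N = 1.
Hypothesis NT : forall i, ip N (T i) = 0.
Hypothesis hi_inv : forall k l, \sum_q hi k q * h q l = (k == l)%:R.
Hypothesis hi_sym : forall k l, hi k l = hi l k.
Hypothesis frame : forall u,
  u = \sum_p (\sum_q hi p q * ip u (T q)) *: T p + ip u N *: N.
Hypothesis Rm_lin1 : forall v w z, scalar (fun u => Rm u v w z).
Hypothesis Rm_lin2 : forall u w z, scalar (fun v => Rm u v w z).
Hypothesis Rm_lin3 : forall u v z, scalar (fun w => Rm u v w z).
Hypothesis Rm_lin4 : forall u v w, scalar (Rm u v w).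
Hypothesis Rm_anti12 : forall u v w z, Rm v u w z = - Rm u v w z.
Hypothesis Rm_anti34 : forall u v w z, Rm u v z w = - Rm u v w z.
Hypothesis Rm_pair : forall u v w z, Rm w z u v = Rm u v w z.
Hypothesis nRm_anti12 : forall s u v w z, nRm s v u w z = - nRm s u v w z.
Hypothesis nRm_anti34 : forall s u v w z, nRm s u v z w = - nRm s u v w z.
Hypothesis nRm_pair : forall s u v w z, nRm s w z u v = nRm s u v w z.
Hypothesis bianchi2 : forall s u v w z,
  nRm s u v w z + nRm w u v z s + nRm z u v s w = 0.
Hypothesis d_Rm : forall i u v w z, d i (Rm u v w z) =
  nRm (T i) u v w z + Rm (D i u) v w z + Rm u (D i v) w z
  + Rm u v (D i w) z + Rm u v w (D i z).
Hypothesis ricci_id : forall i j u v,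
  ip u (D i (D j v) - D j (D i v)) = Rm u v (T i) (T j).
(** The curvature term comes from the motion of the point with velocity [X], the three derivatives
    of Ric from the variation of the Levi-Civita connection under the Ricci flow. *)
Hypothesis ricci_id_t : forall i u v,
  ip u (Dt (D i v) - D i (Dt v)) =
  Rm u v X (T i) - (nRic (T i) v u + nRic v (T i) u - nRic u (T i) v).

Lemma half_mul (x y : A) : x + x = y -> x = half * y.
Proof. by move=> <-; rewrite mulrDr -mulrDl half2 mul1r. Qed.

(** Cancellation of a factor 2 goes through [half], since a ring of functions is in general not an
    integral domain. *)
Lemma two_inj (x y : A) : x + x = y + y -> x = y.
Proof. by move/half_mul => ->; rewrite mulrDr -mulrDl half2 mul1r. Qed.

Let ip_linl u : scalar (fun v => ip v u).
Proof. by move=> b v w; rewrite !(ip_sym _ u) ip_lin. Qed.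

Let h_sym i j : h i j = h j i.
Proof. exact: ip_sym. Qed.

Let a_sym i j : a i j = a j i.
Proof. by rewrite /a torsion. Qed.

(** The Koszul computation: metric compatibility and the symmetry of D_i T_j leave twice g(D_i T_j,
    T_q). Hence the induced connection is the tangential part of the ambient one. *)
Lemma chrE p i j : c p i j = \sum_q hi p q * ip (D i (T j)) (T q).
Proof.
rewrite /c /chr mulr_sumr; apply: eq_bigr => q _; rewrite mulrCA; congr (_ * _).
symmetry; apply: half_mul; rewrite /h !d_ip (torsion j i) (torsion q).
rewrite (torsion q j) !(ip_sym _ (D j (T q))) !(ip_sym _ (D i (T q))).
ring.
Qed.

Lemma chr_sym p i j : c p i j = c p j i.
Proof. by rewrite !chrE torsion. Qed.

(** The Gauss formula. *)
Lemma DT i j : D i (T j) = \sum_p c p i j *: T p + a i j *: N.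
Proof.
rewrite [LHS]frame /a ip_sym; congr (_ + _).
by apply: eq_bigr => p _; rewrite chrE.
Qed.

Lemma h_compat i k l :
  d i (h k l) = \sum_p (c p i k * h p l + c p i l * h k p).
Proof.
rewrite /h d_ip big_split !DT; congr (_ + _).
  rewrite (scalar_add _ _ (ip_linl _)) (scalar_sum _ _ _ _ (ip_linl _)).
  by rewrite (scalar_scale _ _ (ip_linl _)) NT mulr0 addr0.
rewrite (scalar_add _ _ (ip_lin _)) (scalar_sum _ _ _ _ (ip_lin _)).
by rewrite (scalar_scale _ _ (ip_lin _)) ip_sym NT mulr0 addr0.
Qed.

Let d_nat i (b : nat) : d i b%:R = 0.
Proof. exact: (deriv_nat d_mul). Qed.

Lemma ip_DN i : ip (D i N) N = 0.
Proof.
apply: two_inj; have := d_ip i N N; rewrite NN (d_nat i 1) => e.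
by rewrite addr0 e (ip_sym N).
Qed.

Lemma ip_DNT i j : ip (D i N) (T j) = - a i j.
Proof.
by apply/eqP; rewrite -addr_eq0 /a -d_ip NT raddf0.
Qed.

(** The Weingarten equation; the normal component vanishes because [N] has constant length. *)
Lemma DN i : D i N = - \sum_p amix p i *: T p.
Proof.
rewrite [LHS]frame ip_DN scale0r addr0 -sumrN; apply: eq_bigr => p _.
rewrite -scaleNr -sumrN; congr (_ *: _); apply: eq_bigr => q _.
by rewrite ip_DNT mulrN a_sym.
Qed.

Let lin_DT f i j : scalar f ->
  f (D i (T j)) = \sum_p c p i j * f (T p) + a i j * f N.
Proof.
by move=> lf; rewrite DT scalar_add // scalar_sum // scalar_scale.
Qed.

Let lin_DN f i : scalar f -> f (D i N) = - \sum_p amix p i * f (T p).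
Proof. by move=> lf; rewrite DN scalar_opp // scalar_sum. Qed.

Lemma ip_DN_DT k i j : ip (D k N) (D i (T j)) = - \sum_p c p i j * a k p.
Proof.
rewrite lin_DT // ip_DN mulr0 addr0 -sumrN; apply: eq_bigr => p _.
by rewrite ip_DNT mulrN.
Qed.

(* The sum is totally symmetric in [k], [i], [j], so that the Codazzi
   equation is the antisymmetrization of this identity. *)
Lemma nab2_second_form k i j : nab2 d c a k i j =
  ip N (D k (D i (T j)))
  - \sum_p (c p i j * a k p + c p k i * a p j + c p k j * a i p).
Proof.
rewrite /nab2 {1}/a d_ip ip_DN_DT addrAC -opprD addrC; congr (_ - _).
by rewrite -big_split; apply: eq_bigr => p _ /=; ring.
Qed.

Lemma codazzi k i j :
  nab2 d c a k i j = nab2 d c a i k j + Rm N (T j) (T k) (T i).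
Proof.
rewrite -ricci_id (scalar_sub _ _ (ip_lin _)) !nab2_second_form.
rewrite [X in _ = _ - X + _](_ : _ = \sum_p
   (c p i j * a k p + c p k i * a p j + c p k j * a i p)); first by ring.
by apply: eq_bigr => p _; rewrite (chr_sym p i k); ring.
Qed.

(** The linear form that reads off the coefficient of [T p] in the frame T, N. *)
Let coef p u := \sum_q hi p q * ip u (T q).

Let coef_lin p : scalar (coef p).
Proof.
move=> b u v; rewrite /coef mulr_sumr -big_split; apply: eq_bigr => q _ /=.
by rewrite ip_linl; ring.
Qed.

Let coefT p r : coef p (T r) = (p == r)%:R.
Proof. by rewrite -hi_inv; apply: eq_bigr => q _; rewrite (ip_sym (T r)). Qed.

Let coefN p : coef p N = 0.
Proof. by apply: big1 => q _; rewrite NT mulr0. Qed.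

(* The tangential component of the commutator of [D k] and [D i] gives the
   Gauss equation. *)
Lemma coef_DD p k i l : coef p (D k (D i (T l))) =
  d k (c p i l) + \sum_e c p k e * c e i l - a i l * amix p k.
Proof.
rewrite DT raddfD raddf_sum (scalar_add _ _ (coef_lin p)) /=.
have -> : \sum_r D k (c r i l *: T r) =
   \sum_r d k (c r i l) *: T r + \sum_r c r i l *: D k (T r).
  by rewrite -big_split; apply: eq_bigr => r _; rewrite D_mul.
rewrite (scalar_add _ _ (coef_lin p)) !(scalar_sum _ _ _ _ (coef_lin p)).
rewrite D_mul (scalar_add _ _ (coef_lin p)) !(scalar_scale _ _ (coef_lin p))
  coefN.
rewrite (lin_DN _ (coef_lin p)) mulr0 add0r mulrN.
have coef_sum x : \sum_r x r * coef p (T r) = x p.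
  by under eq_bigr => r _ do rewrite coefT mulrC; rewrite sum_delta.
rewrite !coef_sum; congr (_ + _ - _).
apply: eq_bigr => r _; rewrite (lin_DT _ _ (coef_lin p)) coef_sum coefN.
by rewrite mulr0 addr0 mulrC.
Qed.

Let rh := curv_up d c.

Lemma gauss p l k i : rh p l k i =
  \sum_q hi p q * Rm (T q) (T l) (T k) (T i) + a i l * amix p k - a k l * amix
    p i.
Proof.
have := scalar_sub (D k (D i (T l))) (D i (D k (T l))) (coef_lin p).
rewrite {1}/coef; under eq_bigr => q _ do rewrite ip_sym ricci_id.
by move=> ->; rewrite !coef_DD /rh /curv_up sumrB; ring.
Qed.

Let nA := nab2 d c a.
(** The Codazzi defect, the amount by which the covariant derivative of A fails to be symmetric in
    its first two indices. *)
Let cod u v w := Rm N (T w) (T u) (T v).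

(** The induced Christoffel symbols cancel the tangential parts of the derivatives of the [T], so
    that the Weingarten term of [N] and the normal parts remain. The normal part in the second slot
    would give Rm(N, N, ., .) = 0. *)
Lemma nab3_cod k u v w : nab3 d c cod k u v w =
  nRm (T k) N (T w) (T u) (T v) - \sum_p amix p k * Rm (T p) (T w) (T u) (T v)
  + a k u * Rm N (T w) N (T v) + a k v * Rm N (T w) (T u) N.
Proof.
have RNN x y : Rm N N x y = 0.
  by apply: two_inj; rewrite addr0 {1}Rm_anti12 addNr.
rewrite /nab3 /cod d_Rm !big_split /=.
rewrite (lin_DN k (Rm_lin1 _ _ _)) (lin_DT k w (Rm_lin2 _ _ _)).
rewrite (lin_DT k u (Rm_lin3 _ _ _)) (lin_DT k v (Rm_lin4 _ _ _)).
rewrite RNN; ring.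
Qed.

Lemma eq_nab3 S S' k u v w :
  (forall x y z, S x y z = S' x y z) -> nab3 d c S k u v w = nab3 d c S' k u v
    w.
Proof.
move=> e; rewrite /nab3 e; congr (_ - _).
by apply: eq_bigr => l _; rewrite !e.
Qed.

Lemma nab3D S S' k u v w : nab3 d c (fun x y z => S x y z + S' x y z) k u v w
  = nab3 d c S k u v w + nab3 d c S' k u v w.
Proof.
rewrite /nab3 raddfD /= addrACA -opprD -big_split; congr (_ - _).
by apply: eq_bigr => l _ /=; ring.
Qed.

Lemma nabla_swap12 k l i j : nab3 d c nA k l i j =
  nab3 d c nA k i l j + nab3 d c cod k l i j.
Proof.
rewrite -[nab3 _ _ cod _ _ _ _]addr0.
rewrite (eq_nab3 (S' := fun x y z => nA y x z + cod x y z)); last first.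
  by move=> x y z; exact: codazzi.
rewrite nab3D addr0; congr (_ + _).
rewrite /nab3; congr (_ - _); apply: eq_bigr => q _; ring.
Qed.

Let nA_sym k i j : nA k i j = nA k j i.
Proof.
rewrite /nA /nab2 a_sym; congr (_ - _); apply: eq_bigr => l _.
by rewrite addrC !(a_sym l) ; congr (_ + _); rewrite a_sym.
Qed.

(** The symmetry of A brings [j] next to the inner derivative, and the Codazzi equation under the
    outer derivative then exchanges it with [k]. *)
Lemma nabla_rotate i k l j : nab3 d c nA i k l j =
  nab3 d c nA i j k l + nab3 d c cod i k j l.
Proof.
rewrite (eq_nab3 (S' := fun x y z => nA z x y + cod x z y)); last first.
  by move=> x y z; rewrite nA_sym; exact: codazzi.
rewrite (nab3D (fun x y z => nA z x y) (fun x y z => cod x z y)).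
by rewrite /nab3; congr (_ - _ + (_ - _)); apply: eq_bigr => q _; ring.
Qed.

Let hess f i j := d i (d j f) - \sum_l c l i j * d l f.

(** The inverse of the induced metric is parallel, so the trace passes through both covariant
    derivatives. *)
Lemma trace_nabla2 i j : tr (fun k l => nab3 d c nA i j k l) = hess H i j.
Proof.
have dtr := deriv_trace hi_sym d_mul hi_inv h_sym h_compat.
have dH p : d p H = tr (nA p) by rewrite H_def dtr.
rewrite /hess dH dtr.
under [X in _ - X]eq_bigr => l _ do rewrite dH -traceZ.
rewrite -trace_sum -traceB; apply: eq_trace => k l.
rewrite /nab2 /nab3 -/nA -addrA -opprD -big_split; congr (_ - _).
by apply: eq_bigr => q _ /=; ring.
Qed.

Let Rtr k j := \sum_l \sum_p hi l p * Rm (T p) (T k) (T l) (T j).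
Let asq i j := \sum_k a i k * amix k j.
Let norm2 := \sum_k \sum_l aup k l * a k l.

Let contract_up B :
  \sum_k \sum_l aup k l * B k l = tr (fun k l => \sum_p amix p k * B p l).
Proof.
rewrite /tr trace_sum; apply: eq_bigr => k _.
rewrite /trace exchange_big /=; apply: eq_bigr => l _.
rewrite /aup exchange_big mulr_suml; apply: eq_bigr => q _.
rewrite /amix !mulr_suml mulr_sumr; apply: eq_bigr => p _.
rewrite (hi_sym l q); ring.
Qed.

Let trBmix i B : tr (fun k l => a k i * B l) = \sum_l amix l i * B l.
Proof.
rewrite /tr /trace exchange_big; apply: eq_bigr => l _ /=.
by rewrite mulr_suml; apply: eq_bigr => k _; rewrite hi_sym mulrA.
Qed.

Let tr_sym B : tr (fun k l => B l k) = tr B.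
Proof. exact: (trace_sym hi_sym). Qed.

Let asq_sym i j : \sum_p a p j * amix p i = asq i j.
Proof.
rewrite /asq /amix; under eq_bigr => p _ do rewrite mulr_sumr.
rewrite exchange_big; apply: eq_bigr => q _ /=; rewrite mulr_sumr.
apply: eq_bigr => p _; rewrite (hi_sym q p) (a_sym i q); ring.
Qed.

Let Rm_NNr x y : Rm x y N N = 0.
Proof. by apply: two_inj; rewrite addr0 {1}Rm_anti34 addNr. Qed.

Let nRm_NNr s x y : nRm s x y N N = 0.
Proof. by apply: two_inj; rewrite addr0 {1}nRm_anti34 addNr. Qed.

Let nRm_NNl s x y : nRm s N N x y = 0.
Proof. by apply: two_inj; rewrite addr0 {1}nRm_anti12 addNr. Qed.

(** The cube of the second fundamental form. The two Gauss traces contain it with opposite signs, so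
    it is absent from Simons' identity. *)
Let cub i j := tr (fun k l => a i l * \sum_p a p j * amix p k).

Let trace_gauss1 i j :
  tr (fun k l => \sum_p rh p l k i * a p j) =
  - \sum_k amix k j * Rtr k i + cub i j - H * asq i j.
Proof.
rewrite -(asq_sym i j) H_def.
have -> : \sum_k amix k j * Rtr k i =
    \sum_p \sum_q hi p q * a p j * Rtr q i.
  rewrite exchange_big; apply: eq_bigr => q _; rewrite /amix mulr_suml.
  by apply: eq_bigr => p _; rewrite (hi_sym q p).
have -> : cub i j = \sum_p tr (fun k l => a p j * (a i l * amix p k)).
  rewrite -trace_sum; apply: eq_trace => k l.
  by rewrite mulr_sumr; apply: eq_bigr => p _; ring.
rewrite mulr_sumr /tr trace_sum -sumrN -big_split -sumrB.
apply: eq_bigr => p _ /=.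
rewrite [X in X + _ - _](_ : _ = a p j * \sum_q hi p q * - Rtr q i); last first.
  by rewrite mulr_sumr -sumrN; apply: eq_bigr => q _; ring.
rewrite traceZ [RHS](_ : _ = a p j * (\sum_q hi p q * - Rtr q i
  + trace hi (fun k l => a i l * amix p k) - amix p i * trace hi a)); last by
    ring.
rewrite -[amix p i * _]traceZ.
rewrite (@eq_trace _ _ _ _ (fun k l => a p j *
  (\sum_q hi p q * Rm (T q) (T l) (T k) (T i) + a i l * amix p k
   - amix p i * a k l))); last first.
  by move=> k l; rewrite gauss; ring.
rewrite traceZ; congr (_ * _); rewrite traceB traceD; congr (_ + _ - _).
rewrite trace_sum; apply: eq_bigr => q _; rewrite traceZ; congr (_ * _).
rewrite /Rtr -sumrN; apply: eq_bigr => k _; rewrite -sumrN.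
by apply: eq_bigr => l _; rewrite Rm_anti12 mulrN.
Qed.

Let trace_gauss2 i j :
  tr (fun k l => \sum_p rh p j k i * a l p) =
  \sum_k \sum_l aup k l * Rm (T k) (T i) (T l) (T j) + norm2 * a i j - cub i j.
Proof.
have -> : \sum_k \sum_l aup k l * Rm (T k) (T i) (T l) (T j) =
    tr (fun k l => \sum_p amix p l * Rm (T p) (T j) (T k) (T i)).
  rewrite -[RHS]tr_sym -contract_up exchange_big; apply: eq_bigr => k _.
  apply: eq_bigr => l _; rewrite Rm_pair; congr (_ * _).
  rewrite /aup exchange_big; apply: eq_bigr => p _; apply: eq_bigr => q _.
  rewrite a_sym; ring.
have -> : cub i j = tr (fun k l => a k j * asq l i).
  transitivity (tr (fun k l => a k i * asq l j)).
    rewrite -[RHS]tr_sym; apply: eq_trace => k l.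
    by rewrite asq_sym a_sym.
  rewrite !trBmix /asq; under eq_bigr => l _ do rewrite mulr_sumr.
  rewrite exchange_big; apply: eq_bigr => k _; rewrite mulr_sumr.
  apply: eq_bigr => l _; rewrite (a_sym k l); ring.
rewrite /norm2 contract_up [_ * a i j]mulrC -traceZ -traceD -traceB.
apply: eq_trace => k l.
rewrite /asq !mulr_sumr.
have -> : \sum_p amix p l * Rm (T p) (T j) (T k) (T i)
    = \sum_p a l p * \sum_q hi p q * Rm (T q) (T j) (T k) (T i).
  under [RHS]eq_bigr => p _ do rewrite mulr_sumr.
  rewrite exchange_big; apply: eq_bigr => p _; rewrite /amix mulr_suml.
  by apply: eq_bigr => q _; rewrite (hi_sym p q) (a_sym q l); ring.
rewrite -big_split -sumrB; apply: eq_bigr => p _ /=.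
rewrite gauss (a_sym p l); ring.
Qed.

(** The trace of [nab3_cod] contains a divergence of the curvature, which the second Bianchi
    identity turns into derivatives of Ric. The divergence runs over tangential directions only
    while [nRic] also traces over [N]; the difference is the term nabla_0 R_0i0j of the evolution
    equation. *)
Let trace_cod1 i j : tr (fun k l => nab3 d c cod k l i j) =
  nRic N (T i) (T j) - nRm N N (T i) N (T j) - nRic (T j) (T i) N
  - \sum_k \sum_l aup k l * Rm (T k) (T i) (T l) (T j)
  + H * Rm N (T i) N (T j) + tr (fun k l => a k i * Rm N (T j) (T l) N).
Proof.
rewrite {1}/tr (@eq_trace _ _ _ _ (fun k l =>
  - nRm N (T l) (T i) (T j) (T k) - nRm (T j) (T l) (T i) (T k) N
  - \sum_p amix p k * Rm (T p) (T j) (T l) (T i)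
  + Rm N (T j) N (T i) * a k l + a k i * Rm N (T j) (T l) N)); last first.
  move=> k l; rewrite nab3_cod; congr (_ - _ + _ + _); last by rewrite mulrC.
  rewrite nRm_pair -opprD; apply/eqP; rewrite -addr_eq0 addrA.
  by apply/eqP/bianchi2.
rewrite !(traceD, traceB) traceN traceZ -/tr -H_def -contract_up.
have -> : tr (fun k l => nRm N (T l) (T i) (T j) (T k)) =
    - (nRic N (T i) (T j) - nRm N N (T i) N (T j)).
  rewrite /nRic addrK -tr_sym -traceN; apply: eq_trace => k l.
  by rewrite nRm_anti34.
have -> : tr (fun k l => nRm (T j) (T l) (T i) (T k) N) = nRic (T j) (T i) N.
  by rewrite /nRic nRm_NNr addr0 -[LHS]tr_sym.
have -> : \sum_k \sum_l aup k l * Rm (T k) (T j) (T l) (T i) =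
    \sum_k \sum_l aup k l * Rm (T k) (T i) (T l) (T j).
  rewrite exchange_big; apply: eq_bigr => k _.
  apply: eq_bigr => l _; rewrite Rm_pair; congr (_ * _).
  rewrite /aup exchange_big; apply: eq_bigr => p _; apply: eq_bigr => q _.
  rewrite a_sym; ring.
rewrite (Rm_pair N (T i)); ring.
Qed.

(** The direction of derivation stays free here, so the trace falls on two curvature slots and
    yields a derivative of Ric at once. *)
Let trace_cod2 i j : tr (fun k l => nab3 d c cod i k j l) =
  - nRic (T i) N (T j) + \sum_k amix k i * Rtr k j
  + tr (fun k l => a i k * Rm N (T l) N (T j)) - a i j * Ric N N.
Proof.
rewrite {1}/tr (@eq_trace _ _ _ _ (fun k l =>
  - nRm (T i) (T l) N (T k) (T j)
  + \sum_p amix p i * Rm (T l) (T p) (T k) (T j)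
  + a i k * Rm N (T l) N (T j) + a i j * - Rm (T l) N (T k) N)); last first.
  move=> k l; rewrite nab3_cod (nRm_anti12 _ N) -Rm_anti12 -sumrN.
  congr (_ + _ + _ + _); rewrite ?opprK //; apply: eq_bigr => p _.
  by rewrite (Rm_anti12 (T p)) mulrN.
rewrite !traceD traceZ !traceN trace_sum -/tr.
have -> : tr (fun k l => nRm (T i) (T l) N (T k) (T j)) = nRic (T i) N (T j).
  by rewrite /nRic nRm_NNl addr0 -[LHS]tr_sym.
have -> : tr (fun k l => Rm (T l) N (T k) N) = Ric N N.
  by rewrite /Ric Rm_NNr addr0 -[LHS]tr_sym.
rewrite mulrN; congr (_ + _ + _ - _).
by apply: eq_bigr => p _; exact: traceZ.
Qed.

Lemma simons i j : tr (fun k l => nab3 d c nA k l i j) =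
  hess H i j + \sum_k amix k j * Rtr k i + \sum_k amix k i * Rtr k j
  - 2 * \sum_k \sum_l aup k l * Rm (T k) (T i) (T l) (T j)
  + H * asq i j - norm2 * a i j + H * Rm N (T i) N (T j) - a i j * Ric N N
  + nRic N (T i) (T j) - nRic (T j) (T i) N - nRic (T i) N (T j)
  - nRm N N (T i) N (T j).
Proof.
have E k l : nab3 d c nA k l i j = nab3 d c nA i j k l + nab3 d c cod i k j l
    - \sum_p rh p l k i * a p j - \sum_p rh p j k i * a l p
    + nab3 d c cod k l i j.
  rewrite nabla_swap12 -(nabla_rotate i k l j); congr (_ + _).
  have := ricci_identity d_mul a k i l j chr_sym d_comm.
  rewrite -/nA -/c big_split /= => /eqP; rewrite subr_eq => /eqP ->.
  rewrite /rh; ring.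
rewrite {1}/tr (eq_trace _ E) traceD traceB traceB traceD -/tr.
rewrite trace_nabla2 trace_gauss1.
rewrite trace_gauss2 trace_cod1 trace_cod2.
(* The contractions of A with R_0l0j left by the two Codazzi traces are opposite and cancel. *)
have -> : tr (fun k l => a k i * Rm N (T j) (T l) N) =
    - tr (fun k l => a i k * Rm N (T l) N (T j)).
  rewrite -traceN; apply: eq_trace => k l.
  by rewrite a_sym Rm_anti34 mulrN (Rm_pair N (T l)).
ring.
Qed.

Let ip_NDN i : ip N (D i N) = 0.
Proof. by rewrite ip_sym ip_DN. Qed.

Lemma evol_h i j : dt (h i j) = - 2 * Ric (T i) (T j) - 2 * H * a i j.
Proof.
rewrite /h dt_ip !torsion_t flow !D_mul.
rewrite !(scalar_add _ _ (ip_lin _)) !(scalar_add _ _ (ip_linl _)).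
rewrite !(scalar_scale _ _ (ip_lin _)) !(scalar_scale _ _ (ip_linl _)).
rewrite (ip_sym (T i) N) (ip_sym (T i)) !ip_DNT !NT (a_sym j i); ring.
Qed.

Let dt_nat (b : nat) : dt b%:R = 0.
Proof. exact: (@deriv_nat _ 1 (fun=> dt) (fun=> dt_mul) ord0). Qed.

(** The unit length of [N] is measured by a moving metric, so [Dt N] has a normal component: half of
    the 2 Ric(N, N) that compensates the change of the metric. *)
Lemma ip_DtN : ip (Dt N) N = Ric N N.
Proof.
have := dt_ip N N; rewrite NN (dt_nat 1) (ip_sym N) => e.
by apply: two_inj; apply/eqP; rewrite -subr_eq0 {1}e; apply/eqP; ring.
Qed.

Lemma ip_DtNT k : ip (Dt N) (T k) = 2 * Ric N (T k) - d k H.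
Proof.
have := dt_ip N (T k); rewrite NT raddf0 torsion_t flow D_mul.
rewrite (scalar_add _ _ (ip_lin _)) !(scalar_scale _ _ (ip_lin _)) ip_NDN NN =>
  e.
by apply/eqP; rewrite -subr_eq0 [X in _ == X]e; apply/eqP; ring.
Qed.

Let nRic_sym s u v : nRic s u v = nRic s v u.
Proof.
rewrite /nRic nRm_pair -tr_sym; congr (_ + _).
by apply: eq_trace => k l; rewrite nRm_pair.
Qed.

Let Ric_lin u : scalar (Ric u).
Proof.
move=> b v w; rewrite /Ric Rm_lin4 mulrDr addrACA -[b * tr _]traceZ -traceD.
by congr (_ + _); apply: eq_trace => k l; rewrite Rm_lin4.
Qed.

Lemma evol_a_hess i j : dt (a i j) =
  hess H i j - H * asq i j + H * Rm N (T j) N (T i) - a i j * Ric N N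
  - nRic (T i) N (T j) - nRic (T j) (T i) N + nRic N (T i) (T j).
Proof.
have eN : ip N (Dt (D i (T j))) = ip N (D i (D j X)) +
    Rm N (T j) X (T i)
    - (nRic (T i) (T j) N + nRic (T j) (T i) N - nRic N (T i) (T j)).
  have := ricci_id_t i N (T j); rewrite (scalar_sub _ _ (ip_lin _)) torsion_t.
  by move=> /eqP; rewrite subr_eq => /eqP ->; ring.
(* The cross terms of the product rule vanish because derivatives of [N] are tangential; the second
   derivative of [N] contributes -A_ik A^k_j after moving one derivative to the other factor of g(N,
   D_j N) = 0. *)
have eX : ip N (D i (D j X)) = d i (d j H) - H * asq i j.
  rewrite flow D_mul raddfD !D_mul !(scalar_add _ _ (ip_lin _)).
  rewrite !(scalar_scale _ _ (ip_lin _)) !ip_NDN NN.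
  have -> : ip N (D i (D j N)) = - asq i j.
    have := d_ip i N (D j N); rewrite ip_NDN raddf0 (lin_DN j (ip_lin _)).
    move=> /eqP; rewrite eq_sym addrC addr_eq0 => /eqP ->.
    congr (- _); rewrite -sumrN; apply: eq_bigr => p _.
    by rewrite ip_DNT mulrN opprK mulrC.
  ring.
rewrite dt_ip eN eX (lin_DT _ _ (ip_lin _)) ip_DtN (lin_DT _ _ (Ric_lin _)).
rewrite flow (scalar_scale _ _ (Rm_lin3 _ _ _)) (nRic_sym (T i) (T j)) /hess.
(* The gradient part of [Dt N] completes the second partial derivatives of H to the Hessian. Its
   Ricci part cancels the tangential Ricci terms produced by the moving metric. *)
under eq_bigr => p _ do rewrite ip_DtNT mulrBr.
rewrite sumrB [X in X - _ + _](_ : _ = 2 * \sum_p c p i j * Ric N (T p)).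
  by ring.
by rewrite mulr_sumr; apply: eq_bigr => p _; ring.
Qed.

Lemma evol_a i j : dt (a i j) =
  tr (fun k l => nab3 d c nA k l i j)
  - \sum_k amix k i * Rtr k j - \sum_k amix k j * Rtr k i
  + 2 * (\sum_k \sum_l aup k l * Rm (T k) (T i) (T l) (T j))
  - 2 * H * asq i j + norm2 * a i j + nRm N N (T i) N (T j).
Proof. by rewrite evol_a_hess simons (Rm_pair N (T i)); ring. Qed.

Let contract_mix B :
  tr (fun i j => \sum_k amix k i * B k j) = \sum_k \sum_l aup k l * B k l.
Proof. by rewrite contract_up. Qed.

(** Under the trace the undifferentiated curvature terms of [evol_a] cancel one another, so 2 A^{ij}
    R_ij comes entirely from the time derivative of the inverse metric. The same derivative
    contributes 2 H |A|^2, which offsets the trace of -2 H A_ik A^k_j. *)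
Lemma evol_H : dt H = tr (hess H)
  + 2 * (\sum_i \sum_j aup i j * Ric (T i) (T j)) + norm2 * H + nRic N N N.
Proof.
have dhi k l : dt (hi k l) =
    2 * \sum_p \sum_q hi k p * hi l q * (Ric (T p) (T q) + H * a p q).
  rewrite (@deriv_inv _ _ (fun=> dt) _ _ hi_sym (fun=> dt_mul) hi_inv h_sym k).
  rewrite -sumrN mulr_sumr; apply: eq_bigr => p _.
  rewrite -sumrN mulr_sumr; apply: eq_bigr => q _.
  rewrite evol_h (hi_sym l q); ring.
have adj C : \sum_k \sum_l (\sum_p \sum_q hi k p * hi l q * C p q) * a k l =
    \sum_p \sum_q aup p q * C p q.
  rewrite !pair_bigA /=.
  under eq_bigr => u _ do rewrite pair_bigA mulr_suml /=.
  rewrite exchange_big; apply: eq_bigr => -[p q] _ /=.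
  rewrite /aup pair_bigA mulr_suml; apply: eq_bigr => -[k l] _ /=.
  rewrite (hi_sym k p) (hi_sym l q); ring.
have e1 : \sum_k \sum_l dt (hi k l) * a k l =
    2 * (\sum_i \sum_j aup i j * Ric (T i) (T j)) + 2 * (H * norm2).
  under eq_bigr => k _ do under eq_bigr => l _ do rewrite dhi -mulrA.
  under eq_bigr => k _ do rewrite -mulr_sumr.
  rewrite -mulr_sumr adj -mulrDr; congr (_ * _).
  rewrite /norm2 mulr_sumr -big_split; apply: eq_bigr => p _ /=.
  by rewrite mulr_sumr -big_split; apply: eq_bigr => q _ /=; ring.
have e2 : tr (fun i j => tr (fun k l => nab3 d c nA k l i j)) = tr (hess H).
  transitivity (tr (fun k l => tr (fun i j => nab3 d c nA k l i j))).
    rewrite /tr /trace !pair_bigA /=.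
    under eq_bigr => u _ do rewrite pair_bigA mulr_sumr /=.
    under [RHS]eq_bigr => u _ do rewrite pair_bigA mulr_sumr /=.
    rewrite exchange_big; apply: eq_bigr => u _; apply: eq_bigr => v _; ring.
  by apply: eq_trace => k l; exact: trace_nabla2.
have e3 : tr (fun i j => \sum_k \sum_l aup k l * Rm (T k) (T i) (T l) (T j))
    = \sum_k \sum_l aup k l * Rtr k l.
  rewrite /tr trace_sum; apply: eq_bigr => k _; rewrite trace_sum.
  apply: eq_bigr => l _; rewrite traceZ; congr (_ * _).
  rewrite -/tr -tr_sym; apply: eq_trace => i j.
  by rewrite Rm_anti12 Rm_anti34 opprK.
have e4 : tr (fun i j => \sum_k amix k j * Rtr k i) =
    \sum_k \sum_l aup k l * Rtr k l.
  by rewrite -contract_mix -[RHS]tr_sym.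
have e5 : tr asq = norm2.
  rewrite /norm2 -contract_mix -tr_sym; apply: eq_trace => i j.
  by apply: eq_bigr => k _; rewrite a_sym mulrC.
have e6 : tr (fun i j => nRm N N (T i) N (T j)) = nRic N N N.
  rewrite /nRic nRm_NNl addr0; apply: eq_trace => k l.
  by rewrite nRm_anti12 nRm_anti34 opprK.
have dtr : dt (tr a) = \sum_k \sum_l dt (hi k l) * a k l
                       + tr (fun k l => dt (a k l)).
  rewrite /tr /trace raddf_sum -big_split; apply: eq_bigr => k _ /=.
  rewrite raddf_sum -big_split; apply: eq_bigr => l _ /=.
  exact: dt_mul.
rewrite {1}H_def dtr e1 {1}/tr (eq_trace _ evol_a).
rewrite !traceD !traceN !traceZ -/tr.
rewrite e2 e3 e4 e6 contract_mix e5 -H_def.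
ring.
Qed.

End Core.

(** * The Riemann tensor of a metric in coordinates *)

(** The octahedron argument: four instances of the first Bianchi identity, two with each sign, add
    up to twice the difference of the two sides once the antisymmetries are applied. *)
Lemma curvature_pair_sym (A : comPzRingType) (half : A) (I : Type)
    (r : I -> I -> I -> I -> A) :
  half + half = 1 ->
  (forall a b c d, r b a c d = - r a b c d) ->
  (forall a b c d, r a b d c = - r a b c d) ->
  (forall a b c d, r a b c d + r a c d b + r a d b c = 0) ->
  forall a b c d, r c d a b = r a b c d.
Proof.
move=> half2 r12 r34 rB a b c d; apply: (two_inj half2).
apply/eqP; rewrite -subr_eq0; apply/eqP.
transitivity (r c d a b + r c a b d + r c b d a
  + (r d c b a + r d b a c + r d a c b)
  - (r a b c d + r a c d b + r a d b c)
  - (r b a d c + r b d c a + r b c a d)); last by rewrite !rB !subr0 addr0.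
rewrite (r12 c d b a) (r34 c d a b) (r12 a c b d) (r34 a c d b).
rewrite (r12 b c d a) (r34 b c a d) (r12 b d a c) (r34 b d c a) (r34 a c b d).
rewrite (r12 a d c b) (r34 a d b c) (r12 a b d c) (r34 a b c d); ring.
Qed.

Section Ambient.
Variables (A : comPzRingType) (n : nat) (d : 'I_n -> {additive A -> A}).
Variables (half : A) (half2 : half + half = 1).
Variables (g gi : 'I_n -> 'I_n -> A).
Hypothesis d_mul : forall i x y, d i (x * y) = d i x * y + x * d i y.
Hypothesis d_comm : forall i j x, d i (d j x) = d j (d i x).
Hypothesis g_sym : forall k l, g k l = g l k.
Hypothesis gi_sym : forall k l, gi k l = gi l k.
Hypothesis g_inv : forall k l, \sum_q gi k q * g q l = (k == l)%:R.

Let c := chr d half g gi.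
Let up := curv_up d c.

Definition curv_low (a b k i : 'I_n) := \sum_e g a e * up e b k i.
Definition ricci_tensor (b i : 'I_n) := \sum_a up a b a i.

Let rm := curv_low.
Let ric := ricci_tensor.

Lemma christoffel_sym p i j : c p i j = c p j i.
Proof.
rewrite /c /chr; congr (_ * _); apply: eq_bigr => l _.
by rewrite (g_sym i j); congr (_ * _); ring.
Qed.

Lemma christoffel_low i j b : \sum_p c p i j * g p b =
  half * (d i (g j b) + d j (g i b) - d b (g i j)).
Proof.
rewrite /c /chr; under eq_bigr => p _ do rewrite -mulrA mulr_suml.
rewrite -mulr_sumr exchange_big; congr (_ * _) => /=.
rewrite -[RHS](sum_delta (fun l => d i (g j l) + d j (g i l) - d l (g i j))).
apply: eq_bigr => l _; rewrite eq_sym -g_inv mulr_suml.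
by apply: eq_bigr => p _; rewrite (gi_sym l p); ring.
Qed.

Lemma metric_compat i k l :
  d i (g k l) = \sum_p (c p i k * g p l + c p i l * g k p).
Proof.
rewrite big_split /= christoffel_low.
under eq_bigr => p _ do rewrite (g_sym k p).
rewrite christoffel_low -mulrDr (g_sym l k) (g_sym i k) (g_sym i l).
rewrite [X in _ * X](_ : _ = d i (g k l) + d i (g k l)); last by ring.
by rewrite mulrDr -mulrDl half2 mul1r.
Qed.

Lemma curv_up_anti34 a b k i : up a b i k = - up a b k i.
Proof. by rewrite /up /curv_up !sumrB; ring. Qed.

Lemma curv_up_bianchi1 a b k i : up a b k i + up a k i b + up a i b k = 0.
Proof.
rewrite /up /curv_up !sumrB.
have e x y z : \sum_e c a x e * c e y z = \sum_e c a x e * c e z y.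
  by apply: eq_bigr => e _; rewrite (christoffel_sym e).
rewrite (e k b i) (e i k b) (e b i k) (christoffel_sym a b i).
rewrite (christoffel_sym a b k) (christoffel_sym a i k); ring.
Qed.

Lemma curv_low_anti34 a b k i : rm a b i k = - rm a b k i.
Proof.
by rewrite -sumrN; apply: eq_bigr => e _; rewrite curv_up_anti34 mulrN.
Qed.

Lemma curv_low_bianchi1 a b k i : rm a b k i + rm a k i b + rm a i b k = 0.
Proof.
rewrite /rm /curv_low -!big_split big1 // => e _ /=.
by rewrite -!mulrDr curv_up_bianchi1 mulr0.
Qed.

(* This is the Ricci identity applied to the metric, which is parallel. *)
Lemma curv_low_anti12 a b k i : rm b a k i = - rm a b k i.
Proof.
have z x y w : nab2 d c g x y w = 0 by rewrite /nab2 metric_compat subrr.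
have z3 x y w u : nab3 d c (nab2 d c g) x y w u = 0.
  rewrite /nab3 z raddf0 sub0r big1 ?oppr0 // => l _.
  by rewrite !z !mulr0 !addr0.
have := ricci_identity d_mul g k i b a christoffel_sym d_comm.
rewrite !z3 subr0 => /esym/eqP; rewrite oppr_eq0 big_split /= addr_eq0.
rewrite /rm /curv_low => /eqP e; rewrite -[LHS]opprK; congr (- _).
transitivity (- \sum_p up p a k i * g b p).
  by congr (- _); apply: eq_bigr => p _; rewrite mulrC.
by rewrite -e; apply: eq_bigr => p _; rewrite mulrC g_sym.
Qed.

Lemma curv_low_pair a b k i : rm k i a b = rm a b k i.
Proof.
apply: (curvature_pair_sym half2).
- by move=> *; exact: curv_low_anti12.
- by move=> *; exact: curv_low_anti34.
- by move=> *; exact: curv_low_bianchi1.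
Qed.

Let nup e a b k i := d e (up a b k i) + \sum_l (c a e l * up l b k i
  - c l e b * up a l k i - c l e k * up a b l i - c l e i * up a b k l).

(** The metric is parallel, so lowering an index commutes with the covariant derivative. The second
    Bianchi identity can therefore be proved with the first index up, where the curvature is a
    matrix. *)
Lemma nab4_low e a b k i :
  nab4 d c rm e a b k i = \sum_f g a f * nup e f b k i.
Proof.
rewrite /nab4 /rm /curv_low raddf_sum /=.
under eq_bigr => f _ do rewrite d_mul metric_compat.
rewrite /nup; under [RHS]eq_bigr => f _ do rewrite mulrDr mulr_sumr.
have ex (x : 'I_n -> A) (z : 'I_n -> 'I_n -> A) :
    \sum_l x l * (\sum_f g a f * z f l) = \sum_f \sum_l g a f * (x l * z f l).
  under eq_bigr => l _ do rewrite mulr_sumr.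
  rewrite exchange_big; apply: eq_bigr => f _; apply: eq_bigr => l _; ring.
have e1 : \sum_f (\sum_p (c p e a * g p f + c p e f * g a p)) * up f b k i =
    \sum_l c l e a * (\sum_f g l f * up f b k i)
    + \sum_f \sum_l g a f * (c f e l * up l b k i).
  under eq_bigr => f _ do rewrite mulr_suml.
  rewrite exchange_big -big_split; apply: eq_bigr => l _ /=.
  rewrite mulr_sumr -big_split; apply: eq_bigr => f _ /=; ring.
rewrite !big_split /= e1 !ex.
under [X in _ = _ + X]eq_bigr => f _ do
  (under eq_bigr => l _ do rewrite !mulrBr; rewrite !sumrB).
rewrite !sumrB; ring.
Qed.

(** Connection and curvature matrices: [RM k i] is the commutator of the operators d_k + M_k and d_i
    + M_i. *)
Let M k := \matrix_(a, b) c a k b.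
Let RM k i := \matrix_(a, b) up a b k i.
Let dM e (X : 'M[A]_n) := map_mx (d e) X.

Let dM_mul e X Y : dM e (X *m Y) = dM e X *m Y + X *m dM e Y.
Proof.
apply/matrixP => a b; rewrite !mxE raddf_sum -big_split.
by apply: eq_bigr => l _; rewrite d_mul !mxE.
Qed.

Let addmxE (X Y : 'M[A]_n) a b : (X + Y) a b = X a b + Y a b.
Proof. by rewrite mxE. Qed.

Let oppmxE (X : 'M[A]_n) a b : (- X) a b = - X a b.
Proof. by rewrite mxE. Qed.

Let RM_def k i : RM k i = dM k (M i) - dM i (M k) + (M k *m M i - M i *m M k).
Proof.
apply/matrixP => a b; rewrite !mxE /up /curv_up sumrB.
by congr (_ - _ + (_ - _)); apply: eq_bigr => e _; rewrite !mxE.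
Qed.

(* The Jacobi identity for the matrix-valued operators [d k + M k]. *)
Let RM_jacobi e k i :
  (dM e (RM k i) + (M e *m RM k i - RM k i *m M e))
  + (dM k (RM i e) + (M k *m RM i e - RM i e *m M k))
  + (dM i (RM e k) + (M i *m RM e k - RM e k *m M i)) = 0.
Proof.
have dMD x X Y : dM x (X + Y) = dM x X + dM x Y.
  by apply/matrixP => a b; rewrite !mxE raddfD.
have dMN x X : dM x (- X) = - dM x X.
  by apply/matrixP => a b; rewrite !mxE raddfN.
have dMC x y X : dM x (dM y X) = dM y (dM x X).
  by apply/matrixP => a b; rewrite !mxE d_comm.
rewrite !RM_def !(dMD, dMN, dM_mul) (dMC k e) (dMC i e) (dMC i k).
rewrite !(mulmxDr, mulmxDl, mulmxN, mulNmx) !mulmxA.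
apply/matrixP => a b; rewrite !(addmxE, oppmxE) [RHS]mxE; ring.
Qed.

Lemma curv_low_bianchi2 e a b k i :
  nab4 d c rm e a b k i + nab4 d c rm k a b i e + nab4 d c rm i a b e k = 0.
Proof.
rewrite !nab4_low -!big_split big1 //= => f _; rewrite -!mulrDr.
suff -> : nup e f b k i + nup k f b i e + nup i f b e k = 0 by rewrite mulr0.
have eM x y z : (M x *m RM y z) f b = \sum_l c f x l * up l b y z.
  by rewrite mxE; apply: eq_bigr => l _; rewrite !mxE.
have eR x y z : (RM y z *m M x) f b = \sum_l c l x b * up f l y z.
  by rewrite mxE; apply: eq_bigr => l _; rewrite !mxE mulrC.
have ed x y z : dM x (RM y z) f b = d x (up f b y z) by rewrite !mxE.
have := congr1 (fun X : 'M[A]_n => X f b) (RM_jacobi e k i).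
rewrite !(addmxE, oppmxE) !eM !eR !ed mxE => <-.
(* In the cyclic sum the connection terms on the two differential-form indices cancel in pairs, the
   connection being torsion-free; the Jacobi identity remains. *)
have an x y z : \sum_l c l x y * up f b z l = - \sum_l c l y x * up f b l z.
  rewrite -sumrN; apply: eq_bigr => l _.
  by rewrite curv_up_anti34 christoffel_sym mulrN.
rewrite /nup !sumrB !an; ring.
Qed.

Lemma nab4_anti12 e a b k i : nab4 d c rm e b a k i = - nab4 d c rm e a b k i.
Proof.
rewrite /nab4 curv_low_anti12 raddfN -opprD; congr (- (_ + _)).
rewrite -sumrN; apply: eq_bigr => l _.
rewrite (curv_low_anti12 a l) (curv_low_anti12 l b) !(curv_low_anti12 a b);
  ring.
Qed.

Lemma nab4_anti34 e a b k i : nab4 d c rm e a b i k = - nab4 d c rm e a b k i.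
Proof.
rewrite /nab4 curv_low_anti34 raddfN -opprD; congr (- (_ + _)).
rewrite -sumrN; apply: eq_bigr => l _.
rewrite !(curv_low_anti34 _ _ k) (curv_low_anti34 a b l i); ring.
Qed.

Lemma nab4_pair e a b k i : nab4 d c rm e k i a b = nab4 d c rm e a b k i.
Proof.
rewrite /nab4 curv_low_pair; congr (_ - _); apply: eq_bigr => l _.
rewrite !(curv_low_pair _ _ l) !(curv_low_pair _ _ k); ring.
Qed.

Lemma ricci_trace b i : ric b i = trace gi (fun a k => rm a b k i).
Proof.
rewrite /ric /trace /ricci_tensor exchange_big; apply: eq_bigr => k _ /=.
rewrite /rm /curv_low.
under eq_bigr => a _ do rewrite mulr_sumr.
rewrite exchange_big /= -[LHS](sum_delta (fun e => up e b k i)).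
apply: eq_bigr => e _; rewrite -g_inv mulr_suml; apply: eq_bigr => a _.
by rewrite (gi_sym k a) mulrA.
Qed.

Lemma ricci_sym b i : ric b i = ric i b.
Proof.
rewrite !ricci_trace -[RHS](trace_sym gi_sym); apply: eq_trace => a k.
by rewrite curv_low_pair.
Qed.

Lemma nab2_ricci e b i :
  nab2 d c ric e b i = trace gi (fun a k => nab4 d c rm e a b k i).
Proof.
rewrite /nab2 ricci_trace (deriv_trace gi_sym d_mul g_inv g_sym metric_compat).
under [X in _ - X]eq_bigr => l _ do rewrite !ricci_trace -!traceZ -traceD.
rewrite -trace_sum -traceB; apply: eq_trace => a k.
rewrite /nab2 /nab4 -addrA -opprD -big_split; congr (_ - _).
by apply: eq_bigr => l _ /=; ring.
Qed.

Variable dt : {additive A -> A}.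
Hypothesis dt_mul : forall x y, dt (x * y) = dt x * y + x * dt y.
Hypothesis dt_comm : forall i x, dt (d i x) = d i (dt x).
Hypothesis flow : forall k l, dt (g k l) = - 2 * ric k l.

(* Differentiating metric compatibility in time determines the variation of the
   Christoffel symbols by the same cyclic trick as for the Koszul formula. *)
Lemma variation_chr k a b : \sum_e g a e * dt (c e k b) =
  - (nab2 d c ric k b a + nab2 d c ric b k a - nab2 d c ric a k b).
Proof.
pose s k a b := \sum_e g a e * dt (c e k b).
have s_sym x y z : s x y z = s z y x.
  by apply: eq_bigr => e _; rewrite christoffel_sym.
have E x y z : s x y z + s x z y = - 2 * nab2 d c ric x y z.
  have := dt_comm x (g y z); rewrite flow metric_compat raddf_sum /=.
  under eq_bigr => p _ do
    rewrite raddfD /= !(dt_mul (c _ _ _)) !flow.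
  have d2 w : d x (- 2 * w) = - 2 * d x w.
    by rewrite !mulNr raddfN /= !mulr_natl raddfMn.
  rewrite d2 /nab2 mulrBr => <-.
  rewrite /s mulr_sumr -sumrB -big_split; apply: eq_bigr => p _ /=.
  rewrite (g_sym p z). ring.
apply: (two_inj half2); rewrite -/(s k a b).
transitivity ((s k a b + s k b a) + (s b a k + s b k a) - (s a k b + s a b k)).
  by rewrite (s_sym b a k) (s_sym b k a) (s_sym a b k); ring.
have n_sym x y z : nab2 d c ric x y z = nab2 d c ric x z y.
  rewrite /nab2 ricci_sym; congr (_ - _); apply: eq_bigr => l _.
  by rewrite addrC (ricci_sym l) (ricci_sym y).
rewrite !E (n_sym k a b) (n_sym b a k); ring.
Qed.

End Ambient.

(** * Pulling tensors back along a map *)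

Section Contraction.
Variables (Q : comPzRingType) (n : nat).
Implicit Types (u v w z s : 'cV[Q]_n).

(** Tensors are evaluated by nesting this single contraction, so that linearity and the Leibniz rule
    in higher rank follow from the rank-one case. The lemmas with suffix [E] recover the multiple
    sums. *)
Definition ct (r : 'I_n -> Q) v : Q := \sum_a r a * v a 0.

Definition form2 (r : 'I_n -> 'I_n -> Q) u v : Q :=
  ct (fun a => ct (r a) v) u.

Definition form3 (r : 'I_n -> 'I_n -> 'I_n -> Q) s u v : Q :=
  ct (fun e => form2 (r e) u v) s.

Definition form4 (r : 'I_n -> 'I_n -> 'I_n -> 'I_n -> Q) u v w z : Q :=
  form2 (fun a b => form2 (r a b) w z) u v.

Definition form5 (r : 'I_n -> 'I_n -> 'I_n -> 'I_n -> 'I_n -> Q)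
    s u v w z : Q :=
  ct (fun e => form4 (r e) u v w z) s.

Lemma eq_ct r r' v : (forall a, r a = r' a) -> ct r v = ct r' v.
Proof. by move=> e; apply: eq_bigr => a _; rewrite e. Qed.

Lemma eq_form2 r r' u v : (forall a b, r a b = r' a b) ->
  form2 r u v = form2 r' u v.
Proof. by move=> e; apply: eq_ct => a; apply: eq_ct => b. Qed.

Lemma ct_lin r : scalar (ct r).
Proof.
move=> x u v; rewrite /ct mulr_sumr -big_split; apply: eq_bigr => a _ /=.
by rewrite !mxE; ring.
Qed.

Lemma ct_sum I (q : seq I) P (x : I -> Q) (r : I -> 'I_n -> Q) v :
  ct (fun a => \sum_(i <- q | P i) x i * r i a) v
  = \sum_(i <- q | P i) x i * ct (r i) v.
Proof.
rewrite /ct; under eq_bigr => a _ do rewrite mulr_suml.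
rewrite exchange_big; apply: eq_bigr => i _; rewrite mulr_sumr.
by apply: eq_bigr => a _; rewrite mulrA.
Qed.

Lemma ctD r r' v : ct (fun a => r a + r' a) v = ct r v + ct r' v.
Proof. by rewrite -big_split; apply: eq_bigr => a _; rewrite mulrDl. Qed.

Lemma ctZ x r v : ct (fun a => x * r a) v = x * ct r v.
Proof. by rewrite mulr_sumr; apply: eq_bigr => a _; rewrite mulrA. Qed.

Lemma ctN r v : ct (fun a => - r a) v = - ct r v.
Proof. by rewrite -sumrN; apply: eq_bigr => a _; rewrite mulNr. Qed.

Lemma form2_swap r u v : form2 r u v = form2 (fun a b => r b a) v u.
Proof.
rewrite /form2 /ct; under eq_bigr => a _ do rewrite mulr_suml.
rewrite exchange_big; apply: eq_bigr => b _; rewrite mulr_suml.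
by apply: eq_bigr => a _; ring.
Qed.

Lemma form2_lin1 r v : scalar (fun u => form2 r u v).
Proof. by move=> x u u'; rewrite /form2 ct_lin. Qed.

Lemma form2_lin2 r u : scalar (form2 r u).
Proof. by move=> x v v'; rewrite !(form2_swap r u) form2_lin1. Qed.

Lemma form2N r u v : form2 (fun a b => - r a b) u v = - form2 r u v.
Proof. by rewrite -ctN; apply: eq_ct => a; rewrite ctN. Qed.

Lemma form2D r r' u v :
  form2 (fun a b => r a b + r' a b) u v = form2 r u v + form2 r' u v.
Proof. by rewrite -ctD; apply: eq_ct => a; rewrite ctD. Qed.

Lemma form2Z x r u v : form2 (fun a b => x * r a b) u v = x * form2 r u v.
Proof. by rewrite -ctZ; apply: eq_ct => a; rewrite ctZ. Qed.

Lemma form2_sum I (q : seq I) P (x : I -> Q) (r : I -> 'I_n -> 'I_n -> Q) u v :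
  form2 (fun a b => \sum_(i <- q | P i) x i * r i a b) u v
  = \sum_(i <- q | P i) x i * form2 (r i) u v.
Proof. by rewrite -ct_sum; apply: eq_ct => a; rewrite ct_sum. Qed.

Lemma form2E r u v : form2 r u v = \sum_a \sum_b r a b * u a 0 * v b 0.
Proof.
apply: eq_bigr => a _; rewrite mulr_suml; apply: eq_bigr => b _; ring.
Qed.

Lemma form3E r s u v : form3 r s u v =
  \sum_e \sum_a \sum_b r e a b * s e 0 * u a 0 * v b 0.
Proof.
apply: eq_bigr => e _; rewrite form2E mulr_suml; apply: eq_bigr => a _.
by rewrite mulr_suml; apply: eq_bigr => b _; ring.
Qed.

Lemma form4E r u v w z : form4 r u v w z =
  \sum_a \sum_b \sum_c \sum_d r a b c d * u a 0 * v b 0 * w c 0 * z d 0.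
Proof.
rewrite /form4 form2E; apply: eq_bigr => a _; apply: eq_bigr => b _.
rewrite form2E !mulr_suml; apply: eq_bigr => c _; rewrite !mulr_suml.
by apply: eq_bigr => d _; ring.
Qed.

Lemma form5E r s u v w z : form5 r s u v w z =
  \sum_e \sum_a \sum_b \sum_c \sum_d
    r e a b c d * s e 0 * u a 0 * v b 0 * w c 0 * z d 0.
Proof.
apply: eq_bigr => e _; rewrite form4E mulr_suml; apply: eq_bigr => a _.
rewrite mulr_suml; apply: eq_bigr => b _; rewrite mulr_suml.
apply: eq_bigr => c _; rewrite mulr_suml; apply: eq_bigr => d _; ring.
Qed.

Lemma form4_lin1 r v w z : scalar (fun u => form4 r u v w z).
Proof. exact: form2_lin1. Qed.

Lemma form4_lin2 r u w z : scalar (fun v => form4 r u v w z).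
Proof. exact: form2_lin2. Qed.

Lemma form4_lin3 r u v z : scalar (fun w => form4 r u v w z).
Proof.
move=> x w w'; rewrite /form4 -form2Z -form2D; apply: eq_form2 => a b.
exact: form2_lin1.
Qed.

Lemma form4_lin4 r u v w : scalar (form4 r u v w).
Proof.
move=> x z z'; rewrite /form4 -form2Z -form2D; apply: eq_form2 => a b.
exact: form2_lin2.
Qed.

Lemma form4_anti12 r u v w z :
  (forall a b c d, r b a c d = - r a b c d) ->
  form4 r v u w z = - form4 r u v w z.
Proof.
move=> e; rewrite /form4 form2_swap -form2N; apply: eq_form2 => a b.
by rewrite -form2N; apply: eq_form2 => c d.
Qed.

Lemma form4_anti34 r u v w z :
  (forall a b c d, r a b d c = - r a b c d) ->
  form4 r u v z w = - form4 r u v w z.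
Proof.
move=> e; rewrite /form4 -form2N; apply: eq_form2 => a b.
by rewrite form2_swap -form2N; apply: eq_form2 => c d.
Qed.

Lemma form4_exchange r u v w z :
  form4 r u v w z = form4 (fun c d a b => r a b c d) w z u v.
Proof.
rewrite /form4 !form2E !pair_bigA /=.
under eq_bigr => p _ do rewrite form2E pair_bigA -mulrA mulr_suml /=.
rewrite exchange_big; apply: eq_bigr => -[c d] _ /=.
rewrite form2E pair_bigA -mulrA mulr_suml; apply: eq_bigr => -[a b] _ /=; ring.
Qed.

Lemma form4_pair r u v w z :
  (forall a b c d, r c d a b = r a b c d) ->
  form4 r w z u v = form4 r u v w z.
Proof.
move=> e; rewrite form4_exchange; apply: eq_form2 => a b.
by apply: eq_form2 => c d.
Qed.

Lemma form4_swap23 r u v w z :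
  form4 r u v w z = form4 (fun a c b d => r a b c d) u w v z.
Proof.
apply: eq_ct => a.
transitivity (form2 (fun b c => ct (r a b c) z) v w); first by [].
by rewrite form2_swap.
Qed.

Lemma form3_swap12 r s u v :
  form3 r s u v = form3 (fun b e => r e b) u s v.
Proof. exact: form2_swap. Qed.

Lemma form3_swap23 r s u v :
  form3 r s u v = form3 (fun e b a => r e a b) s v u.
Proof. by apply: eq_ct => e; rewrite form2_swap. Qed.

Lemma form5_bianchi r s u v w z :
  (forall e a b c d, r e a b c d + r c a b d e + r d a b e c = 0) ->
  form5 r s u v w z + form5 r w u v z s + form5 r z u v s w = 0.
Proof.
(* With [u] and [v] frozen, the identity concerns the three-index array [K] and its cyclic
   permutations. *)
move=> cyc; pose K e c d := form2 (fun a b => r e a b c d) u v.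
have KE s' w' z' : form5 r s' u v w' z' =
    \sum_e \sum_c \sum_d K e c d * s' e 0 * w' c 0 * z' d 0.
  apply: eq_bigr => e _; rewrite form4_exchange /form4 form2E mulr_suml.
  apply: eq_bigr => c _; rewrite mulr_suml.
  by apply: eq_bigr => d _; rewrite /K; ring.
have K0 e c d : K e c d + K c d e + K d e c = 0.
  rewrite /K -!form2D; apply: big1 => a _.
  by rewrite /ct big1 ?mul0r // => b _; rewrite cyc mul0r.
rewrite !KE.
have -> : \sum_e \sum_c \sum_d K e c d * w e 0 * z c 0 * s d 0 =
   \sum_e \sum_c \sum_d K c d e * s e 0 * w c 0 * z d 0.
  under eq_bigr => e _ do rewrite exchange_big /=.
  rewrite exchange_big; apply: eq_bigr => d _; apply: eq_bigr => e _.
  by apply: eq_bigr => c _; ring.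
have -> : \sum_e \sum_c \sum_d K e c d * z e 0 * s c 0 * w d 0 =
   \sum_e \sum_c \sum_d K d e c * s e 0 * w c 0 * z d 0.
  rewrite exchange_big; apply: eq_bigr => c _; rewrite exchange_big.
  apply: eq_bigr => d _; apply: eq_bigr => e _; ring.
rewrite -!big_split big1 // => e _; rewrite -!big_split big1 // => c _.
rewrite -!big_split big1 // => d _ /=.
by rewrite -!mulrDl K0 !mul0r.
Qed.

End Contraction.

(** * The pulled-back connection and its Leibniz rules *)

Section Connection.
Variables (Q : comPzRingType) (n : nat).
Variables (gam : 'I_n -> 'I_n -> 'I_n -> Q).

(* With [gam a k b] for Gamma^a_kb pulled back, the matrix of the connection in
   the direction [X], and the covariant derivative along [d] for a curve with
   velocity [X]. *)
Definition omega (X : 'cV[Q]_n) (a b : 'I_n) : Q :=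
  \sum_k X k 0 * gam a k b.

Definition covd (d : {additive Q -> Q}) (X v : 'cV[Q]_n) : 'cV[Q]_n :=
  \col_a (d (v a 0) + \sum_b omega X a b * v b 0).

Lemma covd_is_additive d X : zmod_morphism (covd d X).
Proof.
move=> u v; apply/colP => a; rewrite !mxE raddfB opprD addrACA; congr (_ + _).
by rewrite -sumrB; apply: eq_bigr => b _; rewrite !mxE mulrBr.
Qed.

HB.instance Definition _ d X :=
  GRing.isZmodMorphism.Build _ _ (covd d X) (covd_is_additive d X).

Variable d : {additive Q -> Q}.
Hypothesis d_mul : forall x y, d (x * y) = d x * y + x * d y.

Lemma covd_mul X x v : covd d X (x *: v) = d x *: v + x *: covd d X v.
Proof.
apply/colP => a; rewrite !mxE d_mul mulrDr addrA; congr (_ + _).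
by rewrite mulr_sumr; apply: eq_bigr => b _; rewrite !mxE; ring.
Qed.

Lemma covd_torsion (d' : {additive Q -> Q}) (X X' : 'cV[Q]_n) :
  (forall a k b, gam a k b = gam a b k) ->
  (forall a, d (X' a 0) = d' (X a 0)) -> covd d X X' = covd d' X' X.
Proof.
move=> gs e; apply/colP => a; rewrite !mxE e; congr (_ + _).
rewrite /omega; under eq_bigr => b _ do rewrite mulr_suml.
rewrite exchange_big; apply: eq_bigr => k _; rewrite mulr_suml.
by apply: eq_bigr => b _; rewrite gs; ring.
Qed.

Variable X : 'cV[Q]_n.
Let om := omega X.
Let D := covd d X.

(** The connection terms subtracted from the form are those added to the vector. *)
Lemma deriv_ct r v : d (ct r v) =
  ct (fun a => d (r a) - \sum_l om l a * r l) v + ct r (D v).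
Proof.
rewrite /ct raddf_sum.
under eq_bigr => a _ do rewrite d_mul.
under [X in _ = X + _]eq_bigr => a _ do rewrite mulrBl mulr_suml.
under [X in _ = _ + X]eq_bigr => a _ do rewrite mxE mulrDr mulr_sumr.
rewrite sumrB !big_split /= [X in _ = _ - X + _]exchange_big /=.
rewrite [X in _ = _ - X + _](_ : _ =
   \sum_a \sum_b r a * (omega X a b * v b 0)); first by ring.
by apply: eq_bigr => a _; apply: eq_bigr => b _; rewrite /om; ring.
Qed.

Let nb2 (r : 'I_n -> 'I_n -> Q) a b :=
  d (r a b) - \sum_l (om l a * r l b + om l b * r a l).

Let nb4 (r : 'I_n -> 'I_n -> 'I_n -> 'I_n -> Q) a b e f :=
  d (r a b e f) - \sum_l (om l a * r l b e f + om l b * r a l e f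
                          + om l e * r a b l f + om l f * r a b e l).

Lemma deriv_form2 r u v : d (form2 r u v) =
  form2 (nb2 r) u v + form2 r (D u) v + form2 r u (D v).
Proof.
rewrite /form2 deriv_ct addrAC; congr (_ + _); rewrite -ctD; apply: eq_ct => a.
rewrite deriv_ct addrAC; congr (_ + _); rewrite -ct_sum -ctN -ctD.
by apply: eq_ct => b; rewrite /nb2 big_split /=; ring.
Qed.

Lemma deriv_form4 r u v w z : d (form4 r u v w z) =
  form4 (nb4 r) u v w z + form4 r (D u) v w z + form4 r u (D v) w z
  + form4 r u v (D w) z + form4 r u v w (D z).
Proof.
rewrite /form4 deriv_form2.
have -> : form2 (nb2 (fun a b => form2 (r a b) w z)) u v =
  form2 (fun a b => form2 (nb4 r a b) w z) u v
  + form2 (fun a b => form2 (r a b) (D w) z) u v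
  + form2 (fun a b => form2 (r a b) w (D z)) u v; last by ring.
rewrite -!form2D; apply: eq_form2 => a b.
rewrite /nb2 deriv_form2 big_split /= -!form2_sum.
have -> : form2 (nb4 r a b) w z = form2 (nb2 (r a b)) w z
  - form2 (fun e f => \sum_l om l a * r l b e f) w z
  - form2 (fun e f => \sum_l om l b * r a l e f) w z; last by ring.
rewrite -!form2N -!form2D; apply: eq_form2 => e f.
rewrite /nb2 /nb4 !big_split /=; ring.
Qed.

End Connection.

(** * Curvature and adapted frames along an immersion *)

Section Pullback.
Variables (A Q : comPzRingType) (n : nat) (rho : {rmorphism A -> Q}).
Variables (d : 'I_n -> {additive A -> A}) (dt : {additive A -> A}).
Variables (half : A) (half2 : half + half = 1).
Variables (g gi : 'I_n -> 'I_n -> A).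
Hypothesis d_mul : forall i x y, d i (x * y) = d i x * y + x * d i y.
Hypothesis d_comm : forall i j x, d i (d j x) = d j (d i x).
Hypothesis g_sym : forall k l, g k l = g l k.
Hypothesis gi_sym : forall k l, gi k l = gi l k.
Hypothesis g_inv : forall k l, \sum_q gi k q * g q l = (k == l)%:R.

Let c := chr d half g gi.
Let up := curv_up d c.
Let rm := curv_low d half g gi.
Let gam a k b := rho (c a k b).

(* The chain rule: along [d'] time runs with speed [eps] and the point of the
   ambient space moves with velocity [X]. *)
Definition lifts (d' : {additive Q -> Q}) (eps : Q) (X : 'cV[Q]_n) :=
  (forall x y, d' (x * y) = d' x * y + x * d' y) /\
  forall f, d' (rho f) = eps * rho (dt f) + \sum_k X k 0 * rho (d k f).

Section Commutator.
Variables (d1 d2 : {additive Q -> Q}) (eps : Q) (X1 X2 : 'cV[Q]_n).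
Hypothesis d1_lifts : lifts d1 eps X1.
Hypothesis d2_lifts : lifts d2 0 X2.
Hypothesis d12 : forall x, d1 (d2 x) = d2 (d1 x).
Hypothesis dX : forall a, d1 (X2 a 0) = d2 (X1 a 0).

Let om1 := omega gam X1.
Let om2 := omega gam X2.

(** The curvature of the pulled-back connection. The second derivatives of the map cancel by [dX];
    when [d1] involves time, the symbols themselves move, whence the term with [eps]. *)
Lemma omega_curv a b :
  d1 (om2 a b) - d2 (om1 a b) + \sum_e (om1 a e * om2 e b - om2 a e * om1 e b) =
  \sum_k \sum_i X1 k 0 * X2 i 0 * rho (up a b k i)
  + eps * \sum_i X2 i 0 * rho (dt (c a i b)).
Proof.
have [m1 l1] := d1_lifts; have [m2 l2] := d2_lifts.
have -> : d1 (om2 a b) = \sum_i d2 (X1 i 0) * gam a i b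
    + eps * \sum_i X2 i 0 * rho (dt (c a i b))
    + \sum_k \sum_i X1 k 0 * X2 i 0 * rho (d k (c a i b)).
  rewrite /om2 /omega raddf_sum exchange_big mulr_sumr -!big_split.
  apply: eq_bigr => i _ /=; rewrite m1 /gam l1 dX mulrDr addrA.
  rewrite -[X in _ + X = _]/(_ * _); congr (_ + _ + _); first by ring.
  by rewrite mulr_sumr; apply: eq_bigr => k _; ring.
have -> : d2 (om1 a b) = \sum_i d2 (X1 i 0) * gam a i b
    + \sum_k \sum_i X1 k 0 * X2 i 0 * rho (d i (c a k b)).
  rewrite /om1 /omega raddf_sum -big_split; apply: eq_bigr => k _ /=.
  rewrite m2 /gam l2 mul0r add0r; congr (_ + _).
  by rewrite mulr_sumr; apply: eq_bigr => i _; ring.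
have ee (Y Z : 'cV[Q]_n) : \sum_e omega gam Y a e * omega gam Z e b =
    \sum_k \sum_i Y k 0 * Z i 0 * rho (\sum_e c a k e * c e i b).
  under eq_bigr => e _ do rewrite /omega mulr_suml.
  rewrite exchange_big; apply: eq_bigr => k _ /=.
  under eq_bigr => e _ do rewrite mulr_sumr.
  rewrite exchange_big; apply: eq_bigr => i _ /=.
  rewrite rmorph_sum mulr_sumr; apply: eq_bigr => e _.
  by rewrite rmorphM /gam; ring.
rewrite sumrB /om1 /om2 !ee.
rewrite [X in _ + (_ - X)]exchange_big /=.
rewrite [X in X = _](_ : _ = \sum_k \sum_i X1 k 0 * X2 i 0 * rho (d k (c a i b))
   - \sum_k \sum_i X1 k 0 * X2 i 0 * rho (d i (c a k b))
   + (\sum_k \sum_i X1 k 0 * X2 i 0 * rho (\sum_e c a k e * c e i b)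
      - \sum_i \sum_k X2 k 0 * X1 i 0 * rho (\sum_e c a k e * c e i b))
   + eps * \sum_i X2 i 0 * rho (dt (c a i b))); last by ring.
congr (_ + _); rewrite -!sumrB -big_split; apply: eq_bigr => k _ /=.
rewrite -!sumrB -big_split; apply: eq_bigr => i _ /=.
rewrite /up /curv_up sumrB rmorphD !rmorphB /=; ring.
Qed.

Lemma covd_commutator v :
  covd gam d1 X1 (covd gam d2 X2 v) - covd gam d2 X2 (covd gam d1 X1 v) =
  \col_a \sum_b (\sum_k \sum_i X1 k 0 * X2 i 0 * rho (up a b k i)
                 + eps * \sum_i X2 i 0 * rho (dt (c a i b))) * v b 0.
Proof.
have E (dA dB : {additive Q -> Q}) (XA XB : 'cV[Q]_n) a :
    (forall x y, dA (x * y) = dA x * y + x * dA y) ->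
    covd gam dA XA (covd gam dB XB v) a 0 =
    dA (dB (v a 0)) + \sum_b (dA (omega gam XB a b)
      + \sum_e omega gam XA a e * omega gam XB e b) * v b 0
    + \sum_b (omega gam XB a b * dA (v b 0) + omega gam XA a b * dB (v b 0)).
  move=> mA; rewrite !mxE raddfD raddf_sum -!addrA; congr (_ + _).
  rewrite [RHS]addrC -[RHS]addr0 -addrA.
  under [X in X + _ = _]eq_bigr => b _ do rewrite mA.
  under [X in _ + X = _]eq_bigr => b _ do rewrite mxE mulrDr mulr_sumr.
  under [X in _ = _ + (X + _)]eq_bigr => b _ do rewrite mulrDl mulr_suml.
  rewrite !big_split /= [X in _ + (_ + X) = _]exchange_big /=.
  have -> : \sum_j \sum_i omega gam XA a i * (omega gam XB i j * v j 0) =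
     \sum_i \sum_e omega gam XA a e * omega gam XB e i * v i 0.
    by apply: eq_bigr => b _; apply: eq_bigr => e _; ring.
  ring.
apply/colP => a; have [m1 _] := d1_lifts; have [m2 _] := d2_lifts.
rewrite [LHS]mxE [X in _ + X = _]mxE !E // d12.
rewrite [RHS]mxE; under [RHS]eq_bigr => b _ do rewrite -omega_curv.
rewrite [X in X = _](_ : _ = \sum_b (d1 (om2 a b)
     + \sum_e om1 a e * om2 e b) * v b 0 - \sum_b (d2 (om1 a b)
     + \sum_e om2 a e * om1 e b) * v b 0
   + (\sum_b (om2 a b * d1 (v b 0) + om1 a b * d2 (v b 0))
   - \sum_b (om1 a b * d2 (v b 0) + om2 a b * d1 (v b 0)))); last first.
  by rewrite /om1 /om2; ring.
rewrite -!sumrB [X in _ + X = _]big1 ?addr0; last by move=> b _; ring.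
apply: eq_bigr => b _; rewrite sumrB; ring.
Qed.

Let ip := form2 (fun a b => rho (g a b)).
Let Rm := form4 (fun a b k i => rho (rm a b k i)).

(** It supplies both commutators of the hypersurface theory: [eps = 0] for two tangential
    directions, [eps = 1] when [d1] is the time derivative. *)
Lemma ip_commutator u v :
  ip u (covd gam d1 X1 (covd gam d2 X2 v) - covd gam d2 X2 (covd gam d1 X1 v))
  = Rm u v X1 X2
    + eps * form3 (fun i b a => rho (\sum_e g a e * dt (c e i b))) X2 v u.
Proof.
rewrite covd_commutator /ip /Rm /form4 /form3.
have -> : ct (fun i => form2 (fun b a => rho (\sum_e g a e * dt (c e i b))) v u)
    X2 = form2 (fun a b => \sum_i X2 i 0 * rho (\sum_e g a e * dt (c e i b))) u
      v.
  rewrite form2_sum [LHS]/ct; apply: eq_bigr => i _.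
  by rewrite mulrC form2_swap.
rewrite -form2Z -form2D; apply: eq_ct => a.
rewrite /ct; under eq_bigr => e _ do rewrite mxE mulr_sumr.
rewrite exchange_big; apply: eq_bigr => b _ /=.
under eq_bigr => e _ do rewrite mulrA; rewrite -mulr_suml; congr (_ * _).
rewrite (eq_bigr _ (fun e _ => mulrDr (rho (g a e)) _ _)) big_split /=.
congr (_ + _).
  rewrite form2E; under eq_bigr => e _ do rewrite mulr_sumr.
  rewrite exchange_big; apply: eq_bigr => k _ /=.
  under eq_bigr => e _ do rewrite mulr_sumr.
  rewrite exchange_big; apply: eq_bigr => i _ /=.
  rewrite /rm /curv_low rmorph_sum !mulr_suml; apply: eq_bigr => e _.
  by rewrite rmorphM /up /c; ring.
under eq_bigr => e _ do rewrite mulrCA; rewrite -mulr_sumr; congr (_ * _).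
rewrite (eq_bigr _ (fun e _ => mulr_sumr _ _ _ (rho (g a e)))) /=.
rewrite exchange_big; apply: eq_bigr => i _ /=.
rewrite rmorph_sum mulr_sumr; apply: eq_bigr => e _.
by rewrite rmorphM; ring.
Qed.

End Commutator.

Let ip := form2 (fun a b => rho (g a b)).
Let Rm := form4 (fun a b k i => rho (rm a b k i)).
Let nRm := form5 (fun e a b k i => rho (nab4 d c rm e a b k i)).

Lemma deriv_ip d' eps X u v : lifts d' eps X ->
  d' (ip u v) = ip (covd gam d' X u) v + ip u (covd gam d' X v)
                + eps * form2 (fun a b => rho (dt (g a b))) u v.
Proof.
move=> [m l]; rewrite /ip (deriv_form2 gam m X) -form2Z.
rewrite [RHS]addrC [RHS]addrA; congr (_ + _ + _); apply: eq_form2 => a b.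
rewrite l -addrA -[RHS]addr0; congr (_ + _); apply/eqP; rewrite subr_eq0.
rewrite /omega; under [X in _ == X]eq_bigr => p _ do rewrite !mulr_suml
  -big_split.
rewrite exchange_big; apply/eqP; apply: eq_bigr => k _ /=.
rewrite (metric_compat d half2 g_sym gi_sym g_inv) rmorph_sum mulr_sumr.
by apply: eq_bigr => p _ /=; rewrite rmorphD !(rmorphM _ (chr _ _ _ _ _ _ _));
  ring.
Qed.

Lemma deriv_Rm d' X u v w z : lifts d' 0 X ->
  d' (Rm u v w z) = nRm X u v w z
  + Rm (covd gam d' X u) v w z + Rm u (covd gam d' X v) w z
  + Rm u v (covd gam d' X w) z + Rm u v w (covd gam d' X z).
Proof.
move=> [m l]; rewrite /Rm (deriv_form4 gam m X); congr (_ + _ + _ + _ + _).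
rewrite /nRm /form5 [RHS]/ct.
under [RHS]eq_bigr => k _ do rewrite mulrC.
rewrite /form4 -form2_sum; apply: eq_form2 => a b.
rewrite -form2_sum; apply: eq_form2 => e f.
rewrite l mul0r add0r /omega.
under [X in _ - X]eq_bigr => p _ do rewrite !mulr_suml -!big_split.
rewrite exchange_big -sumrB; apply: eq_bigr => k _ /=.
rewrite /nab4 rmorphB rmorph_sum mulrBr mulr_sumr; congr (_ - _).
apply: eq_bigr => p _; rewrite !rmorphD !(rmorphM _ (c _ _ _)) /gam.
by rewrite /=; ring.
Qed.

Variables (m : nat) (T : 'I_m -> 'cV[Q]_n) (N : 'cV[Q]_n).
Variable hi : 'I_m -> 'I_m -> Q.
Hypothesis complete : forall a b, rho (gi a b) =
  trace hi (fun k l => T k a 0 * T l b 0) + N a 0 * N b 0.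

(** The relation [complete] splits the inverse ambient metric into a tangential and a normal part;
    this transfers the split to traces over the first and third slots. *)
Lemma trace_frame r u v :
  form2 (fun b i => \sum_a \sum_k rho (gi a k) * r a b k i) u v
  = trace hi (fun k l => form4 r (T k) u (T l) v) + form4 r N u N v.
Proof.
have E (x y : 'cV[Q]_n) : form4 r x u y v =
    \sum_a \sum_k x a 0 * y k 0 * form2 (fun b i => r a b k i) u v.
  rewrite form4_swap23 /form4 form2E; apply: eq_bigr => a _.
  by apply: eq_bigr => k _; rewrite mulrC mulrA mulrC mulrA; ring.
transitivity (\sum_a \sum_k rho (gi a k) * form2 (fun b i => r a b k i) u v).
  rewrite pair_bigA -form2_sum; apply: eq_form2 => b i.
  by rewrite pair_bigA.
rewrite E (eq_trace _ (fun k l => E (T k) (T l))).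
rewrite trace_sum -big_split; apply: eq_bigr => a _ /=.
rewrite trace_sum -big_split; apply: eq_bigr => k _ /=.
rewrite complete mulrDl; congr (_ + _).
by rewrite mulrC -traceZ; apply: eq_trace => p q; rewrite mulrC.
Qed.

Let Ric := form2 (fun a b => rho (ricci_tensor d half g gi a b)).
Let nRic := form3 (fun e a b =>
  rho (nab2 d c (ricci_tensor d half g gi) e a b)).

Lemma Ric_frame u v :
  Ric u v = trace hi (fun k l => Rm (T k) u (T l) v) + Rm N u N v.
Proof.
rewrite -trace_frame; apply: eq_form2 => b i.
rewrite (ricci_trace d half gi_sym g_inv) rmorph_sum; apply: eq_bigr => a _.
by rewrite rmorph_sum; apply: eq_bigr => k _; exact: rmorphM.
Qed.

Lemma nRic_frame s u v : nRic s u v =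
  trace hi (fun k l => nRm s (T k) u (T l) v) + nRm s N u N v.
Proof.
rewrite /nRic /form3 /nRm /form5 {2}/ct.
have -> : trace hi (fun k l => ct (fun e => form4 (fun a b k i =>
      rho (nab4 d c rm e a b k i)) (T k) u (T l) v) s) =
    \sum_e trace hi (fun k l => form4 (fun a b k i =>
      rho (nab4 d c rm e a b k i)) (T k) u (T l) v) * s e 0.
  rewrite trace_sum; apply: eq_bigr => e _.
  by rewrite mulrC -traceZ; apply: eq_trace => k l; rewrite mulrC.
rewrite -big_split; apply: eq_bigr => e _ /=; rewrite -mulrDl -trace_frame.
congr (_ * _); apply: eq_form2 => b i.
rewrite (nab2_ricci half2 d_mul g_sym gi_sym g_inv) rmorph_sum.
apply: eq_bigr => a _.
by rewrite rmorph_sum; apply: eq_bigr => k _; exact: rmorphM.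
Qed.

(** Lower the index of [u] with the metric and raise it again with the inverse metric in the form
    given by [complete]. *)
Lemma frame_expansion u :
  u = \sum_p (\sum_q hi p q * ip u (T q)) *: T p + ip u N *: N.
Proof.
apply/colP => a; rewrite mxE summxE.
transitivity (ct (fun c => \sum_b rho (g b c) * u b 0)
  (\col_c (trace hi (fun k l => T k a 0 * T l c 0) + N a 0 * N c 0))).
  rewrite /ct; under eq_bigr => e _ do rewrite mxE -complete mulr_suml.
  rewrite exchange_big -[LHS](sum_delta (fun b => u b 0)); apply: eq_bigr => b
    _.
  rewrite eq_sym -(rmorph_nat rho) -(g_invr gi_sym g_inv g_sym) rmorph_sum
    mulr_suml.
  apply: eq_bigr => e _; rewrite rmorphM (gi_sym a e) /=; ring.
have ipE w : ip u w = ct (fun c => \sum_b rho (g b c) * u b 0) w.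
  by rewrite /ip form2_swap; apply: eq_ct => e; apply: eq_bigr.
set r := (fun c => _) in ipE *.
have -> : (\col_c (trace hi (fun k l => T k a 0 * T l c 0) + N a 0 * N c 0)) =
   \sum_p \sum_q (T p a 0 * hi p q) *: T q + N a 0 *: N.
  apply/colP => e; rewrite !mxE summxE; congr (_ + _); apply: eq_bigr => p _.
  by rewrite summxE; apply: eq_bigr => q _; rewrite !mxE; ring.
rewrite (scalar_add _ _ (ct_lin r)) (scalar_scale _ _ (ct_lin r)) mxE.
congr (_ + _); last first.
  by rewrite -ipE mulrC.
rewrite pair_bigA (scalar_sum _ _ _ _ (ct_lin r)) /=.
under [RHS]eq_bigr => p _ do rewrite mxE mulr_suml.
rewrite pair_bigA; apply: eq_bigr => -[p q] _ /=; rewrite -ipE; ring.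
Qed.

Hypothesis dt_mul : forall x y, dt (x * y) = dt x * y + x * dt y.
Hypothesis dt_comm : forall i x, dt (d i x) = d i (dt x).
Hypothesis flow : forall k l, dt (g k l) = - 2 * ricci_tensor d half g gi k l.

Variables (D : 'I_m -> {additive Q -> Q}) (Dt : {additive Q -> Q}).
Variables (X : 'cV[Q]_n) (H : Q).
Hypothesis D_lifts : forall i, lifts (D i) 0 (T i).
Hypothesis Dt_lifts : lifts Dt 1 X.
Hypothesis D_comm : forall i j x, D i (D j x) = D j (D i x).
Hypothesis Dt_comm : forall i x, Dt (D i x) = D i (Dt x).
Hypothesis DT : forall i j a, D i (T j a 0) = D j (T i a 0).
Hypothesis DtT : forall i a, Dt (T i a 0) = D i (X a 0).
Hypothesis mcf : X = H *: N.
Hypothesis hi_sym : forall k l, hi k l = hi l k.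
Hypothesis hi_inv : forall k l, \sum_q hi k q * ip (T q) (T l) = (k == l)%:R.
Hypothesis NN : ip N N = 1.
Hypothesis NT : forall i, ip N (T i) = 0.

Let h i j := ip (T i) (T j).
Let ch := chr D (rho half) h hi.
Let a i j := ip N (covd gam (D i) (T i) (T j)).
Hypothesis H_def : H = trace hi a.
Let aup i j := \sum_p \sum_q hi i p * hi j q * a p q.
Let amix p k := \sum_q hi p q * a q k.
Let Rtr k j := \sum_l \sum_p hi l p * Rm (T p) (T k) (T l) (T j).
Let norm2 := \sum_k \sum_l aup k l * a k l.

Lemma evolution :
  [/\ forall i j, Dt (h i j) = - 2 * Ric (T i) (T j) - 2 * H * a i j,
      forall i j, Dt (a i j) =
        trace hi (fun k l => nab3 D ch (nab2 D ch a) k l i j)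
        - \sum_k amix k i * Rtr k j - \sum_k amix k j * Rtr k i
        + 2 * (\sum_k \sum_l aup k l * Rm (T k) (T i) (T l) (T j))
        - 2 * H * (\sum_k a i k * amix k j) + norm2 * a i j
        + nRm N N (T i) N (T j) &
      Dt H = trace hi (fun i j => D i (D j H) - \sum_l ch l i j * D l H)
        + 2 * (\sum_i \sum_j aup i j * Ric (T i) (T j)) + norm2 * H
        + nRic N N N].
Proof.
have half2' : rho half + rho half = 1 by rewrite -rmorphD half2 rmorph1.
have D_mul i x y : D i (x * y) = D i x * y + x * D i y by case: (D_lifts i).
have Dt_mul x y : Dt (x * y) = Dt x * y + x * Dt y by case: Dt_lifts.
have ip_sym u v : ip u v = ip v u.
  by rewrite /ip form2_swap; apply: eq_form2 => b e; rewrite g_sym.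
have Dip i u v : D i (ip u v) =
    ip (covd gam (D i) (T i) u) v + ip u (covd gam (D i) (T i) v).
  by rewrite (deriv_ip _ _ (D_lifts i)) mul0r addr0.
have Dtip u v : Dt (ip u v) = ip (covd gam Dt X u) v + ip u (covd gam Dt X v)
    - 2 * (trace hi (fun k l => Rm (T k) u (T l) v) + Rm N u N v).
  rewrite (deriv_ip _ _ Dt_lifts) mul1r -Ric_frame -mulNr; congr (_ + _).
  rewrite -form2Z; apply: eq_form2 => b e.
  by rewrite flow rmorphM rmorphN rmorph_nat.
have gam_sym b k e : gam b k e = gam b e k.
  by rewrite /gam /c christoffel_sym.
have r12 := curv_low_anti12 half2 d_mul d_comm g_sym gi_sym g_inv.
have r34 := curv_low_anti34 d half g gi.
have rp := curv_low_pair half2 d_mul d_comm g_sym gi_sym g_inv.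
have n12 := nab4_anti12 half2 d_mul d_comm g_sym gi_sym g_inv.
have n34 := nab4_anti34 d half g gi.
have np := nab4_pair half2 d_mul d_comm g_sym gi_sym g_inv.
have ricci_id i j u v : ip u (covd gam (D i) (T i) (covd gam (D j) (T j) v)
    - covd gam (D j) (T j) (covd gam (D i) (T i) v)) = Rm u v (T i) (T j).
  rewrite /ip (ip_commutator (D_lifts i) (D_lifts j)) ?mul0r ?addr0 //.
have ricci_t i u v : ip u (covd gam Dt X (covd gam (D i) (T i) v)
    - covd gam (D i) (T i) (covd gam Dt X v)) = Rm u v X (T i)
    - (trace hi (fun k l => nRm (T i) (T k) v (T l) u) + nRm (T i) N v N u
       + (trace hi (fun k l => nRm v (T k) (T i) (T l) u) + nRm v N (T i) N u)
       - (trace hi (fun k l => nRm u (T k) (T i) (T l) v) + nRm u N (T i) N v)).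
  rewrite /ip (ip_commutator Dt_lifts (D_lifts i)) // mul1r -!nRic_frame.
  congr (_ + _); rewrite -/nRic.
  (* The slots are permuted so that all three derivatives of Ric are contracted with [T i], [v], [u]
     in this order; [variation_chr] then applies componentwise. *)
  have e1 : nRic v (T i) u = form3 (fun k b a =>
      rho (nab2 d c (ricci_tensor d half g gi) b k a)) (T i) v u.
    exact: form3_swap12.
  have e2 : nRic u (T i) v = form3 (fun k b a =>
      rho (nab2 d c (ricci_tensor d half g gi) a k b)) (T i) v u.
    by rewrite /nRic form3_swap12 form3_swap23.
  rewrite e1 e2 /nRic /form3 -ctD -ctN -ctD -ctN; apply: eq_ct => k.
  rewrite -!form2N -!form2D -!form2N; apply: eq_form2 => b e.
  rewrite (variation_chr half2 d_mul d_comm g_sym gi_sym g_inv dt_mul) //.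
  by rewrite !(rmorphN, rmorphD).
pose Dv i := covd gam (D i) (T i).
have Dv_mul i x v : Dv i (x *: v) = D i x *: v + x *: Dv i v.
  by apply: covd_mul => *; exact: D_mul.
have ip_lin u : scalar (ip u) by exact: form2_lin2.
have torsion k l : Dv k (T l) = Dv l (T k) by exact: covd_torsion.
have torsion_t k : covd gam Dt X (T k) = Dv k X by exact: covd_torsion.
have lin1 v w z : scalar (fun u => Rm u v w z) by exact: form4_lin1.
have lin2 u w z : scalar (fun v => Rm u v w z) by exact: form4_lin2.
have lin3 u v z : scalar (fun w => Rm u v w z) by exact: form4_lin3.
have lin4 u v w : scalar (Rm u v w) by exact: form4_lin4.
have R12 u v w z : Rm v u w z = - Rm u v w z.
  by apply: form4_anti12 => *; rewrite -rmorphN; congr (rho _); exact: r12.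
have R34 u v w z : Rm u v z w = - Rm u v w z.
  by apply: form4_anti34 => *; rewrite -rmorphN; congr (rho _); exact: r34.
have Rp u v w z : Rm w z u v = Rm u v w z.
  by apply: form4_pair => *; congr (rho _); exact: rp.
have nR12 s u v w z : nRm s v u w z = - nRm s u v w z.
  rewrite /nRm /form5 -ctN; apply: eq_ct => e; apply: form4_anti12 => *.
  by rewrite -rmorphN; congr (rho _); exact: n12.
have nR34 s u v w z : nRm s u v z w = - nRm s u v w z.
  rewrite /nRm /form5 -ctN; apply: eq_ct => e; apply: form4_anti34 => *.
  by rewrite -rmorphN; congr (rho _); exact: n34.
have nRp s u v w z : nRm s w z u v = nRm s u v w z.
  by apply: eq_ct => e; apply: form4_pair => *; congr (rho _); exact: np.
have bianchi s u v w z : nRm s u v w z + nRm w u v z s + nRm z u v s w = 0.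
  apply: form5_bianchi => *; rewrite -!rmorphD -[RHS](rmorph0 rho).
  by congr (rho _); exact: curv_low_bianchi2.
have DRm i u v w z : D i (Rm u v w z) = nRm (T i) u v w z + Rm (Dv i u) v w z
    + Rm u (Dv i v) w z + Rm u v (Dv i w) z + Rm u v w (Dv i z).
  exact: deriv_Rm.
have frame := frame_expansion.
split.
- move=> i j; rewrite Ric_frame.
  exact: (@evol_h Q _ m D Dt Dv (covd gam Dt X) ip Rm T N X H hi).
- move=> i j.
  exact: (@evol_a Q _ m _ half2' D Dt Dv (covd gam Dt X) ip Rm nRm T N X H hi).
rewrite (@evol_H Q _ m _ half2' D Dt Dv (covd gam Dt X) ip Rm nRm T N X H hi)
  //.
rewrite nRic_frame; congr (_ + _ * _ + _ + _).
by apply: eq_bigr => i _; apply: eq_bigr => j _; rewrite Ric_frame.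
Qed.

End Pullback.

(** * Smooth functions on an open set *)

Section SmoothCalculus.
Variables (R : realType).

Lemma near_eq_differentiable (V W : normedModType R) (f g : V -> W) x :
  {near x, f =1 g} -> differentiable f x -> differentiable g x.
Proof.
move=> fg /diff_locallyP[df_cont fE].
have gE : g \o shift x = cst (g x) + 'd f x +o_ 0 id.
  apply/eqaddoP => e e0; move/eqaddoP : fE => /(_ e e0).
  have gf : \forall y \near 0, f (y + x) = g (y + x).
    by move: fg; rewrite (near_shift 0 x) /=; apply: filterS => y; rewrite
      subr0.
  apply: filter_app; near=> y; rewrite /= /cst !fctE /=.
  by rewrite (nbhs_singleton fg) (near gf y).
have dE := diff_unique df_cont gE.
by apply/diff_locallyP; rewrite dE.
Unshelve. all: by end_near. Qed.

Lemma open_near_eq (V : normedModType R) (W : Type) (U : set V) (f g : V -> W)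
  x :
  open U -> U x -> (forall y, U y -> f y = g y) -> {near x, f =1 g}.
Proof.
move=> Uo Ux fg; have : nbhs x U by exact: open_nbhs_nbhs.
by apply: filterS.
Qed.

Lemma derive_ext (V W : normedModType R) (U : set V) (f g : V -> W) v x :
  open U -> (forall y, U y -> f y = g y) -> U x -> 'D_v f x = 'D_v g x.
Proof. by move=> Uo fg Ux; apply: near_eq_derive; exact: open_near_eq fg. Qed.

Lemma derive_translate (V : normedModType R) (f : V -> R) (c v y : V) :
  'D_v (fun z => f (z + c)) y = 'D_v f (y + c).
Proof.
rewrite /derive; congr (lim _); apply: (congr1 (fun q => fmap q _)).
by apply/funext => h /=; rewrite addrA.
Qed.

Lemma is_derive_line (V : normedModType R) (g : V -> R) (p u : V) (a : R) :
  derivable g (p + a *: u) u ->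
  is_derive a (1 : R) (fun b => g (p + b *: u)) ('D_u g (p + a *: u)).
Proof.
have E : (fun h : R => h^-1 *: ((fun b => g (p + b *: u)) (h *: 1 + a)
      - g (p + a *: u)))
    = (fun h : R => h^-1 *: (g (h *: u + (p + a *: u)) - g (p + a *: u))).
  apply/funext => h; congr (_ *: (g _ - _)).
  by rewrite [h *: 1]mulr1 scalerDl addrCA.
by move=> dg; split; rewrite /derivable /derive /= E.
Qed.

Lemma mean_value_line (V : normedModType R) (g : V -> R) (p u : V) (s : R) :
  0 < s -> (forall a, 0 <= a <= s -> differentiable g (p + a *: u)) ->
  exists2 a, 0 <= a <= s & g (p + s *: u) - g p = s * 'D_u g (p + a *: u).
Proof.
move=> s0 dg.
have dl a : 0 <= a <= s ->
    is_derive a (1 : R) (fun b => g (p + b *: u)) ('D_u g (p + a *: u)).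
  by move=> /dg ?; apply: is_derive_line; exact: diff_derivable.
have [||a] := @MVT_segment R (fun b => g (p + b *: u))
  (fun a => 'D_u g (p + a *: u)) 0 s (ltW s0).
- by move=> a /itvP a0s; apply: dl; rewrite !a0s.
- apply: derivable_within_continuous => a; rewrite in_itv /= => /dl.
  by case.
rewrite in_itv /= scale0r addr0 subr0 => a0s ->.
by exists a => //; rewrite mulrC.
Qed.

(** The mean value theorem along [v] for the increment of [f] in the direction [u], and then along
    [u] for the derivative of [f] in the direction [v]. *)
Lemma second_difference (V : normedModType R) (U : set V) (f : V -> R)
    (u v x : V) (s : R) : 0 < s ->
  (forall y, U y -> differentiable f y) ->
  (forall y, U y -> differentiable ('D_v f) y) ->
  (forall a b, 0 <= a <= s -> 0 <= b <= s -> U (x + a *: u + b *: v)) ->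
  exists a b, [/\ 0 <= a <= s, 0 <= b <= s &
    f (x + s *: u + s *: v) - f (x + s *: u) - (f (x + s *: v) - f x)
    = s * (s * 'D_u ('D_v f) (x + a *: u + b *: v))].
Proof.
move=> s0 df dDf xU; have ss : 0 <= s <= s by rewrite ltW //= lexx.
have s00 : 0 <= (0 : R) <= s by rewrite lexx ltW.
pose g y := f (y + s *: u) - f y.
have shift_diff y : differentiable f (y + s *: u) ->
    differentiable (fun y => f (y + s *: u)) y.
  move=> dy; apply: (@differentiable_comp _ _ _ _ (fun y => y + s *: u) f) =>
    //.
have dg b : 0 <= b <= s -> differentiable g (x + b *: v).
  move=> bs; apply: differentiableB.
    by apply: shift_diff; rewrite addrAC; apply: df; exact: xU.
  by apply: df; have := xU _ _ s00 bs; rewrite scale0r addr0.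
have [b bs gE] := mean_value_line s0 dg.
have [|a as_ DE] := @mean_value_line _ ('D_v f) (x + b *: v) u s s0.
  by move=> a as_; apply: dDf; rewrite addrAC; exact: xU.
exists a, b; split=> //.
rewrite [x + s *: u + _]addrAC -[LHS]opprB opprB.
have -> : f (x + s *: v + s *: u) - f (x + s *: u) - (f (x + s *: v) - f x)
   = g (x + s *: v) - g x by rewrite /g; ring.
rewrite gE (addrAC x) -DE; congr (_ * _).
rewrite deriveB; last 2 first.
- by apply/diff_derivable/shift_diff; rewrite addrAC; apply: df; exact: xU.
- by apply/diff_derivable/df; have := xU _ _ s00 bs; rewrite scale0r addr0.
by rewrite derive_translate.
Qed.

(** The second difference over a small parallelogram is symmetric in [u] and [v], and equals the
    square of the step times either mixed derivative at a nearby point. By continuity the two values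
    at [x] cannot differ by a positive amount 2e. *)
Lemma derive_comm (V : normedModType R) (U : set V) (f : V -> R) (u v x : V) :
  open U -> U x ->
  (forall y, U y -> differentiable f y) ->
  (forall y, U y -> differentiable ('D_u f) y) ->
  (forall y, U y -> differentiable ('D_v f) y) ->
  {for x, continuous ('D_u ('D_v f))} ->
  {for x, continuous ('D_v ('D_u f))} ->
  'D_u ('D_v f) x = 'D_v ('D_u f) x.
Proof.
move=> Uo Ux df duf dvf cuv cvu; apply/eqP/negP => /negP neq.
pose e := `|'D_u ('D_v f) x - 'D_v ('D_u f) x| / 2.
have e0 : 0 < e by rewrite divr_gt0 // normr_gt0 subr_eq0.
have near_x : \forall y \near x, [/\ U y,
    `|'D_u ('D_v f) x - 'D_u ('D_v f) y| < e &
    `|'D_v ('D_u f) x - 'D_v ('D_u f) y| < e].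
  have n1 : nbhs x U by exact: open_nbhs_nbhs.
  move/cvgrPdist_lt : cuv => /(_ e e0) n2.
  move/cvgrPdist_lt : cvu => /(_ e e0) n3.
  apply: filterS3 n1 n2 n3 => y h1 h2 h3.
  split; [exact: h1|exact: h2|exact: h3].
have [r /= r0 rP] := (@nbhs_ballP _ _ _ _).1 near_x.
(* The parallelogram with sides s u and s v stays within distance r/2 of [x]; the summand 1 keeps
   the denominator positive when both vectors vanish. *)
pose s := r / 2 / (`|u| + `|v| + 1).
have c0 : 0 < `|u| + `|v| + 1 by rewrite ltr_wpDl ?addr_ge0.
have s0 : 0 < s by rewrite !divr_gt0.
have B a b : 0 <= a <= s -> 0 <= b <= s ->
    ball x r (x + a *: u + b *: v).
  move=> /andP[a0 as_] /andP[b0 bs]; rewrite -ball_normE /ball_ /=.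
  rewrite -addrA opprD addNKr normrN (le_lt_trans (ler_normD _ _)) //.
  rewrite !normrZ (ger0_norm a0) (ger0_norm b0).
  apply: (@le_lt_trans _ _ (s * (`|u| + `|v| + 1))); last first.
    by rewrite /s divfK ?gt_eqF // ltr_pdivrMr // ltr_pMr // ltr1n.
  rewrite !mulrDr mulr1 -[leLHS]addr0 lerD ?(ltW s0) //.
  by rewrite lerD // ler_wpM2r.
have BU a b : 0 <= a <= s -> 0 <= b <= s -> U (x + a *: u + b *: v).
  by move=> ha hb; case: (rP _ (B a b ha hb)).
have BU' b a : 0 <= b <= s -> 0 <= a <= s -> U (x + b *: v + a *: u).
  by move=> hb ha; rewrite addrAC; exact: BU.
have [a [b [ha hb E1]]] := second_difference s0 df dvf BU.
have [b' [a' [hb' ha' E2]]] := second_difference s0 df duf BU'.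
have E : 'D_u ('D_v f) (x + a *: u + b *: v)
       = 'D_v ('D_u f) (x + a' *: u + b' *: v).
  move: E2; rewrite (addrAC x (s *: v)) (addrAC x (b' *: v)) => E2.
  apply: (mulfI (lt0r_neq0 s0)); apply: (mulfI (lt0r_neq0 s0)).
  by rewrite -E1 -E2; ring.
have [_ e1 _] := rP _ (B _ _ ha hb); have [_ _ e2] := rP _ (B _ _ ha' hb').
have : 2 * e < e + e.
  rewrite /e mulrC divfK // -/e; apply: le_lt_trans (ltrD e1 e2).
  rewrite E [X in _ <= _ + X]distrC.
  exact: ler_distD.
by rewrite mulr_natl mulr2n ltxx.
Qed.

End SmoothCalculus.

(** * Closure properties of smooth functions *)

Section SmoothClosure.
Variables (R : realType) (V : normedModType R) (U : set V).
Hypothesis Uo : open U.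
Implicit Types (W : normedModType R) (f g : V -> R).

Lemma near_in_open (P : V -> Prop) x : U x -> (forall y, U y -> P y) ->
  \forall y \near x, P y.
Proof.
move=> Ux UP; have : nbhs x U by exact: open_nbhs_nbhs.
exact: filterS.
Qed.

Lemma Ck_ext W k (f g : V -> W) :
  (forall y, U y -> f y = g y) -> Ck_on k U f -> Ck_on k U g.
Proof.
elim: k f g => [|k IH] f g fg /=.
  move=> cf x Ux; have : {near x, f =1 g} by exact: near_in_open.
  move=> nfg; have /= := cf x Ux.
  rewrite /prop_for /continuous_at (fg x Ux); apply: cvg_trans.
  by apply: near_eq_cvg; apply: filterS nfg => y ->.
move=> [df Df]; split.
  move=> x Ux; apply: near_eq_differentiable (df x Ux).
  exact: near_in_open.
move=> v; apply: IH (Df v) => y Uy; apply: near_eq_derive.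
exact: near_in_open.
Qed.

Lemma smooth_ext W (f g : V -> W) :
  (forall y, U y -> f y = g y) -> smooth_on U f -> smooth_on U g.
Proof. by move=> fg sf k; apply: Ck_ext (sf k). Qed.

Lemma CkS W k (f : V -> W) : Ck_on k.+1 U f -> Ck_on k U f.
Proof.
elim: k f => [|k IH] f [df Df].
  by move=> x Ux; apply/differentiable_continuous/df.
by split=> // v; exact: IH.
Qed.

Lemma smooth_differentiable W (f : V -> W) x :
  smooth_on U f -> U x -> differentiable f x.
Proof. by move=> /(_ 1%N)[df _]; exact: df. Qed.

Lemma smooth_derivable W (f : V -> W) x v :
  smooth_on U f -> U x -> derivable f x v.
Proof. by move=> sf Ux; exact/diff_derivable/(smooth_differentiable sf). Qed.

Lemma smooth_derive W (f : V -> W) v : smooth_on U f -> smooth_on U ('D_v f).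
Proof. by move=> sf k; have [_ Df] := sf k.+1; exact: Df. Qed.

Lemma Ck_cst k (c : R) : Ck_on k U (cst c : V -> R).
Proof.
elim: k c => [|k IH] c; first by move=> x _; exact: cst_continuous.
split=> [x _|v]; first exact: differentiable_cst.
by apply: Ck_ext (IH 0) => y _; rewrite derive_cst.
Qed.

Lemma CkD k f g : Ck_on k U f -> Ck_on k U g -> Ck_on k U (f \+ g).
Proof.
elim: k f g => [|k IH] f g /=.
  by move=> cf cg x Ux; apply: cvgD; [exact: cf|exact: cg].
move=> [df Df] [dg Dg]; split.
  by move=> x Ux; apply: differentiableD; [exact: df|exact: dg].
move=> v; apply: Ck_ext (IH _ _ (Df v) (Dg v)) => y Uy /=.
by rewrite deriveD //; apply: diff_derivable; [exact: df|exact: dg].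
Qed.

Lemma CkM k f g : Ck_on k U f -> Ck_on k U g -> Ck_on k U (f \* g).
Proof.
elim: k f g => [|k IH] f g.
  by move=> cf cg x Ux; apply: cvgM; [exact: cf|exact: cg].
move=> cf cg; have [df Df] := cf; have [dg Dg] := cg; split.
  by move=> x Ux; apply: differentiableM; [exact: df|exact: dg].
move=> v; apply: Ck_ext (CkD (IH _ _ (CkS cf) (Dg v)) (IH _ _ (CkS cg) (Df v))).
move=> y Uy /=; rewrite deriveM //; apply: diff_derivable.
  exact: df.
exact: dg.
Qed.

(** Smoothness of [f] to all orders is kept fixed, so that in the derivative -f'/f^2 the induction
    on [k] concerns only the factor 1/f. *)
Lemma CkV k f : smooth_on U f -> (forall x, U x -> f x != 0) ->
  Ck_on k U (fun x => (f x)^-1).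
Proof.
move=> sf f0; elim: k => [|k IH].
  move=> x Ux; apply: cvgV; first exact: f0.
  exact/differentiable_continuous/(smooth_differentiable sf).
split=> [x Ux|v].
  by apply: differentiableV; [exact: smooth_differentiable sf Ux|exact: f0].
have := CkM (Ck_cst k (-1)) (CkM (smooth_derive v sf k) (CkM IH IH)).
apply: Ck_ext => y Uy /=.
rewrite (deriveV (f0 y Uy) (smooth_derivable sf Uy)) /GRing.scale /= mulN1r.
by rewrite -exprVn expr2 mulNr mulrC.
Qed.

Lemma smooth_cst c : smooth_on U (cst c : V -> R).
Proof. by move=> k; exact: Ck_cst. Qed.

Lemma smoothD f g : smooth_on U f -> smooth_on U g -> smooth_on U (f \+ g).
Proof. by move=> sf sg k; exact: CkD. Qed.

Lemma smoothM f g : smooth_on U f -> smooth_on U g -> smooth_on U (f \* g).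
Proof. by move=> sf sg k; exact: CkM. Qed.

Lemma smoothN f : smooth_on U f -> smooth_on U (fun x => - f x).
Proof.
move=> sf; apply: smooth_ext (smoothM (smooth_cst (-1)) sf) => y _ /=.
by rewrite mulN1r.
Qed.

Lemma smoothV f : smooth_on U f -> (forall x, U x -> f x != 0) ->
  smooth_on U (fun x => (f x)^-1).
Proof. by move=> sf f0 k; exact: CkV. Qed.

Lemma smooth_entry p q (f : V -> 'M[R]_(p, q)) i j :
  smooth_on U f -> smooth_on U (fun x : V => f x i j).
Proof.
move=> sf k; elim: k f sf => [|k IH] f sf.
  move=> x Ux; apply: differentiable_continuous.
  apply: (@differentiable_comp _ _ _ _ f (fun A : 'M[R]_(p, q) => A i j)).
    exact: smooth_differentiable sf Ux.
  exact: differentiable_coord.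
split=> [x Ux|v].
  apply: (@differentiable_comp _ _ _ _ f (fun A : 'M[R]_(p, q) => A i j)).
    exact: smooth_differentiable sf Ux.
  exact: differentiable_coord.
apply: Ck_ext (IH _ (smooth_derive v sf)) => y Uy.
by rewrite (derive_mx (smooth_derivable sf Uy)) mxE.
Qed.

End SmoothClosure.

(** * Chain rule and composition for maps into space-time *)

Section SmoothComposition.
Variables (R : realType) (V : normedModType R) (n : nat).
Variables (W : set V) (U : set (R * 'rV[R]_n)).
Hypotheses (Wo : open W) (Uo : open U).

Definition e_time k : R * 'rV[R]_k := (1, 0).
Definition e_space k (a : 'I_k) : R * 'rV[R]_k := (0, delta_mx 0 a).

Lemma pair_basis k (u : R * 'rV[R]_k) :
  u = u.1 *: e_time k + \sum_a u.2 0 a *: e_space a.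
Proof.
apply: injective_projections => /=.
  rewrite (big_morph fst (id1 := 0) (op1 := +%R)) //= big1 ?addr0 => [|a _].
    by rewrite [_ *: _]mulr1.
  by rewrite scaler0.
rewrite (big_morph snd (id1 := 0) (op1 := +%R)) //= scaler0 add0r.
exact: row_sum_delta.
Qed.

Variables (phi0 : V -> R) (phi : 'I_n -> V -> R).
Hypothesis phi0_smooth : smooth_on W phi0.
Hypothesis phi_smooth : forall a, smooth_on W (phi a).
Let Phi z : R * 'rV[R]_n := (phi0 z, \row_a phi a z).
Hypothesis WU : forall z, W z -> U (Phi z).

Lemma row_differentiable z : W z -> differentiable (fun y => \row_a phi a y) z.
Proof.
move=> Wz; have -> : (fun y => \row_a phi a y)
    = (fun y => \sum_a phi a y *: (delta_mx 0 a : 'rV[R]_n)).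
  apply/funext => y; rewrite [LHS]row_sum_delta.
  by apply: eq_bigr => a _; rewrite mxE.
rewrite -fct_sumE.
apply: differentiable_sum => a.
by apply: differentiableZl; exact: smooth_differentiable (phi_smooth a) Wz.
Qed.

Lemma Phi_differentiable z : W z -> differentiable Phi z.
Proof.
move=> Wz; apply: differentiable_pair; last exact: row_differentiable.
exact: smooth_differentiable phi0_smooth Wz.
Qed.

Lemma derive_comp_Phi (f : R * 'rV[R]_n -> R) v z : smooth_on U f -> W z ->
  'D_v (f \o Phi) z = 'D_v phi0 z * 'D_(e_time n) f (Phi z)
    + \sum_a 'D_v (phi a) z * 'D_(e_space a) f (Phi z).
Proof.
move=> sf Wz; have df := smooth_differentiable sf (WU Wz).
have dP := Phi_differentiable Wz; have dr := row_differentiable Wz.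
have d0 := smooth_differentiable phi0_smooth Wz.
rewrite deriveE; last exact: differentiable_comp.
rewrite diff_comp //= diff_pair //= [X in 'd _ _ X]pair_basis linearD linearZ.
rewrite -!deriveE //; congr (_ * _ + _).
  rewrite deriveE; last exact: (smooth_differentiable sf (WU Wz)).
rewrite linear_sum; apply: eq_bigr => a _; rewrite linearZ -deriveE //.
by rewrite (derive_mx (diff_derivable dr)) /= mxE; under eq_fun do rewrite mxE.
Qed.

(** The chain rule expresses a derivative of the composite through composites of derivatives of [f],
    which are again smooth; hence the induction on [k] is for all smooth [f] at once. *)
Lemma smooth_comp_Phi (f : R * 'rV[R]_n -> R) :
  smooth_on U f -> smooth_on W (f \o Phi).
Proof.
move=> sf k; elim: k f sf => [|k IH] f sf.
  move=> z Wz; apply: differentiable_continuous; apply: differentiable_comp.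
    exact: Phi_differentiable.
  exact: smooth_differentiable sf (WU Wz).
split=> [z Wz|v].
  apply: differentiable_comp; first exact: Phi_differentiable.
  exact: smooth_differentiable sf (WU Wz).
apply: (Ck_ext Wo (f := (fun z => 'D_v phi0 z * ('D_(e_time n) f \o Phi) z) \+
    (fun z => \sum_a 'D_v (phi a) z * ('D_(e_space a) f \o Phi) z))).
  by move=> z Wz; rewrite /= -derive_comp_Phi.
apply: CkD => //.
  apply: CkM => //; first exact: smooth_derive.
  by apply: IH; exact: smooth_derive.
elim: (index_enum _) => [|a r IHr].
  by apply: Ck_ext (Ck_cst Wo k 0) => // y _; rewrite big_nil.
apply: (Ck_ext Wo (f := (fun z => 'D_v (phi a) z * ('D_(e_space a) f \o Phi) z)
  \+
    (fun z => \sum_(b <- r) 'D_v (phi b) z * ('D_(e_space b) f \o Phi) z))).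
  by move=> y _; rewrite big_cons.
apply: CkD => //; apply: CkM => //; first exact: smooth_derive.
by apply: IH; exact: smooth_derive.
Qed.

End SmoothComposition.

Record open_set (R : realType) (V : normedModType R) :=
  OpenSet { oset :> set V; osetP : open oset }.

(* Elements vanish off [U], so that equality on [U] is equality of functions. *)
Record smf (R : realType) (V : normedModType R) (U : open_set V) := Smf {
  smf_val :> V -> R;
  smf_smooth : smooth_on U smf_val;
  smf_off : forall x, ~ oset U x -> smf_val x = 0 }.

(** * The ring of smooth functions and its derivations *)

Section SmoothRing.
Variables (R : realType) (V : normedModType R) (U : open_set V).
Implicit Types f g h : smf U.

Lemma smf_eq f g : (forall x, oset U x -> f x = g x) -> f = g.
Proof.
move=> fg; have e : smf_val f = smf_val g.
  apply/funext => x; have [/fg //|Ux] := pselect (oset U x).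
  by rewrite !smf_off.
case: f g e {fg} => f sf f0 [g sg g0] /= e; case: _ / e sg g0 => sg g0.
by congr Smf; exact: Prop_irrelevance.
Qed.

Definition restr (f : V -> R) (x : V) : R := if `[< oset U x >] then f x else 0.

Lemma restr_smooth (f : V -> R) : smooth_on U f -> smooth_on U (restr f).
Proof.
apply: smooth_ext; first exact: osetP.
by move=> x Ux; rewrite /restr; case: asboolP.
Qed.

Lemma restr_off (f : V -> R) x : ~ oset U x -> restr f x = 0.
Proof. by rewrite /restr; case: asboolP. Qed.

Definition mk_smf (f : V -> R) (sf : smooth_on U f) : smf U :=
  Smf (restr_smooth sf) (@restr_off f).

Lemma mk_smfE (f : V -> R) (sf : smooth_on U f) x : oset U x -> mk_smf sf x = f
  x.
Proof. by move=> Ux; rewrite /= /restr; case: asboolP. Qed.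

HB.instance Definition _ := gen_eqMixin (smf U).
HB.instance Definition _ := gen_choiceMixin (smf U).

Definition smf_cst c : smf U := mk_smf (smooth_cst (osetP U) c).
Definition smf_add f g := mk_smf (smoothD (osetP U) (smf_smooth f) (smf_smooth
  g)).
Definition smf_opp f := mk_smf (smoothN (osetP U) (smf_smooth f)).
Definition smf_mul f g := mk_smf (smoothM (osetP U) (smf_smooth f) (smf_smooth
  g)).

Let addE f g x : oset U x -> smf_add f g x = f x + g x.
Proof. exact: mk_smfE. Qed.

Let mulE f g x : oset U x -> smf_mul f g x = f x * g x.
Proof. exact: mk_smfE. Qed.

Let oppE f x : oset U x -> smf_opp f x = - f x.
Proof. exact: mk_smfE. Qed.

Let cstE c x : oset U x -> smf_cst c x = c.
Proof. exact: mk_smfE. Qed.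

Lemma smf_addA : associative smf_add.
Proof. by move=> f g h; apply: smf_eq => x Ux; rewrite !addE // addrA. Qed.

Lemma smf_addC : commutative smf_add.
Proof. by move=> f g; apply: smf_eq => x Ux; rewrite !addE // addrC. Qed.

Lemma smf_add0 : left_id (smf_cst 0) smf_add.
Proof. by move=> f; apply: smf_eq => x Ux; rewrite addE // cstE // add0r. Qed.

Lemma smf_addN : left_inverse (smf_cst 0) smf_opp smf_add.
Proof.
by move=> f; apply: smf_eq => x Ux; rewrite addE // oppE // cstE // addNr.
Qed.

HB.instance Definition _ :=
  GRing.isZmodule.Build (smf U) smf_addA smf_addC smf_add0 smf_addN.

Lemma smf_mulA : associative smf_mul.
Proof. by move=> f g h; apply: smf_eq => x Ux; rewrite !mulE // mulrA. Qed.

Lemma smf_mulC : commutative smf_mul.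
Proof. by move=> f g; apply: smf_eq => x Ux; rewrite !mulE // mulrC. Qed.

Lemma smf_mul1 : left_id (smf_cst 1) smf_mul.
Proof. by move=> f; apply: smf_eq => x Ux; rewrite mulE // cstE // mul1r. Qed.

Lemma smf_mulD : left_distributive smf_mul (@GRing.add (smf U)).
Proof.
move=> f g h; apply: smf_eq => x Ux.
by rewrite mulE // !addE // !mulE // mulrDl.
Qed.

(** Over an empty [U] this is the zero ring, hence a structure that allows 1 = 0. *)
HB.instance Definition _ := GRing.Zmodule_isComPzRing.Build (smf U)
  smf_mulA smf_mulC smf_mul1 smf_mulD.

Lemma smfD f g x : (f + g) x = f x + g x.
Proof.
have [Ux|Ux] := pselect (oset U x); first exact: mk_smfE.
by rewrite !smf_off // addr0.
Qed.

Lemma smfN f x : (- f) x = - f x.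
Proof.
have [Ux|Ux] := pselect (oset U x); first exact: mk_smfE.
by rewrite !smf_off // oppr0.
Qed.

Lemma smfB f g x : (f - g) x = f x - g x.
Proof. by rewrite smfD smfN. Qed.

Lemma smfM f g x : (f * g) x = f x * g x.
Proof.
have [Ux|Ux] := pselect (oset U x); first exact: mk_smfE.
by rewrite !smf_off // mulr0.
Qed.

Lemma smf0 x : (0 : smf U) x = 0.
Proof.
have [Ux|Ux] := pselect (oset U x); first exact: mk_smfE.
by rewrite smf_off.
Qed.

Lemma smf1 x : oset U x -> (1 : smf U) x = 1.
Proof. exact: mk_smfE. Qed.

Lemma smf_sum I (r : seq I) P (F : I -> smf U) x :
  (\sum_(i <- r | P i) F i) x = \sum_(i <- r | P i) F i x.
Proof.
elim/big_rec2: _ => [|i y1 y2 _ <-]; first exact: smf0.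
by rewrite smfD.
Qed.

Lemma smf_nat (n : nat) x : oset U x -> (n%:R : smf U) x = n%:R.
Proof.
move=> Ux; elim: n => [|n IH]; first exact: smf0.
by rewrite -!natr1 smfD IH smf1.
Qed.

Definition der v f : smf U := mk_smf (smooth_derive v (smf_smooth f)).

Lemma derE v f x : oset U x -> der v f x = 'D_v f x.
Proof. exact: mk_smfE. Qed.

Lemma der_is_additive v : zmod_morphism (der v).
Proof.
move=> f g; apply: smf_eq => x Ux; rewrite smfB !derE //.
rewrite -deriveB; try exact: smooth_derivable (smf_smooth _) Ux.
congr ('D_v _ x); apply/funext => y; exact: smfB.
Qed.

HB.instance Definition _ v :=
  GRing.isZmodMorphism.Build _ _ (der v) (der_is_additive v).

Lemma der_mul v f g : der v (f * g) = der v f * g + f * der v g.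
Proof.
apply: smf_eq => x Ux; rewrite smfD !smfM !derE //.
have -> : 'D_v (f * g) x = 'D_v (fun y => f y * g y) x.
  by congr ('D_v _ x); apply/funext => y; exact: smfM.
rewrite deriveM; try exact: smooth_derivable (smf_smooth _) Ux.
by rewrite /GRing.scale /= addrC; congr (_ + _); rewrite mulrC.
Qed.

Lemma der_comm u v f : der u (der v f) = der v (der u f).
Proof.
apply: smf_eq => x Ux; have Uo := osetP U.
have E w w' : der w (der w' f) x = 'D_w ('D_w' f) x.
  rewrite derE //; apply: (derive_ext (U := oset U)) => // y Uy.
  exact: derE.
have sf := smf_smooth f.
have df w y (Uy : oset U y) := smooth_differentiable (smooth_derive w sf) Uy.
transitivity ('D_u ('D_v f) x); first exact: E.
transitivity ('D_v ('D_u f) x); last exact: esym (E v u).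
apply: (derive_comm Uo Ux (fun y => smooth_differentiable sf (x := y)) (df u)
  (df v)).
  exact: (smooth_derive u (smooth_derive v sf) 0).
exact: (smooth_derive v (smooth_derive u sf) 0).
Qed.

Lemma is_derive_smf f g v x : oset U x -> der v f = g ->
  is_derive x v f (g x).
Proof.
move=> Ux <-; rewrite derE //; apply: derivableP.
exact: smooth_derivable (smf_smooth f) Ux.
Qed.

End SmoothRing.

(** * Smoothness of time, determinants and inverse matrices *)

Section SmoothExamples.
Variables (R : realType) (V : normedModType R).

Lemma smooth_subset (W' : normedModType R) (U D : set V) (f : V -> W') :
  U `<=` D -> smooth_on D f -> smooth_on U f.
Proof.
move=> UD sf k; have {sf} := sf k.
elim: k f => [|k IH] f /=; first by move=> cf x /UD; exact: cf.
by move=> [df Df]; split=> [x /UD|v]; [exact: df|exact/IH/Df].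
Qed.

Lemma smooth_fst (U : open_set (R * V)%type) :
  smooth_on U (fun z : R * V => z.1).
Proof.
have fst_linear : linear (fun z : R * V => z.1 : R^o) by [].
pose l := GRing.isLinear.Build _ _ _ _ (fun z : R * V => z.1 : R^o) fst_linear.
pose L : {linear (R * V)%type -> R^o} := HB.pack (fun z : R * V => z.1 : R^o) l.
have Lc : continuous L by move=> z; exact: cvg_fst.
move=> [|k]; first by move=> z _; exact: Lc.
split=> [z _|v]; first exact: (linear_differentiable (f := L)).
apply: Ck_ext (Ck_cst (osetP U) k v.1); first exact: osetP.
move=> z _; rewrite (deriveE _ (linear_differentiable (f := L) z Lc)).
by rewrite (diff_lin z Lc).
Qed.

Variable U : open_set V.

Lemma smooth_sum I (r : seq I) P (F : I -> V -> R) :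
  (forall i, smooth_on U (F i)) ->
  smooth_on U (fun x => \sum_(i <- r | P i) F i x).
Proof.
move=> sF; have Uo := osetP U; pose f := \sum_(i <- r | P i) mk_smf (sF i).
apply: smooth_ext (smf_smooth f) => // x Ux.
by rewrite smf_sum; apply: eq_bigr => i _; exact: mk_smfE.
Qed.

Lemma smooth_prod I (r : seq I) P (F : I -> V -> R) :
  (forall i, smooth_on U (F i)) ->
  smooth_on U (fun x => \prod_(i <- r | P i) F i x).
Proof.
move=> sF; have Uo := osetP U; pose f := \prod_(i <- r | P i) mk_smf (sF i).
apply: smooth_ext (smf_smooth f) => // x Ux; rewrite /f.
elim/big_rec2: _ => [|i y1 y2 _ <-]; first exact: smf1.
by rewrite smfM mk_smfE.
Qed.

Lemma smooth_det n (A : V -> 'M[R]_n) :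
  (forall i j, smooth_on U (fun x => A x i j)) ->
  smooth_on U (fun x => \det (A x)).
Proof.
move=> sA; have Uo := osetP U; apply: smooth_sum => s.
by apply: smoothM => //; [exact: smooth_cst|exact: smooth_prod].
Qed.

(** Cramer's rule: the entries are cofactors divided by a nowhere vanishing determinant. *)
Lemma smooth_invmx n (A : V -> 'M[R]_n) i j :
  (forall i j, smooth_on U (fun x => A x i j)) ->
  (forall x, oset U x -> A x \in unitmx) ->
  smooth_on U (fun x => invmx (A x) i j).
Proof.
move=> sA uA; have Uo := osetP U.
apply: (smooth_ext Uo (f := (fun x => (\det (A x))^-1) \*
    (fun x => (-1) ^+ (j + i) * \det (row' j (col' i (A x)))))).
  by move=> x /uA ux; rewrite /invmx ux !mxE.
apply: smoothM => //.
  apply: smoothV => //; first exact: smooth_det.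
  by move=> x /uA; rewrite unitmxE unitfE.
apply: smoothM => //; first exact: smooth_cst.
apply: smooth_det => k l; apply: smooth_ext (sA (lift j k) (lift i l)) => //.
by move=> x _; rewrite !mxE.
Qed.

End SmoothExamples.

(** * Pullback as a ring morphism *)

Section Pull.
Variables (R : realType) (V : normedModType R) (n : nat).
Variables (W : open_set V) (U : open_set (R * 'rV[R]_n)%type).

(** The components are themselves elements of [smf W], so that the chain rule [der_pull] becomes an
    identity in that ring. *)
Record param_map := ParamMap {
  pm0 : smf W;
  pm : 'I_n -> smf W;
  pm_in : forall z, oset W z -> oset U (pm0 z, \row_a pm a z) }.

Variable P : param_map.

Definition pm_fun z : R * 'rV[R]_n := (pm0 P z, \row_a pm P a z).

Definition pull (f : smf U) : smf W :=
  mk_smf (smooth_comp_Phi (osetP W) (smf_smooth (pm0 P))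
    (fun a => smf_smooth (pm P a)) (@pm_in P) (smf_smooth f)).

Lemma pullE f z : oset W z -> pull f z = f (pm_fun z).
Proof. exact: mk_smfE. Qed.

Lemma pull_is_additive : zmod_morphism pull.
Proof. by move=> f g; apply: smf_eq => x Wx; rewrite smfB !pullE // smfB. Qed.

Lemma pull_is_multiplicative : monoid_morphism pull.
Proof.
split; first by apply: smf_eq => x Wx; rewrite pullE // !smf1 //; exact: pm_in.
by move=> f g; apply: smf_eq => x Wx; rewrite smfM !pullE // smfM.
Qed.

HB.instance Definition _ := GRing.isZmodMorphism.Build _ _ pull
  pull_is_additive.
HB.instance Definition _ :=
  GRing.isMonoidMorphism.Build _ _ pull pull_is_multiplicative.

Lemma der_pull v f : der v (pull f) =
  der v (pm0 P) * pull (der (e_time R n) f)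
  + \sum_a der v (pm P a) * pull (der (e_space R a) f).
Proof.
apply: smf_eq => z Wz; have Uz := pm_in P Wz.
rewrite smfD smfM smf_sum !derE // !pullE // derE //.
have -> : 'D_v (pull f) z = 'D_v (f \o pm_fun) z.
  by apply: (derive_ext (U := oset W)) (osetP W) _ Wz => y; exact: pullE.
rewrite (derive_comp_Phi (smf_smooth (pm0 P))
  (fun a => smf_smooth (pm P a)) (@pm_in P)) //; last exact: smf_smooth.
by congr (_ + _); apply: eq_bigr => a _; rewrite smfM derE // pullE // derE.
Qed.

End Pull.

(** * Coordinate expressions as elements of the ring of smooth functions *)

Section Represent.
Variables (R : realType) (k : nat) (U : open_set (R * 'rV[R]_k)%type).
Implicit Types (f g : smf U) (p q : R -> 'rV[R]_k -> R).

(** The expression is curried in time because the geometric operators act on a time slice [p t];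
    agreement is asked on [U] only, where coordinate expressions are meaningful. *)
Definition rep f p := forall t x, oset U (t, x) -> f (t, x) = p t x.

Lemma rep_eq f p q : (forall t x, oset U (t, x) -> p t x = q t x) ->
  rep f p -> rep f q.
Proof. by move=> pq fp t x Ux; rewrite fp ?pq. Qed.

Lemma rep_uniq f g p : rep f p -> rep g p -> f = g.
Proof. by move=> fp gp; apply: smf_eq => -[t x] Ux; rewrite fp ?gp. Qed.

Lemma repD f g p q : rep f p -> rep g q -> rep (f + g) (fun t x => p t x + q t
  x).
Proof. by move=> fp gq t x Ux; rewrite smfD fp ?gq. Qed.

Lemma repB f g p q : rep f p -> rep g q -> rep (f - g) (fun t x => p t x - q t
  x).
Proof. by move=> fp gq t x Ux; rewrite smfB fp ?gq. Qed.

Lemma repM f g p q : rep f p -> rep g q -> rep (f * g) (fun t x => p t x * q t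
  x).
Proof. by move=> fp gq t x Ux; rewrite smfM fp ?gq. Qed.

Lemma rep_sum I (r : seq I) P (F : I -> smf U) (Q : I -> R -> 'rV[R]_k -> R) :
  (forall i, rep (F i) (Q i)) ->
  rep (\sum_(i <- r | P i) F i) (fun t x => \sum_(i <- r | P i) Q i t x).
Proof.
by move=> FQ t x Ux; rewrite smf_sum; apply: eq_bigr => i _; exact: FQ.
Qed.

Lemma rep_cst c : rep (smf_cst U c) (fun _ _ => c).
Proof. by move=> t x; exact: mk_smfE. Qed.

Lemma repN f p : rep f p -> rep (- f) (fun t x => - p t x).
Proof. by move=> fp t x Ux; rewrite smfN fp. Qed.

Lemma rep_nat n : rep (n%:R) (fun _ _ => n%:R).
Proof. by move=> t x; exact: smf_nat. Qed.

Lemma rep_space f p a t x : rep f p -> oset U (t, x) ->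
  is_derive x (delta_mx 0 a) (p t) (der (e_space R a) f (t, x)).
Proof.
move=> fp Ux; apply: (near_eq_is_derive (f := fun y => f (t, y))).
  have nU : nbhs (t, x) U by apply: open_nbhs_nbhs; split=> //; exact: osetP.
  have tc : (fun y : 'rV[R]_k => (t, y)) @ x --> (t, x).
    exact: (cvg_pair (cvg_cst t) (@cvg_id _ (nbhs x))).
  have nx : nbhs x (fun y => oset U (t, y)) := tc _ nU.
  by apply: filterS nx => y; exact: fp.
have [fd <-] := is_derive_smf Ux (erefl (der (e_space R a) f)).
have E : (fun h : R => h^-1 *: (f (h *: e_space R a + (t, x)) - f (t, x))) =
    (fun h : R => h^-1 *: (f (t, h *: delta_mx 0 a + x) - f (t, x))).
  by apply/funext => h; congr (_ *: (f (_, _) - _)); rewrite /= scaler0 add0r.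
by split; rewrite /derivable /derive /= -E.
Qed.

Lemma rep_pd f p a :
  rep f p -> rep (der (e_space R a) f) (fun t => pd a (p t)).
Proof.
by move=> fp t x Ux; have [_ <-] := rep_space a fp Ux.
Qed.

Lemma rep_time f p t x : rep f p -> oset U (t, x) ->
  is_derive t (1 : R) (fun s : R => p s x) (der (e_time R k) f (t, x)).
Proof.
move=> fp Ux; apply: (near_eq_is_derive (f := fun s => f (s, x))).
  have nU : nbhs (t, x) U by apply: open_nbhs_nbhs; split=> //; exact: osetP.
  have tc : (fun s : R => (s, x)) @ t --> (t, x).
    exact: (cvg_pair (@cvg_id _ (nbhs t)) (cvg_cst x)).
  have nx : nbhs t (fun s => oset U (s, x)) := tc _ nU.
  by apply: filterS nx => s; exact: fp.
have [fd <-] := is_derive_smf Ux (erefl (der (e_time R k) f)).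
have E : (fun h : R => h^-1 *: (f (h *: 1 + t, x) - f (t, x))) =
    (fun h : R => h^-1 *: (f (h *: e_time R k + (t, x)) - f (t, x))).
  by apply/funext => h; congr (_ *: (f (_, _) - _)); rewrite /= scaler0 add0r.
by split; rewrite /derivable /derive /= E.
Qed.

End Represent.

(** * Christoffel symbols, curvature and covariant derivatives in coordinates *)

Section RepresentCalculus.
Variables (R : realType) (k : nat) (U : open_set (R * 'rV[R]_k)%type).
Let d (a : 'I_k) : {additive smf U -> smf U} := der (e_space R a).
Variables (g gi : 'I_k -> 'I_k -> smf U) (G : R -> 'rV[R]_k -> 'M[R]_k).
Hypothesis gG : forall i j, rep (g i j) (fun t x => G t x i j).
Hypothesis giG : forall i j, rep (gi i j) (fun t x => invmx (G t x) i j).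
Let c := chr d (smf_cst U 2^-1) g gi.

Lemma rep_chr p i j : rep (c p i j) (fun t => christoffel (G t) p i j).
Proof.
apply: repM; first exact: rep_cst.
apply: rep_sum => l; apply: repM => //; apply: repB; last exact: rep_pd.
by apply: repD; exact: rep_pd.
Qed.

Lemma rep_curv_up p l i j :
  rep (curv_up d c p l i j) (fun t => riem_up (G t) p l i j).
Proof.
apply: repD.
  by apply: repB; apply: rep_pd; exact: rep_chr.
by apply: rep_sum => e; apply: repB; apply: repM; exact: rep_chr.
Qed.

Lemma rep_curv_low a b i j :
  rep (curv_low d (smf_cst U 2^-1) g gi a b i j) (fun t => riem (G t) a b i j).
Proof. by apply: rep_sum => e; apply: repM => //; exact: rep_curv_up. Qed.

Lemma rep_ricci b i :
  rep (ricci_tensor d (smf_cst U 2^-1) g gi b i) (fun t => ricci (G t) b i).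
Proof. by apply: rep_sum => a; exact: rep_curv_up. Qed.

Lemma rep_nab2 T T' e i j : (forall i j, rep (T i j) (fun t => T' t i j)) ->
  rep (nab2 d c T e i j) (fun t => nabla2 (G t) (T' t) e i j).
Proof.
move=> TT; apply: repB; first exact: rep_pd.
by apply: rep_sum => l; apply: repD; apply: repM => //; exact: rep_chr.
Qed.

Lemma rep_nab3 T T' e i j l :
  (forall i j l, rep (T i j l) (fun t => T' t i j l)) ->
  rep (nab3 d c T e i j l) (fun t => nabla3 (G t) (T' t) e i j l).
Proof.
move=> TT; apply: repB; first exact: rep_pd.
apply: rep_sum => p; apply: repD; [apply: repD|]; apply: repM => //;
  exact: rep_chr.
Qed.

Lemma rep_nab4 T T' e i j l m :
  (forall i j l m, rep (T i j l m) (fun t => T' t i j l m)) ->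
  rep (nab4 d c T e i j l m) (fun t => nabla4 (G t) (T' t) e i j l m).
Proof.
move=> TT; apply: repB; first exact: rep_pd.
apply: rep_sum => p; apply: repD; [apply: repD; [apply: repD|]|];
  apply: repM => //; exact: rep_chr.
Qed.

Lemma rep_laplacian2 T T' i j : (forall i j, rep (T i j) (fun t => T' t i j)) ->
  rep (trace gi (fun p q => nab3 d c (nab2 d c T) p q i j))
      (fun t => laplacian2 (G t) (T' t) i j).
Proof.
move=> TT; apply: rep_sum => p; apply: rep_sum => q; apply: repM => //.
apply: (rep_nab3 (T' := fun t => nabla2 (G t) (T' t))) => *.
exact: rep_nab2.
Qed.

Lemma rep_laplacian f p : rep f p ->
  rep (trace gi (fun i j => d i (d j f) - \sum_l c l i j * d l f))
      (fun t => laplacian (G t) (p t)).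
Proof.
move=> fp; apply: rep_sum => i; apply: rep_sum => j; apply: repM => //.
apply: repB; first by apply: rep_pd; exact: rep_pd.
by apply: rep_sum => l; apply: repM; [exact: rep_chr|exact: rep_pd].
Qed.

End RepresentCalculus.

(** * Vector fields and contractions in coordinates *)

Section RepresentVectors.
Variables (R : realType) (k n : nat) (U : open_set (R * 'rV[R]_k)%type).
Implicit Types (u v w z s : 'cV[smf U]_n) (p : R -> 'rV[R]_k -> 'rV[R]_n).

Definition repv u p := forall a, rep (u a 0) (fun t x => p t x 0 a).

Lemma repv_pd u p i :
  repv u p -> repv (\col_a der (e_space R i) (u a 0)) (fun t => pd i (p t)).
Proof.
move=> up a t x Ux; rewrite mxE (rep_pd i (up a) Ux).
rewrite /pd [in RHS]derive_mx ?mxE //; apply/derivable_mxP => r b.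
by rewrite (ord1 r); have [] := rep_space i (up b) Ux.
Qed.

Lemma rep_form2 r r' u p v q : (forall a b, rep (r a b) (r' a b)) ->
  repv u p -> repv v q ->
  rep (form2 r u v)
      (fun t x => \sum_a \sum_b r' a b t x * p t x 0 a * q t x 0 b).
Proof.
move=> rr up vq; rewrite form2E; apply: rep_sum => a; apply: rep_sum => b.
by apply: repM; [apply: repM; [exact: rr|exact: up]|exact: vq].
Qed.

Lemma rep_form4 r r' u p v q w y z o :
  (forall a b c d, rep (r a b c d) (r' a b c d)) ->
  repv u p -> repv v q -> repv w y -> repv z o ->
  rep (form4 r u v w z) (fun t x => \sum_a \sum_b \sum_c \sum_d
    r' a b c d t x * p t x 0 a * q t x 0 b * y t x 0 c * o t x 0 d).
Proof.
move=> rr up vq wy zo; rewrite form4E.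
apply: rep_sum => a; apply: rep_sum => b; apply: rep_sum => c.
apply: rep_sum => d; apply: repM; last exact: zo.
apply: repM; last exact: wy.
by apply: repM; [apply: repM; [exact: rr|exact: up]|exact: vq].
Qed.

Lemma rep_form5 r r' s l u p v q w y z o :
  (forall e a b c d, rep (r e a b c d) (r' e a b c d)) ->
  repv s l -> repv u p -> repv v q -> repv w y -> repv z o ->
  rep (form5 r s u v w z)
    (fun t x => \sum_e \sum_a \sum_b \sum_c \sum_d r' e a b c d t x
     * l t x 0 e * p t x 0 a * q t x 0 b * y t x 0 c * o t x 0 d).
Proof.
move=> rr sl up vq wy zo; rewrite form5E; apply: rep_sum => e.
apply: rep_sum => a; apply: rep_sum => b; apply: rep_sum => c.
apply: rep_sum => d; apply: repM; last exact: zo.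
apply: repM; last exact: wy.
apply: repM; last exact: vq.
by apply: repM; [apply: repM; [exact: rr|exact: sl]|exact: up].
Qed.

Lemma rep_form3 r r' s l u p v q :
  (forall e a b, rep (r e a b) (r' e a b)) ->
  repv s l -> repv u p -> repv v q ->
  rep (form3 r s u v) (fun t x => \sum_e \sum_a \sum_b
    r' e a b t x * l t x 0 e * p t x 0 a * q t x 0 b).
Proof.
move=> rr sl up vq; rewrite form3E; apply: rep_sum => e.
apply: rep_sum => a; apply: rep_sum => b; apply: repM; last exact: vq.
by apply: repM; [apply: repM; [exact: rr|exact: sl]|exact: up].
Qed.

End RepresentVectors.

Lemma posdef_unitmx (R : realFieldType) (n : nat) (A : 'M[R]_n) :
  (forall v : 'rV_n, v != 0 -> 0 < (v *m A *m v^T) 0 0) -> A \in unitmx.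
Proof.
move=> pos; rewrite -row_free_unit; apply/inj_row_free => v vA.
apply/eqP; apply: contraT => /pos.
by rewrite vA mul0mx mxE ltxx.
Qed.

(* [E] has the rows [N], [T]; then E G E^T is block diagonal with blocks 1 and
   h = T G T^T, and the formula is E^T (E G E^T)^-1 E = G^-1. *)
Lemma frame_inverse (R : comUnitRingType) (m : nat) (G : 'M[R]_m.+1)
    (T : 'M[R]_(m, m.+1)) (N : 'rV[R]_m.+1) (hi : 'M[R]_m) :
  G \in unitmx -> N *m G *m N^T = 1%:M -> N *m G *m T^T = 0 ->
  T *m G *m N^T = 0 -> T *m G *m T^T *m hi = 1%:M ->
  invmx G = N^T *m N + T^T *m hi *m T.
Proof.
move=> Gu NN NT TN Th.
pose E : 'M[R]_(1 + m, m.+1) := col_mx N T.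
pose K : 'M[R]_(1 + m) := block_mx 1%:M 0 0 hi.
have EG : E *m G *m (E^T *m K) = 1%:M.
  rewrite mulmxA tr_col_mx mul_col_mx mul_col_row NN NT TN mulmx_block.
  by rewrite !mul0mx !mulmx0 mul1mx !addr0 add0r Th -scalar_mx_block.
have : E^T *m K *m E *m G = 1%:M by rewrite -mulmxA; exact: mulmx1C EG.
move=> /(congr1 (fun A => A *m invmx G)); rewrite mul1mx mulmxK // => <-.
rewrite tr_col_mx mul_row_block !mulmx0 addr0 add0r mulmx1.
by rewrite mul_row_col.
Qed.

Lemma is_derive_entry (R : realType) (p q : nat) (V : normedModType R)
    (f : V -> 'M[R]_(p, q)) (t v : V) (df : 'M[R]_(p, q)) i j :
  is_derive t v f df -> is_derive t v (fun s => f s i j) (df i j).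
Proof.
move=> [fd <-]; split; first exact: (derivable_mxP _ _ _).1.
by rewrite (derive_mx fd) mxE.
Qed.

Lemma is_derive_unique (R : realType) (V W : normedModType R) (f : V -> W)
    (t v : V) (a b : W) : is_derive t v f a -> is_derive t v f b -> a = b.
Proof. by move=> [_ <-] [_ <-]. Qed.

Lemma ipE (R : realType) (n : nat) (G : 'rV[R]_n -> 'M[R]_n) y u v :
  ip G y u v = \sum_a \sum_b G y a b * u 0 a * v 0 b.
Proof.
rewrite /ip mxE exchange_big; apply: eq_bigr => b _ /=.
rewrite mxE mulr_suml; apply: eq_bigr => a _; rewrite mxE; ring.
Qed.

(** * The flow in a pair of charts *)

Section Flow.
Variables (R : realType) (m : nat).
Variables (M : manifold R m.+1) (S : manifold R m) (J : set R).
Variables (g : metric_family M) (e : R -> S -> M).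
Variables (phi : chart R m S) (psi : chart R m.+1 M).
Variables (W : set (R * 'rV[R]_m)) (e0 : R -> 'rV[R]_m -> 'rV[R]_m.+1).
Hypothesis J_open : open J.
Hypothesis g_metric : riemannian_metrics J g.
Hypothesis g_flow : ricci_flow J g.
Hypothesis e_imm : smooth_immersions J e.
Hypothesis e_flow : mean_curvature_flow J e g.
Hypothesis phi_atlas : atlas S phi.
Hypothesis psi_atlas : atlas M psi.
Hypothesis W_open : open W.
Hypothesis W_sub : W `<=` rep_domain J e phi psi.
Hypothesis e0_smooth : smooth_on W (fun z => e0 z.1 z.2).
Hypothesis e0_normal : forall t x, W (t, x) ->
  unit_normal (g t psi) (local_rep e phi psi t) x (e0 t x).

Let n := m.+1.
Let G t := g t psi.
Let F t := local_rep e phi psi t.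

Let D0 : set (R * 'rV[R]_n) := [set z | J z.1 /\ img psi z.2].

Let D0_open : open D0.
Proof.
have -> : D0 = (fst @^-1` J) `&` (snd @^-1` (img psi)) by [].
apply: openI; apply: open_comp => //.
- by move=> z _; exact: cvg_fst.
- by move=> z _; exact: cvg_snd.
- exact: img_open.
Qed.

Let U := OpenSet D0_open.
Let WW := OpenSet W_open.

Let G_sym t y : oset U (t, y) -> (G t y)^T = G t y.
Proof. by move=> [Jt iy]; have [+ _ _] := g_metric; move=> /(_ t psi y Jt
  psi_atlas iy)[]. Qed.

Let G_pos t y (v : 'rV[R]_n) : oset U (t, y) -> v != 0 -> 0 < (v *m G t y *m
  v^T) 0 0.
Proof.
move=> [Jt iy]; have [+ _ _] := g_metric.
by move=> /(_ t psi y Jt psi_atlas iy)[_]; exact.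
Qed.

Let G_unit t y : oset U (t, y) -> G t y \in unitmx.
Proof. by move=> Uy; apply: posdef_unitmx => v; exact: G_pos. Qed.

Let G_smooth a b : smooth_on U (fun z => G z.1 z.2 a b).
Proof.
apply: (smooth_entry (osetP U) (f := fun z => G z.1 z.2)).
by have [_ _] := g_metric; exact.
Qed.

Let Gi_smooth a b : smooth_on U (fun z => invmx (G z.1 z.2) a b).
Proof. by apply: smooth_invmx => // -[t y]; exact: G_unit. Qed.

Let gs a b : smf U := mk_smf (G_smooth a b).
Let gis a b : smf U := mk_smf (Gi_smooth a b).
Let halfU : smf U := smf_cst U 2^-1.
Let dU (a : 'I_n) : {additive smf U -> smf U} := der (e_space R a).
Let tU : {additive smf U -> smf U} := der (e_time R n).

Let gsG a b : rep (gs a b) (fun t y => G t y a b).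
Proof. by move=> t y; exact: mk_smfE. Qed.

Let gisG a b : rep (gis a b) (fun t y => invmx (G t y) a b).
Proof. by move=> t y; exact: mk_smfE. Qed.

Let gs_sym a b : gs a b = gs b a.
Proof.
apply: rep_uniq (gsG a b) _; apply: rep_eq (gsG b a) => t y Uy.
by rewrite -[in LHS](G_sym Uy) mxE.
Qed.

Let gis_sym a b : gis a b = gis b a.
Proof.
apply: rep_uniq (gisG a b) _; apply: rep_eq (gisG b a) => t y Uy.
by rewrite -[in LHS](G_sym Uy) -trmx_inv mxE.
Qed.

Let gs_inv a b : \sum_q gis a q * gs q b = (a == b)%:R.
Proof.
apply: (rep_uniq (p := fun _ _ => (a == b)%:R)); last exact: rep_nat.
apply: rep_eq (rep_sum _ _ (fun q => repM (gisG a q) (gsG q b))) => t y Uy.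
by have := congr1 (fun A : 'M[R]_n => A a b) (mulVmx (G_unit Uy)); rewrite !mxE.
Qed.

Let halfU2 : halfU + halfU = 1.
Proof.
apply: smf_eq => x Ux; rewrite smfD smf1 // !mk_smfE //.
by rewrite [RHS]splitr !mul1r.
Qed.

Let gs_flow a b : tU (gs a b) = - 2 * ricci_tensor dU halfU gs gis a b.
Proof.
apply: smf_eq => -[t y] Uy; have [Jt iy] := Uy.
rewrite smfM smfN smf_nat // (rep_ricci gsG gisG a b Uy).
apply: is_derive_unique (rep_time (gsG a b) Uy) _.
exact: g_flow.
Qed.

Let dU_mul i x y : dU i (x * y) = dU i x * y + x * dU i y.
Proof. exact: der_mul. Qed.

Let dU_comm i j x : dU i (dU j x) = dU j (dU i x).
Proof. exact: der_comm. Qed.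

Let F_smooth a : smooth_on WW (fun z => F z.1 z.2 0 a).
Proof.
apply: (smooth_entry (osetP WW) (f := fun z => F z.1 z.2)).
have [_ /(_ phi psi phi_atlas psi_atlas)[sF _]] := e_imm.
exact: smooth_subset W_sub sF.
Qed.

Let N_smooth a : smooth_on WW (fun z => e0 z.1 z.2 0 a).
Proof. exact: (smooth_entry (osetP WW) (f := fun z => e0 z.1 z.2)). Qed.

Let FU t x : W (t, x) -> oset U (t, F t x).
Proof. by move=> /W_sub[Jt _ dp]; split=> //; exists (e t (param phi x)). Qed.

Let fs a : smf WW := mk_smf (F_smooth a).
Let ts : smf WW := mk_smf (smooth_fst WW).

Let fsF a : rep (fs a) (fun t x => F t x 0 a).
Proof. by move=> t x; exact: mk_smfE. Qed.

Let tsE : rep ts (fun t _ => t).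
Proof. by move=> t x; exact: mk_smfE. Qed.

Let pair_in z : oset WW z -> oset U (ts z, \row_a fs a z).
Proof.
case: z => t x Wx; rewrite tsE //.
have -> : \row_a fs a (t, x) = F t x.
  by apply/rowP => a; rewrite mxE fsF.
exact: FU.
Qed.

Let P : param_map WW U := ParamMap pair_in.
Let rho : {rmorphism smf U -> smf WW} := pull P.

Let rho_rep f p : rep f p -> rep (rho f) (fun t x => p t (F t x)).
Proof.
move=> fp t x Wx; rewrite [LHS](pullE P f Wx) -fp; last exact: FU.
congr (f (_, _)); first exact: tsE.
by apply/rowP => a; rewrite mxE; exact: fsF.
Qed.

Let Ds (i : 'I_m) : {additive smf WW -> smf WW} := der (e_space R i).
Let Dt : {additive smf WW -> smf WW} := der (e_time R m).
Let T (i : 'I_m) : 'cV[smf WW]_n := \col_a Ds i (fs a).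
Let X : 'cV[smf WW]_n := \col_a Dt (fs a).
Let N : 'cV[smf WW]_n := \col_a mk_smf (N_smooth a).

Let NE : repv N e0.
Proof. by move=> a t x Wx; rewrite mxE mk_smfE. Qed.

Let TE i : repv (T i) (fun t => pd i (F t)).
Proof.
have := @repv_pd _ _ _ WW (\col_a fs a) F i.
have -> : (\col_a der (e_space R i) ((\col_a0 fs a0) a 0)) = T i.
  by apply/colP => a; rewrite !mxE.
by apply=> a t x Wx; rewrite mxE; exact: fsF.
Qed.

Let Ds_lifts i : lifts rho dU tU (Ds i) 0 (T i).
Proof.
split; first by move=> x y; exact: der_mul.
move=> f; rewrite [LHS](der_pull P); congr (_ * _ + _).
  apply: smf_eq => -[t x] Wx; rewrite smf0 (rep_pd i tsE Wx).
  exact: derive_cst.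
by apply: eq_bigr => a _; rewrite mxE.
Qed.

Let Dt_lifts : lifts rho dU tU Dt 1 X.
Proof.
split; first by move=> x y; exact: der_mul.
move=> f; rewrite [LHS](der_pull P); congr (_ * _ + _).
  apply: smf_eq => -[t x] Wx; rewrite smf1 //.
  exact: is_derive_unique (rep_time tsE Wx) (is_derive_id _ _).
by apply: eq_bigr => a _; rewrite mxE.
Qed.

Let ips := form2 (fun a b => rho (gs a b)).

Let ips_rep u p v q : repv u p -> repv v q ->
  rep (ips u v) (fun t x => ip (G t) (F t x) (p t x) (q t x)).
Proof.
move=> up vq.
apply: rep_eq (rep_form2 (fun a b => rho_rep (gsG a b)) up vq) => t x _.
by rewrite ipE.
Qed.

Let h t := pullback_metric (G t) (F t).

Let h_rep i j : rep (ips (T i) (T j)) (fun t x => h t x i j).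
Proof.
by apply: rep_eq (ips_rep (TE i) (TE j)) => t x _; rewrite mxE.
Qed.

Let tangent t x : 'M[R]_(m, n) := \matrix_i pd i (F t) x.

Let h_gram t x : h t x = tangent t x *m G t (F t x) *m (tangent t x)^T.
Proof.
apply/matrixP => i j; rewrite mxE /ip.
have rT k : pd k (F t) x = row k (tangent t x).
  by apply/rowP => a; rewrite !mxE.
rewrite !rT -row_mul [LHS]mxE [RHS]mxE; apply: eq_bigr => a _; congr (_ * _).
  by rewrite [LHS]mxE.
by rewrite [LHS]mxE [RHS]mxE mxE.
Qed.

(** The ambient metric is positive definite and the coordinate tangent vectors of an immersion are
    independent, so their Gram matrix is positive definite. *)
Let h_unit t x : W (t, x) -> h t x \in unitmx.
Proof.
move=> Wx; apply: posdef_unitmx => v v0.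
rewrite h_gram !mulmxA -[v *m _ *m _ *m _ *m _]mulmxA -trmx_mul.
apply: G_pos; first exact: FU.
apply: contra v0 => /eqP vT; have [_ /(_ phi psi phi_atlas psi_atlas)[_ rf]] :=
  e_imm.
have /row_free_inj inj := rf t x (W_sub Wx).
by apply/eqP/inj; rewrite mul0mx -vT; congr (_ *m _).
Qed.

Let hi_smooth i j : smooth_on WW (fun z => invmx (h z.1 z.2) i j).
Proof.
apply: smooth_invmx => [k l|[t x]]; last exact: h_unit.
have := smf_smooth (ips (T k) (T l)); apply: (smooth_ext (osetP WW)).
by move=> [t x] Wx; exact: h_rep.
Qed.

Let his i j : smf WW := mk_smf (hi_smooth i j).

Let hisE i j : rep (his i j) (fun t x => invmx (h t x) i j).
Proof. by move=> t x; exact: mk_smfE. Qed.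

Let h_sym t x : W (t, x) -> (h t x)^T = h t x.
Proof.
move=> Wx; rewrite h_gram !trmx_mul trmxK G_sym ?mulmxA //; exact: FU.
Qed.

Let his_sym i j : his i j = his j i.
Proof.
apply: rep_uniq (hisE i j) _; apply: rep_eq (hisE j i) => t x Wx.
by rewrite -[in LHS](h_sym Wx) -trmx_inv mxE.
Qed.

Let his_inv k l : \sum_q his k q * ips (T q) (T l) = (k == l)%:R.
Proof.
apply: (rep_uniq (p := fun _ _ => (k == l)%:R)); last exact: rep_nat.
apply: rep_eq (rep_sum _ _ (fun q => repM (hisE k q) (h_rep q l))) => t x Wx.
by have := congr1 (fun A : 'M[R]_m => A k l) (mulVmx (h_unit Wx)); rewrite !mxE.
Qed.

Let NN : ips N N = 1.
Proof.
apply: smf_eq => -[t x] Wx; rewrite (ips_rep NE NE Wx) smf1 //.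
by have [] := e0_normal Wx.
Qed.

Let NT i : ips N (T i) = 0.
Proof.
apply: smf_eq => -[t x] Wx; rewrite (ips_rep NE (TE i) Wx) smf0 //.
by have [_] := e0_normal Wx; exact.
Qed.

Let complete a b : rho (gis a b) =
  trace his (fun k l => T k a 0 * T l b 0) + N a 0 * N b 0.
Proof.
apply: (rep_uniq (rho_rep (gisG a b))).
apply: rep_eq (repD (rep_sum _ _ (fun k => rep_sum _ _ (fun l =>
  repM (hisE k l) (repM (TE k a) (TE l b))))) (repM (NE a) (NE b))) => t x Wx.
have [nn nt] := e0_normal Wx; have Uy := FU Wx.
have NT0 : e0 t x *m G t (F t x) *m (tangent t x)^T = 0.
  apply/rowP => i; rewrite [RHS]mxE -(nt i) /ip.
  rewrite !mxE; apply: eq_bigr => c _; congr (_ * _).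
  by rewrite !mxE.
rewrite (@frame_inverse R m _ (tangent t x) (e0 t x) (invmx (h t x))) //.
- rewrite [RHS]mxE [RHS]addrC; congr (_ + _); last first.
    by rewrite [RHS]mxE big_ord1 !mxE.
  rewrite [RHS]mxE; under [RHS]eq_bigr => l _ do rewrite mxE mulr_suml.
  rewrite exchange_big; apply: eq_bigr => l _; apply: eq_bigr => k _.
  rewrite !mxE; ring.
- exact: G_unit.
- by apply/matrixP => i j; rewrite !ord1 [LHS]nn mxE.
- have := congr1 trmx NT0; rewrite !trmx_mul trmxK trmx0 G_sym //.
  by rewrite mulmxA.
- by rewrite -h_gram mulmxV // h_unit.
Qed.

Let gam a k b := rho (chr dU halfU gs gis a k b).
Let acc i j := covd gam (Ds i) (T i) (T j).
Let a i j := ips N (acc i j).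
Let H : smf WW := trace his a.

Let acc_rep i j : repv (acc i j) (fun t => acceleration (G t) (F t) i j).
Proof.
move=> b; rewrite /acc /covd mxE.
have DT := @repv_pd _ _ _ WW (T j) _ i (TE j) b; rewrite mxE in DT.
have om c := rep_sum (index_enum _) predT (fun k =>
  repM (TE i k) (rho_rep (rep_chr gsG gisG b k c))).
apply: rep_eq (repD DT (rep_sum _ _ (fun c => repM (om c) (TE j c)))) => t x Wx.
rewrite !mxE; congr (_ + _); rewrite exchange_big; apply: eq_bigr => c _.
by rewrite mulr_suml; apply: eq_bigr => k _; congr (_ * _); rewrite mulrC.
Qed.

Let a_rep i j : rep (a i j) (fun t => second_form (G t) (F t) (e0 t) i j).
Proof. exact: ips_rep NE (acc_rep i j). Qed.

Let H_rep : rep H (fun t => mean_curvature (G t) (F t) (e0 t)).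
Proof.
exact: rep_sum (fun i => rep_sum _ _ (fun j => repM (hisE i j) (a_rep i j))).
Qed.

Let mcf : X = H *: N.
Proof.
apply/colP => b; rewrite !mxE; apply: smf_eq => -[t x] Wx.
rewrite smfM (H_rep Wx) mk_smfE //.
(* The flow equation uses the constant field with value [e0 t x]. The mean curvature at [x] reads
   the normal field only at [x], so both versions agree by conversion. *)
have := e_flow phi_atlas psi_atlas (W_sub Wx) (e0_normal Wx).
move=> /(is_derive_entry 0 b); rewrite mxE.
exact: is_derive_unique (rep_time (fsF b) Wx).
Qed.

(** The pulled-back theory forms the induced connection with the image of 1/2, the coordinate
    representation with the constant 1/2 of the second ring. *)
Let rho_half : rho halfU = smf_cst WW 2^-1.
Proof.
apply: smf_eq => -[t x] Wx.
by rewrite (rho_rep (@rep_cst _ _ U _) Wx) (@rep_cst _ _ WW _ _ _ Wx).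
Qed.

Let Ds_comm i j x : Ds i (Ds j x) = Ds j (Ds i x).
Proof. exact: der_comm. Qed.

Let Dt_comm i x : Dt (Ds i x) = Ds i (Dt x).
Proof. exact: der_comm. Qed.

Let DT i j b : Ds i (T j b 0) = Ds j (T i b 0).
Proof.
have E k : T k b 0 = Ds k (fs b) by exact: mxE.
transitivity (Ds i (Ds j (fs b))); first exact: congr1 (E j).
exact: etrans (Ds_comm i j (fs b)) (congr1 (Ds j) (esym (E i))).
Qed.

Let DtT i b : Dt (T i b 0) = Ds i (X b 0).
Proof.
have E : T i b 0 = Ds i (fs b) by exact: mxE.
have EX : X b 0 = Dt (fs b) by exact: mxE.
transitivity (Dt (Ds i (fs b))); first exact: congr1 E.
exact: etrans (Dt_comm i (fs b)) (congr1 (Ds i) (esym EX)).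
Qed.

Let tU_mul x y : tU (x * y) = tU x * y + x * tU y.
Proof. exact: der_mul. Qed.

Let tU_comm i x : tU (dU i x) = dU i (tU x).
Proof. exact: der_comm. Qed.

Let evol :=
  @evolution (smf U) (smf WW) n rho dU tU halfU halfU2 gs gis
  dU_mul dU_comm gs_sym gis_sym gs_inv m T N his complete
  tU_mul tU_comm gs_flow Ds Dt X H Ds_lifts Dt_lifts Ds_comm Dt_comm DT DtT
  mcf his_sym his_inv NN NT (erefl H).

Let A t := second_form (G t) (F t) (e0 t).
Let Hc t := mean_curvature (G t) (F t) (e0 t).
Let Amix t x := raise1 (invmx (h t x)) (fun i j => A t i j x).
Let Aup t x := raise2 (invmx (h t x)) (fun i j => A t i j x).
Let Tx t x i := pd i (F t) x.
Let Rict t x i j := Ric (G t) (F t x) (Tx t x i) (Tx t x j).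
Let Rmt t x i j k l :=
  Rm (G t) (F t x) (Tx t x i) (Tx t x j) (Tx t x k) (Tx t x l).
Let Rtr t x k j := \sum_l \sum_p invmx (h t x) l p * Rmt t x p k l j.
Let norm2 t x := \sum_k \sum_l Aup t x k l * A t k l x.

Let Rict_rep i j : rep (form2 (fun a b => rho (ricci_tensor dU halfU gs gis a
  b))
  (T i) (T j)) (fun t x => Rict t x i j).
Proof. exact: rep_form2 (fun a b => rho_rep (rep_ricci gsG gisG a b)) _ _. Qed.

Let Rmt_rep i j k l : rep (form4 (fun a b c d =>
  rho (curv_low dU halfU gs gis a b c d)) (T i) (T j) (T k) (T l))
  (fun t x => Rmt t x i j k l).
Proof.
exact: rep_form4 (fun a b c d => rho_rep (rep_curv_low gsG gisG a b c d)) _ _ _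
  _.
Qed.

Let amix_rep i j : rep (\sum_q his i q * a q j) (fun t x => Amix t x i j).
Proof. exact: rep_sum (fun q => repM (hisE i q) (a_rep q j)). Qed.

Let aup_rep i j : rep (\sum_p \sum_q his i p * his j q * a p q)
  (fun t x => Aup t x i j).
Proof.
exact: rep_sum (fun p => rep_sum _ _ (fun q =>
  repM (repM (hisE i p) (hisE j q)) (a_rep p q))).
Qed.

Let norm2_rep : rep (\sum_k \sum_l (\sum_p \sum_q his k p * his l q * a p q) *
  a k l)
  norm2.
Proof.
exact: rep_sum (fun k => rep_sum _ _ (fun l => repM (aup_rep k l) (a_rep k l))).
Qed.

Let Rtr_rep k j : rep (\sum_l \sum_p his l p * form4 (fun a b c d =>
  rho (curv_low dU halfU gs gis a b c d)) (T p) (T k) (T l) (T j))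
  (fun t x => Rtr t x k j).
Proof.
exact: rep_sum (fun l => rep_sum _ _ (fun p => repM (hisE l p) (Rmt_rep p k l
  j))).
Qed.

Lemma evolution_metric t x i j : W (t, x) ->
  is_derive t (1 : R) (fun s => h s x i j)
    (- 2 * Rict t x i j - 2 * Hc t x * A t i j x).
Proof.
move=> Wx; have [E _ _] := evol.
have := rep_time (h_rep i j) Wx; rewrite [der _ _](E i j).
rewrite (repB (repM (repN (@rep_nat _ _ WW 2)) (Rict_rep i j))
  (repM (repM (@rep_nat _ _ WW 2) H_rep) (a_rep i j)) Wx).
exact.
Qed.

Lemma evolution_second_form t x i j : W (t, x) ->
  is_derive t (1 : R) (fun s => A s i j x)
    (laplacian2 (h t) (A t) i j x
     - \sum_k Amix t x k i * Rtr t x k j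
     - \sum_k Amix t x k j * Rtr t x k i
     + 2 * (\sum_k \sum_l Aup t x k l * Rmt t x k i l j)
     - 2 * Hc t x * (\sum_k A t i k x * Amix t x k j)
     + norm2 t x * A t i j x
     + nablaRm (G t) (F t x) (e0 t x) (e0 t x) (Tx t x i) (e0 t x) (Tx t x j)).
Proof.
move=> Wx; have [_ E _] := evol.
have := rep_time (a_rep i j) Wx; rewrite [der _ _](E i j) rho_half.
have mixR k l := rep_sum (index_enum 'I_m) predT (fun p =>
  repM (amix_rep p k) (Rtr_rep p l)).
have n4 p b c d q : rep (nab4 dU (chr dU halfU gs gis)
    (curv_low dU halfU gs gis) p b c d q)
    (fun t => nabla4 (G t) (riem (G t)) p b c d q).
  apply: (rep_nab4 gsG gisG (T' := fun t => riem (G t))) => *.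
  exact: rep_curv_low.
have nR := rep_form5 (fun p b c d q => rho_rep (n4 p b c d q))
  NE NE (TE i) NE (TE j).
rewrite (repD (repD (repB (repD (repB (repB
  (rep_laplacian2 h_rep hisE i j a_rep)
  (mixR i j)) (mixR j i))
  (repM (@rep_nat _ _ WW 2) (rep_sum _ _ (fun k => rep_sum _ _ (fun l =>
    repM (aup_rep k l) (Rmt_rep k i l j))))))
  (repM (repM (@rep_nat _ _ WW 2) H_rep) (rep_sum _ _ (fun k =>
    repM (a_rep i k) (amix_rep k j)))))
  (repM norm2_rep (a_rep i j))) nR Wx).
exact.
Qed.

Lemma evolution_mean_curvature t x : W (t, x) ->
  is_derive t (1 : R) (fun s => Hc s x)
    (laplacian (h t) (Hc t) x
     + 2 * (\sum_i \sum_j Aup t x i j * Rict t x i j)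
     + norm2 t x * Hc t x
     + nablaRic (G t) (F t x) (e0 t x) (e0 t x) (e0 t x)).
Proof.
move=> Wx; have [_ _ E] := evol.
have := rep_time H_rep Wx; rewrite [der _ _]E rho_half.
have n2 p b c : rep (nab2 dU (chr dU halfU gs gis)
    (ricci_tensor dU halfU gs gis) p b c)
    (fun t => nabla2 (G t) (ricci (G t)) p b c).
  apply: (rep_nab2 gsG gisG (T' := fun t => ricci (G t))) => *.
  exact: rep_ricci.
have nR := rep_form3 (fun p b c => rho_rep (n2 p b c)) NE NE NE.
rewrite (repD (repD (repD (rep_laplacian h_rep hisE H_rep)
  (repM (@rep_nat _ _ WW 2) (rep_sum _ _ (fun i => rep_sum _ _ (fun j =>
    repM (aup_rep i j) (Rict_rep i j))))))
  (repM norm2_rep H_rep)) nR Wx).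
exact.
Qed.

End Flow.

(** A global unit normal may fail to exist, so the equations are read in a pair of charts over an
    open set [W] of times and parameters on which a smooth unit normal [e0] is given. *)
Theorem proposition4 (R : realType) (m : nat)
    (M : manifold R m.+1) (S : manifold R m)
    (J : set R) (J_open : open J) (J_itv : is_interval J)
    (g : metric_family M) (g_metric : riemannian_metrics J g)
    (g_flow : ricci_flow J g)
    (e : R -> S -> M) (e_imm : smooth_immersions J e)
    (e_flow : mean_curvature_flow J e g)
    (phi : chart R m S) (phi_atlas : atlas S phi)
    (psi : chart R m.+1 M) (psi_atlas : atlas M psi)
    (W : set (R * 'rV[R]_m)) (W_open : open W)
    (W_sub : W `<=` rep_domain J e phi psi)
    (e0 : R -> 'rV[R]_m -> 'rV[R]_m.+1)
    (e0_smooth : smooth_on W (fun z => e0 z.1 z.2))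
    (e0_normal : forall t x, W (t, x) ->
       unit_normal (g t psi) (local_rep e phi psi t) x (e0 t x)) :
  let G := fun t => g t psi in
  let F := fun t => local_rep e phi psi t in
  let h := fun t => pullback_metric (G t) (F t) in
  let A := fun t => second_form (G t) (F t) (e0 t) in
  let H := fun t => mean_curvature (G t) (F t) (e0 t) in
  forall (t : R) (x : 'rV[R]_m), W (t, x) ->
  let T := fun i => pd i (F t) x in
  let N := e0 t x in
  let hi := invmx (h t x) in
  let Ax := fun i j => A t i j x in
  let Amix := raise1 hi Ax in
  let Aup := raise2 hi Ax in
  let normA2 := \sum_k \sum_l Aup k l * Ax k l in
  let Rict := fun i j => Ric (G t) (F t x) (T i) (T j) in
  let Rmt := fun i j k l => Rm (G t) (F t x) (T i) (T j) (T k) (T l) in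
  let Rtr := fun k j => \sum_l \sum_p hi l p * Rmt p k l j in
  [/\ forall i j, is_derive t (1 : R) (fun s : R => h s x i j)
        (- 2 * Rict i j - 2 * H t x * Ax i j),
      forall i j, is_derive t (1 : R) (fun s : R => A s i j x)
        (laplacian2 (h t) (A t) i j x
         - \sum_k Amix k i * Rtr k j
         - \sum_k Amix k j * Rtr k i
         + 2 * (\sum_k \sum_l Aup k l * Rmt k i l j)
         - 2 * H t x * (\sum_k Ax i k * Amix k j)
         + normA2 * Ax i j
         + nablaRm (G t) (F t x) N N (T i) N (T j)) &
      is_derive t (1 : R) (fun s : R => H s x)
        (laplacian (h t) (H t) x
         + 2 * (\sum_i \sum_j Aup i j * Rict i j)
         + normA2 * H t x
         + nablaRic (G t) (F t x) N N N)].
Proof.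
move=> G F h A H t x Wx; split=> [i j|i j|].
- exact: (evolution_metric J_open g_metric g_flow e_imm e_flow phi_atlas
    psi_atlas W_open W_sub e0_smooth e0_normal i j Wx).
- exact: (evolution_second_form J_open g_metric g_flow e_imm e_flow phi_atlas
    psi_atlas W_open W_sub e0_smooth e0_normal i j Wx).
- exact: (evolution_mean_curvature J_open g_metric g_flow e_imm e_flow phi_atlas
    psi_atlas W_open W_sub e0_smooth e0_normal Wx).
Qed.
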